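(* Up to isomorphism, there are exactly six Isaacs groups of degree $4$. Exactly four of them are $2$-closed, and each of these four has a normal Sylow $2$-subgroup that is semi-extraspecial. The other two are not $2$-closed, and for each of these two groups $G$ the subgroup $O_2(G)$ has nilpotence class $2$.
   Context: All groups are finite. For an integer $e > 1$, a group $G$ is an Isaacs group of degree $e$ if $|G| = e^4 - e^3$ and $d = e^2 - e$ is the degree of some irreducible complex character of $G$ (so that $|G| = d(d+e)$); for $e = 4$ this means $|G| = 192$ and $G$ has an irreducible character of degree $12$. A group is $2$-closed if it has a normal Sylow $2$-subgroup. $O_2(G)$ is the largest normal $2$-subgroup of $G$. A $p$-group $P$ is semi-extraspecial if $P/M$ is extraspecial for every maximal subgroup $M$ of $Z(P)$. *)

(* Defs.v *)
From mathcomp Require Import all_boot all_order all_algebra all_fingroup.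
From mathcomp Require Import all_solvable all_field all_character.

Set Implicit Arguments.
Unset Strict Implicit.
Unset Printing Implicit Defensive.

Import GroupScope.

(* The difference e ^ 4 - e ^ 3 is in nat, but never truncated since 1 < e;  *)
(* likewise for e ^ 2 - e.                                                   *)
Definition isaacs_group (e : nat) (gT : finGroupType) (G : {group gT}) : Prop :=
  [/\ (1 < e)%N,
      #|G| = (e ^ 4 - e ^ 3)%N
    & exists i : Iirr G, ('chi_i 1%g = (e ^ 2 - e)%N%:R)%R].

Definition pclosed (p : nat) (gT : finGroupType) (G : {group gT}) : bool :=
  [exists P : {group gT}, p.-Sylow(G) P && (P <| G)].

Definition semi_extraspecial (p : nat) (gT : finGroupType) (P : {group gT}) :
    Prop :=
  p.-group P /\
  (forall M : {group gT}, maximal M 'Z(P) -> extraspecial (P / M)).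

(* Main.v *)
(* Let chi have degree 12 in a group G of order 192, and let n be a central   *)
(* involution of a Sylow 2-subgroup lying in O_2(G).  As chi is large,        *)
(* Z(G) = 1, so n has three conjugates, whose product is central; hence they  *)
(* span a normal Klein four-group N.  Comparing sums of squares of degrees,   *)
(* chi is the only irreducible character whose kernel does not contain N, so  *)
(* it vanishes outside N and every coset gN other than N lies in one class.   *)
(* An element t of order 3 permutes the involutions of N regularly.  Either   *)
(* O_2(G) has order 64, squares and commutators lie in N, and t acts on       *)
(* O_2(G) / N freely or with four fixed points, each case leaving two sets of *)
(* relations; or O_2(G) has order 32, the fixed points of t in O_2(G) / N     *)
(* have order 2, and G is an extension of O_2(G) by S_3, again with two sets  *)
(* of relations.  Each set is a polycyclic presentation of order 192, so it   *)
(* determines G.  The six models are twisted products of F_4^3 by Z/3, for    *)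
(* which the relations and the Camina property of N are checked by            *)
(* computation; conversely the Camina property yields a character of degree   *)
(* 12.  Numbers of cube roots of unity and of pairs of commuting involutions  *)
(* distinguish the models.                                                    *)

From HB Require Import structures.
Require Import Defs.
From mathcomp Require Import all_boot all_order all_algebra all_fingroup.
From mathcomp Require Import all_solvable all_field all_character.

Set Implicit Arguments.
Unset Strict Implicit.
Unset Printing Implicit Defensive.

Import GroupScope.

From mathcomp Require Import zify.

(** * Polycyclic presentations *)

(** A character of degree 12 can be traded for pure group structure. The irreducible characters
    nontrivial on a normal four-group [N] contribute exactly 192 - 48 = 144 = 12^2 to the sum of
    squared degrees. A character of degree 12 nontrivial on [N] is therefore the only one of that
    kind, and orthogonality puts each coset [g *: N] other than [N] into the class of [g].
    [isaacs_camina] finds such an [N] and [irr12_camina] proves its Camina property; [camina_irr12]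
    is the way back, used for the models.

    Let [t] have order 3. It acts on [N] as a primitive cube root of unity acts on F_4, and counting
    its fixed points modulo 3 leaves few possible orders for a [t]-invariant 2-subgroup. If O_2(G)
    has order 64, these counts show that [N] is its centre, derived subgroup and Frattini subgroup;
    commutation becomes a bilinear map into [N] and squaring a quadratic map. By the Camina
    property, commutation with any element outside [N] is onto [N] ([commg_onto]), which is what
    semi-extraspecial means here. If [t] acts freely, the remaining choice is whether squaring is
    isotropic or anisotropic ([free_satisfies]); if [t] has four fixed points, it is whether a
    well-chosen [x] squares to 1 ([fixed_satisfies]). If O_2(G) has order 32, [t] fixes a single
    nontrivial [c] in it, [c] is the square of an element [s] inverting [t], and again the square of
    some [x] decides ([core_satisfies]).

    Each case ends in generators satisfying one of six polycyclic presentations of order 192. Such a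
    presentation bounds the order of the groups satisfying it ([pc_card_le]), so two groups
    attaining the bound are isomorphic ([pc_isog]). The models [law] realize all six presentations,
    and counting cube roots of 1 and commuting involutions separates them
    ([twisted_invariants_law]). *)

Definition eval_word (gT : finGroupType) (s : seq gT) (w : seq nat) : gT :=
  foldr (fun k x => nth 1 s k * x) 1 w.

(* The [j]-th entry [(p, w, cs)] of a presentation stands for the relations   *)
(* [s_j ^+ p = w] and [s_i ^ s_j = cs_i] for [i < j]; the words [w] and [cs_i]*)
(* only involve generators of index less than [j].                           *)
Definition pc_presentation := seq (nat * seq nat * seq (seq nat)).

Definition pc_entry (P : pc_presentation) (j : nat) :=
  nth (0, [::], [::]) P j.

Definition pc_wf (P : pc_presentation) : bool :=
  all (fun j => [&& 0 < (pc_entry P j).1.1,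
                    all (gtn j) (pc_entry P j).1.2,
                    size (pc_entry P j).2 == j
                  & all (all (gtn j)) (pc_entry P j).2])
      (iota 0 (size P)).

Definition pc_order (P : pc_presentation) : nat := \prod_(e <- P) e.1.1.

Definition pc_sat (P : pc_presentation) (gT : finGroupType) (s : seq gT) :=
  (size s == size P) &&
  all (fun j =>
         (nth 1 s j ^+ (pc_entry P j).1.1 == eval_word s (pc_entry P j).1.2) &&
         all (fun i => nth 1 s i ^ nth 1 s j ==
                       eval_word s (nth [::] (pc_entry P j).2 i))
             (iota 0 j))
      (iota 0 (size P)).

Section Presentations.

Implicit Types gT hT : finGroupType.

Lemma card_join_cycle gT (H : {group gT}) (g : gT) (p : nat) :
  0 < p -> g \in 'N(H) -> g ^+ p \in H -> #|H <*> <[g]>| <= #|H| * p.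
Proof.
move=> p_gt0 nHg gpH.
have nHc : <[g]> \subset 'N(H) by rewrite cycle_subG.
have nHK : H <*> <[g]> \subset 'N(H) by rewrite join_subG normG.
rewrite -(Lagrange (joing_subl H <[g]>)) leq_mul2l; apply/orP; right.
rewrite -(card_quotient nHK) quotientYidl // quotient_cycle //.
apply: dvdn_leq => //; rewrite order_dvdn -morphX //.
by apply/eqP/coset_id.
Qed.

Lemma eval_word_mem gT (G : {group gT}) (s : seq gT) (w : seq nat) :
  {in w, forall k, nth 1 s k \in G} -> eval_word s w \in G.
Proof.
elim: w => [|k w IHw] sG; first exact: group1.
by rewrite /= groupM ?sG ?mem_head // IHw // => l wl; rewrite sG // inE wl orbT.
Qed.

(** By induction on prefixes. The conjugation relations make each generator normalize the subgroup
    generated by the previous ones, and the power relation puts its [p]-th power there, so it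
    multiplies the order by at most [p]. The relations might collapse, hence only a bound. *)
Lemma pc_card_le gT (P : pc_presentation) (s : seq gT) :
  pc_wf P -> pc_sat P s -> #|<<[set x in s]>>| <= pc_order P.
Proof.
move=> /allP wfP /andP[/eqP szs /allP satP].
suff IH n : n <= size P -> #|<<[set x in take n s]>>| <= pc_order (take n P).
  by have := IH (size P) (leqnn _); rewrite take_size -szs take_size.
elim: n => [|n IHn] ltnP.
  have nil0 : [set x in take 0 s] = set0 :> {set gT}.
    by apply/setP=> x; rewrite take0 !inE.
  by rewrite nil0 gen0 cards1 take0 /pc_order big_nil.
have n_in : n \in iota 0 (size P) by rewrite mem_iota.
have /and4P[p_gt0 /allP w_lt /eqP szc /allP c_lt] := wfP _ n_in.
have /andP[/eqP relp /allP relc] := satP _ n_in.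
set H := <<[set x in take n s]>> in IHn.
have ltns : n < size s by rewrite szs.
have genH k : k < n -> nth 1 s k \in H.
  move=> ltkn; apply: mem_gen; rewrite inE -(nth_take 1 ltkn).
  by rewrite mem_nth // size_take ltns.
have evH w : all (gtn n) w -> eval_word s w \in H.
  by move=> /allP wlt; apply: eval_word_mem => k /wlt; apply: genH.
have nHg : nth 1 s n \in 'N(H).
  rewrite inE -genJ gen_subG.
  apply/subsetP=> y /imsetP[x]; rewrite inE => /(nthP 1)[i].
  rewrite size_take ltns => ltin <- ->; rewrite nth_take //.
  have := relc i; rewrite mem_iota => /(_ ltin)/eqP->.
  by apply: evH; apply/c_lt/mem_nth; rewrite szc.
have gpH : nth 1 s n ^+ (pc_entry P n).1.1 \in H by rewrite relp; apply: evH; apply/allP.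
have -> : pc_order (take n.+1 P) = (pc_order (take n P) * (pc_entry P n).1.1)%N.
  by rewrite (take_nth (0, [::], [::])) // /pc_order big_rcons.
rewrite (take_nth 1) //; apply: leq_trans (leq_mul (IHn (ltnW ltnP)) (leqnn _)).
apply: leq_trans (card_join_cycle p_gt0 nHg gpH); apply: subset_leq_card.
rewrite gen_subG; apply/subsetP=> x; rewrite inE mem_rcons inE.
case/predU1P=> [->|xs]; first by rewrite mem_gen // inE cycle_id orbT.
by rewrite mem_gen // inE mem_gen ?inE // .
Qed.

Lemma eval_word_pair gT hT (s : seq gT) (s' : seq hT) (w : seq nat) :
  size s = size s' ->
  eval_word (zip s s') w = (eval_word s w, eval_word s' w).
Proof.
by move=> szs; elim: w => //= k w ->; rewrite -[1]/(1, 1) nth_zip.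
Qed.

Lemma pc_sat_zip gT hT (P : pc_presentation) (s : seq gT) (s' : seq hT) :
  pc_sat P s -> pc_sat P s' -> pc_sat P (zip s s').
Proof.
case/andP=> /eqP szs /allP satP /andP[/eqP szs' /allP satP'].
have szss : size s = size s' by rewrite szs szs'.
rewrite /pc_sat size_zip -szss minnn szs eqxx /=.
apply/allP=> j jP; have /andP[/eqP pj /allP cj] := satP j jP.
have /andP[/eqP pj' /allP cj'] := satP' j jP.
have nthz k : nth 1 (zip s s') k = (nth 1 s k, nth 1 s' k).
  by rewrite -[1]/(1, 1) nth_zip.
have expz (a : gT) (b : hT) n : (a, b) ^+ n = (a ^+ n, b ^+ n).
  by elim: n => // n IHn; rewrite !expgS IHn.
rewrite nthz expz eval_word_pair // pj pj' eqxx /=.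
apply/allP=> i ij; rewrite !nthz eval_word_pair //.
by rewrite -(eqP (cj i ij)) -(eqP (cj' i ij)).
Qed.

Lemma morphim_gen_seq gT hT (D : {group gT}) (f : {morphism D >-> hT})
    (s : seq gT) :
  {subset s <= D} -> f @* <<[set x in s]>> = <<[set x in map f s]>>.
Proof.
move=> sD; rewrite morphim_gen; last by apply/subsetP=> x; rewrite inE => /sD.
congr <<_>>; apply/setP=> y; rewrite !inE; apply/morphimP/mapP.
  by case=> x _; rewrite inE => xs ->; exists x.
by case=> x xs ->; exists x; rewrite ?inE ?sD.
Qed.

(* The diagonal subgroup of the product is generated by elements satisfying  *)
(* the same relations, so both of its projections are injective.             *)
Lemma pc_isog gT hT (P : pc_presentation) (s : seq gT) (s' : seq hT)
    (G : {group gT}) (H : {group hT}) :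
    pc_wf P -> pc_sat P s -> pc_sat P s' ->
    <<[set x in s]>> = G -> <<[set x in s']>> = H ->
    #|G| = pc_order P -> #|H| = pc_order P ->
  G \isog H.
Proof.
move=> wfP satP satP' genG genH oG oH.
have szss : size s = size s'.
  by move: satP satP' => /andP[/eqP-> _] /andP[/eqP-> _].
pose K : {group gT * hT} := <<[set x in zip s s']>>%G.
have leK : #|K| <= pc_order P by apply: pc_card_le => //; apply: pc_sat_zip.
have inT (rT : finGroupType) (r : seq rT) : {subset r <= setT} by move=> x; rewrite inE.
pose f1 := [morphism of (fun x : gT * hT => x.1)].
pose f2 := [morphism of (fun x : gT * hT => x.2)].
have im1 : f1 @* K = G.
  by rewrite morphim_gen_seq // -[map _ _]/(unzip1 _) unzip1_zip ?szss.
have im2 : f2 @* K = H.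
  by rewrite morphim_gen_seq // -[map _ _]/(unzip2 _) unzip2_zip ?szss.
(* [K] has order at most [pc_order P] and maps onto a group of exactly that order. *)
have inj1 : 'injm (restrm (subsetT K) f1).
  rewrite -card_im_injm morphim_restrm setIid im1 oG eqn_leq leK -oG -im1.
  by rewrite leq_morphim.
have inj2 : 'injm (restrm (subsetT K) f2).
  rewrite -card_im_injm morphim_restrm setIid im2 oH eqn_leq leK -oH -im2.
  by rewrite leq_morphim.
have iso1 : K \isog G.
  by rewrite -im1; apply/isogP; exists (restrm_morphism (subsetT K) f1); rewrite // morphim_restrm setIid.
have iso2 : K \isog H.
  by rewrite -im2; apply/isogP; exists (restrm_morphism (subsetT K) f2); rewrite // morphim_restrm setIid.
by apply: isog_trans iso2; rewrite isog_sym.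
Qed.

End Presentations.

(** * Characters of degree 12 *)

(** The structural substitute for a character of degree 12. The last clause is the Camina condition:
    multiplying an element outside [N] by elements of [N] does not leave its class. *)
Definition camina_kernel (gT : finGroupType) (G N : {group gT}) : Prop :=
  [/\ N <| G, #|N| = 4, 2.-abelem N,
      {in N^#, forall n, #|n ^: G| = 3}
    & {in G :\: N & N, forall g n, g * n \in g ^: G}].

Section CaminaCharacters.

Variables (gT : finGroupType) (G N : {group gT}).
Hypotheses (oG : #|G| = 192) (nNG : N <| G) (oN : #|N| = 4).

Local Open Scope ring_scope.
Import Order.TTheory GRing.Theory Num.Theory.

Lemma sum_irr1_notker :
  \sum_(i | ~~ (N \subset cfker 'chi[G]_i)) 'chi_i 1%g ^+ 2 = 144%:R.
Proof.
have := irr_sum_square G; rewrite (bigID (fun i => N \subset cfker 'chi[G]_i)) /=.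
have ge0 (i : Iirr G) : `|'chi_i 1%g| ^+ 2 = 'chi_i 1%g ^+ 2.
  by rewrite ger0_norm // char1_ge0 ?irr_char.
have <- : \sum_(i | N \subset cfker 'chi[G]_i) `|'chi_i 1%g| ^+ 2
        = \sum_(i | N \subset cfker 'chi[G]_i) 'chi_i 1%g ^+ 2.
  by apply: eq_bigr => i _; apply: ge0.
rewrite -(sum_norm_irr_quo (group1 G) nNG) morph1.
have -> : \sum_i `|'chi[G / N]_i 1%g| ^+ 2 = 48%:R.
  rewrite (eq_bigr (fun i => 'chi_i 1%g ^+ 2)) => [|i _]; last first.
    by rewrite ger0_norm // char1_ge0 ?irr_char.
  by rewrite irr_sum_square card_quotient ?normal_norm // -divgS ?normal_sub // oG oN.
rewrite oG => /(canRL (addKr _)) ->.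
by rewrite addrC -natrB.
Qed.

(** The regular characters of [G] and of [G / N] both vanish at [g]; they differ by the single term
    of [i]. *)
Lemma irr_notker_vanish (i : Iirr G) (g : gT) :
    'chi_i 1%g = 12%:R -> ~~ (N \subset cfker 'chi_i) ->
    (forall j : Iirr G, ~~ (N \subset cfker 'chi_j) -> j = i) ->
  g \in G -> g \notin N -> 'chi_i g = 0.
Proof.
move=> chi1 kerN uniq_i Gg N'g.
have nNg : g \in 'N(N) by rewrite (subsetP (normal_norm nNG)).
have reg0 (rT : finGroupType) (H : {group rT}) (h : rT) :
    h != 1%g -> \sum_(j : Iirr H) 'chi_j 1%g * 'chi_j h = 0.
  move=> nt_h; have := cfRegE H h; rewrite (negPf nt_h) mulr0n cfReg_sum sum_cfunE.
  by move=> sum0; rewrite -[RHS]sum0; apply: eq_bigr => j _; rewrite cfunE.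
have nt_g : g != 1%g by apply: contraNneq N'g => ->.
have := reg0 _ G g nt_g; rewrite (bigID (fun j => N \subset cfker 'chi[G]_j)) /=.
have -> : \sum_(j | N \subset cfker 'chi[G]_j) 'chi_j 1%g * 'chi_j g = 0.
  have nt_Ng : coset N g != 1%g by apply: contraNneq N'g => /coset_idr->.
  rewrite -[RHS](reg0 _ (G / N)%G _ nt_Ng) (reindex _ (mod_Iirr_bij nNG)) /=.
  apply/eq_big => [j | j _]; first by rewrite mod_IirrE ?cfker_mod.
  by rewrite mod_IirrE // !cfModE // morph1.
rewrite add0r (big_pred1 i) => [|j]; last first.
  by rewrite /=; apply/idP/eqP=> [/uniq_i | ->].
by rewrite chi1 => /eqP; rewrite mulf_eq0 pnatr_eq0 /= => /eqP.
Qed.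

(** Since 12^2 exhausts the sum 144, only ['chi_i] is nontrivial on [N]. It vanishes outside [N] and
    the other characters are constant on cosets of [N], so no character separates [g] from
    [g * n]. *)
Lemma irr12_camina (i : Iirr G) :
    'chi_i 1%g = 12%:R -> ~~ (N \subset cfker 'chi_i) ->
  {in G :\: N & N, forall g n, (g * n)%g \in g ^: G}.
Proof.
move=> chi1 kerN g n /setDP[Gg N'g] Nn.
have Gn : n \in G by rewrite (subsetP (normal_sub nNG)).
have uniq_i (j : Iirr G) : ~~ (N \subset cfker 'chi_j) -> j = i.
  move=> kerj; apply/eqP/idPn=> neq_ji; have := sum_irr1_notker.
  rewrite (bigD1 i) //= chi1.
  rewrite -natrX => /(canRL (addKr _)); rewrite addNr => /eqP.
  rewrite psumr_eq0 => [/allP/(_ j (mem_index_enum j))|k _]; last first.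
    by rewrite exprn_ge0 // ltW ?irr1_gt0.
  by rewrite kerj neq_ji /= expf_eq0 /= (negPf (irr1_neq0 j)).
have chi_gn (j : Iirr G) : 'chi_j (g * n)%g = 'chi_j g.
  have [kerj | kerj] := boolP (N \subset cfker 'chi_j).
    by rewrite cfkerMr // (subsetP kerj).
  have vanish := irr_notker_vanish chi1 kerN uniq_i.
  by rewrite (uniq_i j kerj) (vanish g) // vanish ?(groupMr g Nn) // groupM.
(* Were the two elements not conjugate, a sum of squared norms would be 0, although the trivial
   character contributes 1. *)
apply/idPn=> not_conj; have := second_orthogonality_relation (g * n)%g Gg.
rewrite (negPf not_conj) mulr0n => /eqP; rewrite psumr_eq0 => [|j _]; last first.
  by rewrite chi_gn mul_conjC_ge0.
move/allP/(_ 0 (mem_index_enum 0)) => /=.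
by rewrite irr0 !cfun1E Gg groupM // conjC1 mulr1 oner_eq0.
Qed.

Hypothesis clN : {in N^#, forall n, #|n ^: G| = 3}.
Hypothesis camN : {in G :\: N & N, forall g n, (g * n)%g \in g ^: G}.

(** The preimage [K] of the centralizer of the coset acts on [g *: N] by conjugation, transitively
    by the Camina condition. Hence ['C_G[g]] has index 4 in [K], and so has the order of [K] divided
    by 4. *)
Lemma camina_card_cent1 (g : gT) :
  g \in G :\: N -> #|'C_(G / N)[coset N g]| = #|'C_G[g]|.
Proof.
move=> GNg; have [Gg N'g] := setDP GNg.
have [sNG nNGs] := andP nNG.
have nNg := subsetP nNGs g Gg.
pose K := (coset N @*^-1 'C_(G / N)[coset N g])%G.
have sKG : K \subset G by rewrite -(quotientGK nNG) morphpreS ?subsetIl.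
have memK h : h \in G -> (h \in K) = (g ^ h \in g *: N)%g.
  move=> Gh; have nNh := subsetP nNGs h Gh.
  have nNgh : (g ^ h)%g \in 'N(N) by rewrite groupJ.
  rewrite -(norm_rlcoset nNg); apply/idP/rcoset_kercosetP => //.
    by case/morphpreP=> _ /setIP[_ /cent1P cgh]; rewrite morphJ // /conjg -cgh mulKg.
  rewrite morphJ // => cgh; apply/morphpreP; split=> //.
  rewrite inE mem_quotient //=; apply/cent1P/commute_sym.
  by apply/commgP; rewrite commgEl cgh mulVg.
have sCK : 'C_G[g] \subset K.
  apply/subsetP=> h /setIP[Gh /cent1P cgh]; rewrite memK // /conjg -cgh mulKg.
  exact: lcoset_refl.
have := index_cent1 K g; rewrite (_ : g ^: K = (g *: N)%g).
  rewrite card_lcoset oN (_ : 'C_K[g] = 'C_G[g]) => [indK|].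
    have := Lagrange sCK; rewrite indK card_cosetpre oN mulnC.
    by move/eqP; rewrite eqn_pmul2l // => /eqP.
  apply/eqP; rewrite eqEsubset setSI //= subsetI sCK subsetIr //.
apply/setP=> y; apply/imsetP/lcosetP=> [[h Kh ->] | [n Nn ->]].
  by apply/lcosetP; rewrite -memK // (subsetP sKG).
have /imsetP[h Gh gn_gh] := camN GNg Nn; exists h => //.
by rewrite memK // -gn_gh mem_lcoset mulKg.
Qed.

(** Any irreducible character nontrivial on [N] works. By [camina_card_cent1] the characters of
    [G / N] already account for all of the second orthogonality relation at [g] outside [N], so this
    one vanishes there. It takes one value [a] on the involutions of [N]; orthogonality gives d + 3a
    = 0 and d^2 + 3|a|^2 = 192 for the degree d, whence d^2 = 144. *)
Lemma camina_irr12 : exists i : Iirr G, 'chi_i 1%g = 12%:R.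
Proof.
have [sNG nNGs] := andP nNG.
have [i kerN] : exists i : Iirr G, ~~ (N \subset cfker 'chi_i).
  apply/existsP; rewrite -negb_forall; apply/negP=> /forallP kerN.
  have : N \subset \bigcap_i cfker 'chi[G]_i by apply/bigcapsP.
  by rewrite TI_cfker_irr => /subset_leq_card; rewrite oN cards1.
have vanish g : g \in G :\: N -> 'chi_i g = 0.
  move=> GNg; have [Gg N'g] := setDP GNg.
  have := second_orthogonality_relation g Gg; rewrite class_refl mulr1n.
  rewrite -(camina_card_cent1 GNg) (bigID (fun j => N \subset cfker 'chi[G]_j)) /=.
  have := second_orthogonality_relation (coset N g) (mem_quotient N Gg).
  rewrite class_refl mulr1n => <-.
  rewrite -!(eq_bigr _ (fun _ _ => normCK _)) sum_norm_irr_quo // => /(canRL (addKr _)).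
  rewrite addNr => /eqP; rewrite psumr_eq0 => [/allP/(_ i (mem_index_enum i))|j _].
    by rewrite kerN expf_eq0 normr_eq0 => /eqP.
  by rewrite exprn_ge0.
have [n Nn nt_n] : exists2 n, n \in N & n != 1%g.
  by apply/trivgPn; rewrite -cardG_gt1 oN.
have clNn : n ^: G = N^#.
  have oN1 : #|N^#| = 3 by move: oN; rewrite (cardsD1 1%g N) group1 => -[].
  apply/eqP; rewrite eqEcard clN ?inE ?nt_n // oN1 leqnn andbT.
  apply/subsetP=> _ /imsetP[h Gh ->]; rewrite !inE conjg_eq1 nt_n.
  by rewrite memJ_norm // (subsetP nNGs).
pose a := 'chi_i n; pose d := 'chi_i 1%g.
have sumG (f : gT -> algC) : {in G :\: N, forall g, f g = 0} ->
    {in N^#, forall m, f m = f n} -> \sum_(g in G) f g = f 1%g + f n *+ 3.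
  move=> f0 fN; rewrite (big_setID N) /= (setIidPr sNG) addrC big1 // add0r.
  rewrite (big_setD1 1%g) //= (eq_bigr (fun _ => f n)) //; congr (_ + _).
  by rewrite sumr_const -clNn clN // !inE nt_n.
have chiN m : m \in N^# -> 'chi_i m = a.
  by rewrite -clNn => /imsetP[h Gh ->]; rewrite cfunJ.
have nz_i : i != 0 by apply: contraNneq kerN => ->; rewrite cfker_irr0.
have cG : #|G|%:R != 0 :> algC by rewrite neq0CG.
have d_eq : d = - (a *+ 3).
  have := first_orthogonality_relation i (0 : Iirr G); rewrite (negPf nz_i).
  move/eqP; rewrite mulf_eq0 invr_eq0 (negPf cG) /= => /eqP.
  rewrite (eq_bigr 'chi_i) => [|x Gx]; last first.
    by rewrite irr0 cfun1E groupV Gx mulr1.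
  by rewrite sumG // => /eqP; rewrite addr_eq0 => /eqP.
have d_ge0 : 0 <= d by rewrite ltW ?irr1_gt0.
have norm_eq : d ^+ 2 + `|a| ^+ 2 *+ 3 = 192%:R.
  have := first_orthogonality_relation i i; rewrite eqxx.
  move/(canRL (mulKf (invr_neq0 cG))); rewrite invrK mulr1 oG => <-.
  rewrite (eq_bigr (fun x => `|'chi_i x| ^+ 2)) => [|x Gx]; last first.
    by rewrite irr_inv normCK.
  rewrite sumG /= => [|g GNg|m Nm]; first by rewrite -/d (ger0_norm d_ge0).
    by rewrite vanish // normr0 expr0n.
  by rewrite chiN.
have sqr_d : d ^+ 2 = `|a| ^+ 2 *+ 9.
  by rewrite -(ger0_norm d_ge0) d_eq normrN normrMn exprMn_n.
have : d ^+ 2 * 4%:R = 12%:R ^+ 2 * 4%:R.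
  have -> : 12%:R ^+ 2 * 4%:R = 192%:R *+ 3 :> algC.
    by rewrite -natrX -natrM -mulrnA -[RHS]/((192 * 3)%:R).
  by rewrite -norm_eq mulrnDl -mulrnA -sqr_d mulr_natr -mulrSr.
move/(mulIf _) => sqr_eq; exists i; apply: (@pexpIrn _ 2); rewrite ?nnegrE //.
by rewrite sqr_eq // pnatr_eq0.
Qed.

End CaminaCharacters.

(** * Groups of order 192 and the normal four-group *)

Section Order192.

Variables (gT : finGroupType) (G : {group gT}).
Hypothesis oG : #|G| = 192.

Lemma card_Sylow2_192 (P : {group gT}) : 2.-Sylow(G) P -> #|P| = 64.
Proof.
by move/card_Hall->; rewrite oG p_part.
Qed.

(** Two distinct Sylow 2-subgroups meet in a group [D] of order at least 64 * 64 / 192, hence 32. It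
    has index 2 in both, so its normalizer properly contains a Sylow 2-subgroup, whose index 3 is
    prime; thus [D] is normal. *)
Lemma card_pcore_192 : #|'O_2(G)| = 64 \/ #|'O_2(G)| = 32.
Proof.
have [P sylP] := Sylow_exists 2 G; have [sPG pP _] := and3P sylP.
have oP := card_Sylow2_192 sylP.
have [nPG | not_nPG] := boolP (P <| G).
  by left; rewrite (normal_Hall_pcore sylP).
have [x Gx neqPx] : exists2 x, x \in G & P :^ x != P.
  move: not_nPG; rewrite /normal sPG /= => /subsetPn[x Gx].
  by rewrite inE => nPx; exists x => //; apply: contraNneq nPx => ->.
pose D := (P :&: P :^ x)%G.
have sDP : D \subset P := subsetIl _ _.
have sPxG : P :^ x \subset G by rewrite -(conjGid Gx) conjSg.
have oD : #|D| = 32.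
  have le_oD : 64 * 64 <= 192 * #|D|.
    have := mul_cardG P (P :^ x)%G; rewrite cardJg oP -oG => ->.
    by rewrite leq_mul // subset_leq_card // mul_subG.
  have : #|D| %| 64 by rewrite -oP cardSg.
  rewrite dvdn_divisors // -[divisors 64]/[:: 1; 2; 4; 8; 16; 32; 64]%N => oD.
  have neqD : #|D| != 64.
    rewrite -oP; apply: contraNneq neqPx => eqDP; rewrite eq_sym eqEcard cardJg leqnn andbT.
    have eqD : D :=: P by apply/eqP; rewrite eqEcard sDP eqDP leqnn.
    by rewrite -{1}eqD; apply: subsetIr.
  move: oD neqD le_oD; rewrite !inE.
  by case/or4P=> [|||/or4P[]] /eqP->.
have nDP : P \subset 'N(D).
  by apply/normal_norm/index2_normal; rewrite // -divgS // oP oD.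
have nDPx : P :^ x \subset 'N(D).
  apply/normal_norm/index2_normal; rewrite ?subsetIr //.
  by rewrite -divgS ?subsetIr // cardJg oP oD.
have nDG : D <| G.
  rewrite /normal (subset_trans sDP) //=; apply/setIidPl/eqP.
  rewrite eqEcard subsetIl oG /=.
  have : P \proper 'N_G(D).
    rewrite properE subsetI sPG nDP /=; apply: contra neqPx => sNP.
    by rewrite eqEcard cardJg leqnn andbT (subset_trans _ sNP) // subsetI sPxG.
  move/proper_card; rewrite oP.
  have: #|P| %| #|'N_G(D)| by rewrite cardSg // subsetI sPG.
  have: #|'N_G(D)| %| #|G| by rewrite cardSg // subsetIl.
  rewrite oP oG => dvd192 /dvdnP[k Dk]; rewrite Dk in dvd192 *.
  rewrite -[64]mul1n -[192]/(3 * 64)%N !ltn_pmul2r // leq_pmul2r //.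
  rewrite -[192]/(3 * 64)%N dvdn_pmul2r // in dvd192.
  by move: k dvd192 {Dk} => [|[|[|[|k]]]].
have sDO : D \subset 'O_2(G) by rewrite pcore_max // (pgroupS sDP).
have : #|'O_2(G)| %| 64 by rewrite -oP cardSg // (pcore_sub_Hall sylP).
have : 32 <= #|'O_2(G)| by rewrite -oD subset_leq_card.
rewrite dvdn_divisors // -[divisors 64]/[:: 1; 2; 4; 8; 16; 32; 64]%N !inE => le32 oO.
by move: oO le32; case/or4P=> [|||/or4P[]] /eqP-> // _; [right | left].
Qed.

Lemma pclosed_192 : pclosed 2 G = (#|'O_2(G)| == 64).
Proof.
apply/existsP/eqP=> [[P /andP[sylP nPG]] | oO].
  by rewrite (normal_Hall_pcore sylP) // card_Sylow2_192.
exists 'O_2(G)%G; rewrite pcore_normal andbT pHallE pcore_sub /= oO oG.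
by rewrite p_part.
Qed.

Lemma isaacs_camina :
  isaacs_group 4 G -> exists N : {group gT}, camina_kernel G N.
Proof.
case=> _ _ [i]; rewrite -[(4 ^ 2 - 4)%N]/12 => chi1.
(* The squared degree 144 is at most the index of the centre of the character, and exceeds half of
   192. *)
have Z1 : 'Z(('chi[G]_i)%R)%CF = 1.
  have := irr1_bound i; rewrite chi1 -GRing.natrX => -[+ _].
  rewrite Num.Theory.ler_nat => le144; apply/eqP; rewrite trivg_card_le1.
  have := Lagrange (cfcenter_sub ('chi_i)%R); rewrite oG; move: le144.
  by move: #|_| #|_ : _| => k l; nia.
have ZG1 : 'Z(G) = 1.
  have sZ : 'Z(G) \subset 'Z(('chi[G]_i)%R)%CF.
    by rewrite -(cap_cfcenter_irr G) (bigcap_inf i).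
  by rewrite Z1 in sZ; apply/trivgP.
have [P sylP] := Sylow_exists 2 G; have [sPG pP _] := and3P sylP.
have oP := card_Sylow2_192 sylP.
pose Q := 'O_2(G)%G; have nQG : Q <| G := pcore_normal 2 G.
have sQP : Q \subset P := pcore_sub_Hall sylP.
have ntQ : Q :!=: 1.
  by rewrite -cardG_gt1 /=; case: card_pcore_192 => ->.
have ntQZ : Q :&: 'Z(P) != 1.
  by rewrite (meet_center_nil (pgroup_nil pP)) // (normalS sQP sPG).
have [||n QZn on] := @Cauchy _ 2 (Q :&: 'Z(P))%G => //.
  have [_ []//] := pgroup_pdiv (pgroupS (subset_trans (subsetIl _ _) sQP) pP) ntQZ.
have [Qn /centerP[Pn cPn]] := setIP QZn.
have Gn : n \in G := subsetP sPG n Pn.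
have nt_n : n != 1 by rewrite -order_gt1 on.
have sPC : P \subset 'C_G[n].
  by rewrite subsetI sPG; apply/subsetP=> x Px; apply/cent1P/commute_sym; exact: cPn.
have cl_n : #|n ^: G| = 3.
  have nz : #|n ^: G| != 1%N.
    apply: contraNneq nt_n => cl1; rewrite -in_set1 -[[set 1]]/(1 : {set gT}) -ZG1.
    apply/centerP; split=> // x Gx; apply/commgP/conjg_fixP.
    have cln : [set n] = n ^: G.
      by apply/eqP; rewrite eqEcard sub1set class_refl cl1 cards1.
    by apply/set1P; rewrite cln memJ_class.
  move: nz; rewrite -index_cent1 -divgS ?subsetIl // oG.
  have /dvdnP[k oC] : 64 %| #|'C_G[n]| by rewrite -oP cardSg.
  have := cardSg (subsetIl G 'C[n]); rewrite oC oG -[192]/(3 * 64)%N dvdn_pmul2r //.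
  by case: k oC => [|[|[|[|k]]]].
have oC : #|'C_G[n]| = 64.
  have := Lagrange (subsetIl G 'C[n]); rewrite index_cent1 cl_n oG.
  by rewrite -[192]/(64 * 3)%N => /eqP; rewrite eqn_pmul2r // => /eqP.
have [||t Gt ot] := @Cauchy _ 3 G; rewrite ?oG //.
have cGt x : x \in G -> #[x] = 3 -> n ^ x != n.
  move=> Gx ox; apply/negP=> /eqP/conjg_fixP/commgP/commute_sym/cent1P cnx.
  by have := order_dvdG (_ : x \in 'C_G[n]); rewrite oC ox inE Gx cnx => /(_ isT).
have neq_nt := cGt t Gt ot.
have neq_nt2 : n ^ (t ^+ 2) != n.
  by rewrite cGt ?groupX // orderXgcd ot.
have clE : n ^: G = [set n; n ^ t; n ^ (t ^+ 2)].
  apply/esym/eqP; rewrite eqEcard cl_n; apply/andP; split.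
    apply/subsetP=> x; rewrite !inE -orbA.
    by case/or3P=> /eqP->; rewrite ?class_refl // memJ_class // groupX.
  have neq_ntt2 : n ^ (t ^+ 2) != n ^ t.
    by rewrite expgS conjgM (inj_eq (conjg_inj t)).
  by rewrite setUC cardsU1 cards2 eq_sym neq_nt !inE negb_or neq_nt2 neq_ntt2.
pose Z := 'Z(Q)%G.
have abZ : abelian Z := center_abelian Q.
have nZG : G \subset 'N(Z) := normal_norm (gFnormal_trans _ nQG).
have sclZ : n ^: G \subset Z.
  rewrite class_sub_norm // inE Qn; apply/centP=> x Qx.
  by apply: cPn; apply: (subsetP sQP).
have Zt : n ^ t \in Z by rewrite (subsetP sclZ) // memJ_class.
have Zt2 : n ^ (t ^+ 2) \in Z by rewrite (subsetP sclZ) // memJ_class ?groupX.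
have Zn : n \in Z by rewrite (subsetP sclZ) // class_refl.
have comZ := centsP abZ.
(* The product of the three conjugates of [n] is fixed by [t], and also by [P], which fixes [n] and
   permutes the other two. So it is central, hence trivial, and the conjugates span a four-group. *)
pose m := n * n ^ t * n ^ (t ^+ 2).
have mt : t \in 'C[m].
  apply/cent1P/commute_sym/commgP/conjg_fixP.
  rewrite /m 2!conjMg -!conjgM -expgSr -[t * t]/(t ^+ 2).
  rewrite (_ : t ^+ 3 = 1) ?conjg1; last by rewrite -ot expg_order.
  by rewrite -[RHS]mulgA; apply/commute_sym/comZ; rewrite // groupM.
have mP p : p \in P -> p \in 'C[m].
  move=> Pp; have Gp := subsetP sPG p Pp.
  have np : n ^ p = n by apply/conjg_fixP/commgP; exact: cPn.
  have cl_p x : x \in n ^: G -> x != n -> x ^ p \in [set n ^ t; n ^ (t ^+ 2)].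
    move=> clx ntx; have : x ^ p \in n ^: G by rewrite memJ_norm // (subsetP (class_norm n G)).
    by rewrite clE !inE -orbA -{1}np (inj_eq (conjg_inj p)) (negPf ntx).
  have /set2P xt := cl_p _ (memJ_class n Gt) neq_nt.
  have /set2P xt2 := cl_p _ (memJ_class n (groupX 2 Gt)) neq_nt2.
  apply/cent1P/commute_sym/commgP/conjg_fixP.
  have neq : (n ^ t) ^ p != (n ^ (t ^+ 2)) ^ p.
    by rewrite (inj_eq (conjg_inj p)) expgS conjgM (inj_eq (conjg_inj t)) eq_sym.
  rewrite /m 2!conjMg np; case: xt xt2 neq => -> [] ->; rewrite ?eqxx // => _.
  by rewrite -(mulgA n) (comZ _ Zt2 _ Zt) mulgA.
have m1 : m = 1.
  have Gm : m \in G := groupM (groupM Gn (groupJ Gn Gt)) (groupJ Gn (groupX 2 Gt)).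
  apply/set1P; rewrite -[[set 1]]/(1 : {set gT}) -ZG1 inE Gm -sub_cent1.
  apply/setIidPl/eqP; rewrite eqEcard subsetIl oG /= dvdn_leq //.
  rewrite -[192]/(64 * 3)%N Gauss_dvd //; apply/andP; split.
    by rewrite -oP cardSg // subsetI sPG; apply/subsetP.
  by rewrite -ot order_dvdG // inE Gt.
pose N := <<n ^: G>>%G.
have NE : N :=: <[n]> * <[n ^ t]>.
  have cnt : <[n ^ t]> \subset 'C(<[n]>).
    rewrite cycle_subG; apply/centP=> _ /cycleP[k ->].
    by apply: commuteX; exact: (comZ _ Zt _ Zn).
  rewrite -(cent_joinEr cnt); apply/eqP; rewrite eqEsubset gen_subG join_subG.
  rewrite !cycle_subG !mem_gen ?class_refl ?memJ_class //= andbT clE.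
  apply/subsetP=> x; rewrite !inE -orbA => /or3P[] /eqP->.
  - by rewrite mem_gen // inE cycle_id.
  - by rewrite mem_gen // inE cycle_id orbT.
  rewrite -(mulKg (n * n ^ t) (n ^ (t ^+ 2))) -/m m1 mulg1 groupV.
  by rewrite groupM // mem_gen // inE cycle_id ?orbT.
have ont : #[n ^ t] = 2 by rewrite orderJ.
have oN : #|N| = 4.
  rewrite NE TI_cardMg -?orderE ?on ?ont //.
  rewrite prime_TIg ?on -?orderE ?on // cycle_subG.
  apply: contraNN neq_nt.
  by rewrite /= (cycle2g ont) !inE (negPf nt_n) /= eq_sym.
have nNG : N <| G.
  by rewrite /normal gen_subG (normal_sub (class_normal Gn)) norms_gen ?class_norm.
have clN : n ^: G = N^#.
  have oN1 : #|N^#| = 3 by move: oN; rewrite (cardsD1 1 N) group1 => -[].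
  apply/eqP; rewrite eqEcard oN1 cl_n leqnn andbT.
  apply/subsetP=> x clx; rewrite !inE mem_gen // andbT.
  by case/imsetP: clx => y _ ->; rewrite conjg_eq1.
exists N; split=> //.
- apply/abelemP=> //; split=> [|x Nx].
    by apply: abelianS abZ; rewrite gen_subG.
  have [-> | ntx] := eqVneq x 1; first by rewrite expg1n.
  have : x \in n ^: G by rewrite clN !inE ntx.
  by case/imsetP=> y _ ->; rewrite -conjXg -on expg_order conj1g.
- by move=> x; rewrite -clN => clx; rewrite -cl_n (class_eqP clx).
apply: (irr12_camina oG nNG oN chi1).
apply/negP=> sNk; have : N \subset 'Z(('chi[G]_i)%R)%CF.
  by apply: subset_trans sNk (normal_sub (cfker_center_normal _)).
by rewrite Z1 => /subset_leq_card; rewrite oN cards1.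
Qed.

End Order192.

(** * Elements of order 3 and class two *)

Section Order3Action.

Variables (gT : finGroupType) (G N : {group gT}) (t : gT).
Hypotheses (oG : #|G| = 192) (cGN : camina_kernel G N).
Hypotheses (Gt : t \in G) (ot : #[t] = 3).

Lemma conj_order3 (x : gT) : ((x ^ t) ^ t) ^ t = x.
Proof.
have t3 : t * (t * t) = 1 by rewrite -(expg_order t) ot.
by rewrite -[RHS]conjg1 -t3 2!conjgM.
Qed.

Lemma camina_kernelJ (n g : gT) : n \in N -> g \in G -> n ^ g \in N.
Proof. by case: cGN => /normal_norm/subsetP nNG *; rewrite memJ_norm // nNG. Qed.

Lemma camina_kernel_mulgg (n : gT) : n \in N -> n * n = 1.
Proof. by case: cGN => _ _ /abelemP-/(_ isT)[_ N2] _ _ /N2. Qed.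

Lemma camina_kernelV (n : gT) : n \in N -> n^-1 = n.
Proof. by move/camina_kernel_mulgg/(canRL (mulKg n)); rewrite mulg1. Qed.

Lemma camina_kernelC (n m : gT) : n \in N -> m \in N -> n * m = m * n.
Proof. by case: cGN => _ _ /abelem_abelian/centsP cNN _ _ Nn; apply: cNN. Qed.

Lemma card_cent1_camina_kernel (n : gT) : n \in N^# -> #|'C_G[n]| = 64.
Proof.
case: cGN => _ _ _ clN _ /clN; rewrite -index_cent1 => ind.
have := Lagrange (subsetIl G 'C[n]); rewrite ind oG.
by rewrite -[192]/(64 * 3)%N => /eqP; rewrite eqn_pmul2r // => /eqP.
Qed.

(** A nontrivial element of [N] has a centralizer of order 64, which contains no element of order
    3. *)
Lemma camina_kernel_fix (n : gT) : n \in N -> n ^ t = n -> n = 1.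
Proof.
move=> Nn /conjg_fixP/commgP/commute_sym/cent1P cnt; apply/eqP/idPn=> nt_n.
have tC : t \in 'C_G[n] by rewrite inE Gt.
by have := order_dvdG tC; rewrite ot card_cent1_camina_kernel // !inE nt_n.
Qed.

Lemma camina_kernel_norm3 (n : gT) : n \in N -> n * n ^ t * (n ^ t) ^ t = 1.
Proof.
move=> Nn; have Nnt := camina_kernelJ Nn Gt; have Nntt := camina_kernelJ Nnt Gt.
apply: (camina_kernel_fix (groupM (groupM Nn Nnt) Nntt)).
rewrite conjMg (conjMg n) conj_order3 (camina_kernelC (groupM Nnt Nntt) Nn).
by rewrite mulgA.
Qed.

Lemma camina_kernel_conj2 (n : gT) : n \in N -> (n ^ t) ^ t = n * n ^ t.
Proof.
move=> Nn; have Nnt := camina_kernelJ Nn Gt; have Nntt := camina_kernelJ Nnt Gt.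
apply: (mulgI (n * n ^ t)); rewrite camina_kernel_norm3 //.
by rewrite (camina_kernel_mulgg (groupM Nn Nnt)).
Qed.

(** A coset of [N] fixed by [t] contains a fixed element, as for any coprime action. With [m] the
    defect of [w], the correction [m ^ t] works because [m] times its second conjugate is
    [m ^ t]. *)
Lemma fixed_coset_camina_kernel (w : gT) :
  w^-1 * w ^ t \in N -> exists2 n, n \in N & (w * n) ^ t = w * n.
Proof.
set m := w^-1 * w ^ t => Nm; exists (m ^ t); first exact: camina_kernelJ.
have Nmt := camina_kernelJ Nm Gt; have Nmtt := camina_kernelJ Nmt Gt.
rewrite conjMg -{1}(mulKVg w (w ^ t)) -/m -mulgA; congr (_ * _).
by rewrite (camina_kernel_conj2 Nm) mulgA camina_kernel_mulgg // mul1g.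
Qed.

(** The orbits of [<[t]>] on [K] have size 1 or 3. *)
Lemma card_cent1_mod3 (K : {group gT}) :
  t \in 'N(K) -> #|K| = #|'C_K[t]| %[mod 3].
Proof.
move=> nKt; have p3 : 3.-group <[t]> by rewrite /pgroup -orderE ot.
have actK : [acts <[t]>, on K | 'J] by rewrite astabsJ cycle_subG.
by rewrite (pgroup_fix_mod p3 actK) afixJ cent_cycle.
Qed.

Lemma camina_kernel_elements (u : gT) : u \in N -> u != 1 ->
  forall n, n \in N -> n \in [:: 1; u; u ^ t; u * u ^ t].
Proof.
move=> Nu nt_u n Nn; have Nut := camina_kernelJ Nu Gt.
have neq_ut : u ^ t != u.
  by apply: contraNneq nt_u => /(camina_kernel_fix Nu)->.
have nt_ut : u ^ t != 1 by rewrite conjg_eq1.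
have uniq_s : uniq [:: 1; u; u ^ t; u * u ^ t].
  rewrite /= !inE !negb_or !andbT ![1 == _]eq_sym nt_u nt_ut (eq_sym u) neq_ut /=.
  rewrite -eq_invg_mul (camina_kernelV Nu) eq_sym neq_ut /=.
  rewrite -{1}[u]mulg1 (inj_eq (mulgI u)) eq_sym nt_ut /=.
  by rewrite -{1}[u ^ t]mul1g (inj_eq (mulIg _)) eq_sym.
have sub_s : {subset [:: 1; u; u ^ t; u * u ^ t] <= enum N}.
  move=> z; rewrite mem_enum !inE => /or4P[] /eqP-> //; exact: groupM.
have [|_ ->] := uniq_min_size uniq_s sub_s; first by rewrite -cardE; case: cGN => _ ->.
by rewrite mem_enum.
Qed.

Section Invariant.

Variable Q : {group gT}.
Hypotheses (nQG : Q <| G) (pQ : 2.-group Q) (sNQ : N \subset Q).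

(** The centralizer in [G] of an involution of [N] is a Sylow 2-subgroup, so it contains every
    normal 2-subgroup. *)
Lemma camina_kernel_central : N \subset 'Z(Q).
Proof.
have [P sylP sQP] := Sylow_superset (normal_sub nQG) pQ.
apply/subsetP=> n Nn; have [-> | nt_n] := eqVneq n 1; first exact: group1.
have NEn : n \in N^# by rewrite !inE nt_n.
have oC := card_cent1_camina_kernel NEn.
have sylC : 2.-Sylow(G) 'C_G[n].
  by rewrite pHallE subsetIl oG p_part oC.
have sQC : Q \subset 'C_G[n].
  apply: subset_trans (pcore_sub_Hall sylC).
  by rewrite pcore_max.
rewrite inE (subsetP sNQ) //= -sub_cent1.
by apply: subset_trans sQC (subsetIr _ _).
Qed.

Lemma camina_kernel_com (n q : gT) : n \in N -> q \in Q -> n * q = q * n.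
Proof. by move=> /(subsetP camina_kernel_central)/centerP[_ cQ] /cQ. Qed.

Lemma camina_kernel_conj (n q : gT) : n \in N -> q \in Q -> n ^ q = n.
Proof. by move=> Nn Qq; apply/conjg_fixP/commgP; apply: camina_kernel_com. Qed.

Lemma cent1_TI_camina_kernel (c : gT) : c \in N -> c \in 'C[t] -> c = 1.
Proof.
move=> Nc /cent1P ct; apply: camina_kernel_fix => //.
by apply/conjg_fixP/commgP.
Qed.

(** The product telescopes. It is the multiplicative analogue of a norm, evaluated at a
    coboundary. *)
Lemma norm3_commg (p x : gT) :
  x = p^-1 * p ^ t -> x * x ^ t * (x ^ t) ^ t = 1.
Proof.
move=> Dx.
have xt : x ^ t = (p ^ t)^-1 * (p ^ t) ^ t by rewrite Dx conjMg conjVg.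
have xtt : (x ^ t) ^ t = ((p ^ t) ^ t)^-1 * p.
  by rewrite xt conjMg (conjVg (p ^ t)) conj_order3.
rewrite xtt xt Dx; move: (p ^ t) => p1; move: (p1 ^ t) => p2.
by rewrite !mulgA mulgK mulgK mulVg.
Qed.

Lemma norm3_fixed_mul (c n : gT) : c \in Q -> c ^ t = c -> n \in N ->
  (c * n) * (c * n) ^ t * ((c * n) ^ t) ^ t = c * c * c.
Proof.
move=> Qc ct Nn; rewrite (conjMg c) ct (conjMg c) ct.
have := camina_kernel_norm3 Nn; have Nnt := camina_kernelJ Nn Gt.
move: (n ^ t) Nnt => m Nm; move: (m ^ t) => k nmk.
have cC i : i \in N -> i * c = c * i by move=> Ni; apply: camina_kernel_com.
rewrite !mulgA -(mulgA c n c) (cC n Nn) (mulgA c c) -(mulgA (c * c) n).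
rewrite -(mulgA (c * c) _ c) (cC _ (groupM Nn Nm)) (mulgA (c * c)).
by rewrite -(mulgA (c * c * c)) nmk mulg1.
Qed.

End Invariant.
End Order3Action.

(** * Commutation as a bilinear map and squaring as a quadratic map *)

Section ClassTwo.

Variables (gT : finGroupType) (Q N : {group gT}).
Hypothesis cNQ : N \subset 'Z(Q).
Hypothesis N2 : {in N, forall n, n * n = 1}.
Hypothesis QQN : {in Q &, forall x y, [~ x, y] \in N}.

Let nC n q : n \in N -> q \in Q -> n * q = q * n.
Proof. by move=> /(subsetP cNQ)/centerP[_ cQ] /cQ. Qed.

Let sNQ : {subset N <= Q}.
Proof. by move=> n /(subsetP cNQ)/centerP[]. Qed.

Let nJ n q : n \in N -> q \in Q -> n ^ q = n.
Proof. by move=> Nn Qq; apply/conjg_fixP/commgP; apply: nC. Qed.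

Lemma class2_commgMr (x y z : gT) :
  x \in Q -> y \in Q -> z \in Q -> [~ x, y * z] = [~ x, y] * [~ x, z].
Proof.
move=> Qx Qy Qz; rewrite commgMJ nJ ?QQN //; apply: nC; rewrite ?QQN //.
by rewrite sNQ ?QQN.
Qed.

Lemma class2_commMgl (x y z : gT) :
  x \in Q -> y \in Q -> z \in Q -> [~ x * y, z] = [~ x, z] * [~ y, z].
Proof. by move=> Qx Qy Qz; rewrite commMgJ nJ ?QQN. Qed.

Lemma class2_commg_sym (x y : gT) :
  x \in Q -> y \in Q -> [~ y, x] = [~ x, y].
Proof.
move=> Qx Qy; apply: (mulgI [~ x, y]); rewrite N2 ?QQN //.
by rewrite -(invg_comm x y) mulgV.
Qed.

Lemma class2_mulC (x y : gT) : x \in Q -> y \in Q -> y * x = x * y * [~ x, y].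
Proof. by move=> Qx Qy; rewrite -class2_commg_sym // -commgC. Qed.

Lemma class2_sqM (x y : gT) : x \in Q -> y \in Q ->
  (x * y) * (x * y) = (x * x) * (y * y) * [~ x, y].
Proof.
move=> Qx Qy; have := class2_mulC Qx Qy.
move: [~ x, y] (QQN Qx Qy) => c Nc yx; rewrite -mulgA (mulgA y) yx -!mulgA.
by rewrite (nC Nc Qy).
Qed.

End ClassTwo.

(** * Centralizers modulo [N] *)

Section CentMod.

Variables (gT : finGroupType) (P N : {group gT}).
Hypothesis nsNP : N <| P.

Let nNP : P \subset 'N(N) := normal_norm nsNP.

Definition cent_mod (x : gT) : {group gT} :=
  (coset N @*^-1 'C_(P / N)[coset N x])%G.

Lemma cent_mod_sub (x : gT) : cent_mod x \subset P.
Proof.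
by rewrite -(quotientGK nsNP) morphpreS ?subsetIl.
Qed.

Lemma commg_mod (x p : gT) : x \in P -> p \in P ->
  ([~ x, p] \in N) = ([~ coset N x, coset N p] == 1).
Proof.
move=> Px Pp; have Nx := subsetP nNP x Px; have Np := subsetP nNP p Pp.
rewrite -morphR //; apply/idP/eqP=> [/coset_id // | ].
by apply: coset_idr; rewrite groupR.
Qed.

Lemma mem_cent_mod (x p : gT) :
  x \in P -> p \in P -> (p \in cent_mod x) = ([~ x, p] \in N).
Proof.
move=> Px Pp; have Np := subsetP nNP p Pp; rewrite commg_mod //.
apply/morphpreP/commgP=> [[_ /setIP[_ /cent1P/commute_sym]] // | cxp].
by split=> //; rewrite inE mem_quotient //; apply/cent1P/commute_sym.
Qed.

(** A group of exponent 2, here [P / N], is abelian. *)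
Lemma commg_of_sq_mod :
  {in P, forall x, x * x \in N} -> {in P &, forall x y, [~ x, y] \in N}.
Proof.
move=> sqN x y Px Py; rewrite commg_mod //.
have inv (z : gT) : z \in P -> (coset N z)^-1 = coset N z.
  move=> Pz; apply/eqP; rewrite eq_invg_mul -morphM ?(subsetP nNP) //.
  by rewrite /= coset_id // sqN.
apply/commgP; rewrite /commute -{2}(inv x) // -{2}(inv y) // -invMg.
by rewrite -morphM ?(subsetP nNP) // inv // groupM.
Qed.

End CentMod.

Section ClassTwoAction.

Variables (gT : finGroupType) (G N Q : {group gT}) (t : gT).
Hypotheses (oG : #|G| = 192) (cGN : camina_kernel G N).
Hypotheses (Gt : t \in G) (ot : #[t] = 3).
Hypotheses (nQG : Q <| G) (cNQ : N \subset 'Z(Q)).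
Hypothesis QQN : {in Q &, forall x y, [~ x, y] \in N}.
Hypothesis QsqN : {in Q, forall x, x * x \in N}.

Let Pt (x : gT) : x \in Q -> x ^ t \in Q.
Proof. by move=> Qx; rewrite memJ_norm // (subsetP (normal_norm nQG)). Qed.

Let N2 := camina_kernel_mulgg cGN.
Let commR := class2_commgMr cNQ QQN.
Let commS := class2_commg_sym N2 QQN.
Let sqM := class2_sqM cNQ N2 QQN.

Lemma class2_commgVr (x y : gT) : x \in Q -> y \in Q -> [~ x, y^-1] = [~ x, y].
Proof.
move=> Px Py; have PV : y^-1 \in Q by rewrite groupV.
apply: (mulgI [~ x, y]); rewrite -commR // mulgV N2 ?QQN //.
by rewrite commg1.
Qed.

Lemma class2_inv (x : gT) : x \in Q -> x^-1 = x * (x * x).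
Proof.
move=> Px; apply: (mulgI x); rewrite mulgV (mulgA x x).
by rewrite (N2 (QsqN Px)).
Qed.

(** Trivial norm makes the second conjugate the inverse of [x * x ^ t], and inverses in [Q] are
    cubes because squares lie in [N]. *)
Lemma conj2_norm3 (x : gT) : x \in Q -> commute x (x ^ t) ->
    x * x ^ t * (x ^ t) ^ t = 1 ->
  (x ^ t) ^ t = x * x ^ t * (x * x) * (x * x) ^ t.
Proof.
move=> Px cxt /(canRL (mulKg _)); rewrite mulg1 => ->.
have Pxt := Pt Px; have Nxx := QsqN Px.
rewrite (class2_inv (groupM Px Pxt)) (sqM Px Pxt).
rewrite (_ : [~ x, x ^ t] = 1); last exact/eqP/commgP.
by rewrite mulg1 (conjMg x) !mulgA.
Qed.

(** Substituting the inverse of [x * x ^ t] for the second conjugate shows that the commutator of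
    [x] and [x ^ t] is fixed by [t]; lying in [N], it is trivial. *)
Lemma norm3_com (x : gT) : x \in Q -> x * x ^ t * (x ^ t) ^ t = 1 -> commute x (x ^ t).
Proof.
move=> Px /(canRL (mulKg _)); rewrite mulg1 => xtt; have Pxt := Pt Px.
have Ne : [~ x, x ^ t] \in N by rewrite QQN.
apply/commgP/eqP/(camina_kernel_fix oG cGN Gt ot Ne).
rewrite conjRg xtt (class2_commgVr Pxt (groupM Px Pxt)) (commR Pxt Px Pxt) commgg mulg1.
exact: commS.
Qed.

End ClassTwoAction.

(* Presentations on [u, v, x, x', y, y', t] (the first four),                *)
(* and [u, v, x, x', c, t, s] (the last two), with [x' = x ^ t].             *)
Definition pres_hyperbolic : pc_presentation :=
  [:: (2, [::], [::]);
      (2, [::], [:: [:: 0]]);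
      (2, [::], [:: [:: 0]; [:: 1]]);
      (2, [::], [:: [:: 0]; [:: 1]; [:: 2]]);
      (2, [::], [:: [:: 0]; [:: 1]; [:: 2; 0]; [:: 3; 0; 1]]);
      (2, [::], [:: [:: 0]; [:: 1]; [:: 2; 0; 1]; [:: 3; 1]; [:: 4]]);
      (3, [::], [:: [:: 1]; [:: 0; 1]; [:: 3]; [:: 2; 3]; [:: 5]; [:: 4; 5]])]%N.

Definition pres_elliptic : pc_presentation :=
  [:: (2, [::], [::]);
      (2, [::], [:: [:: 0]]);
      (2, [:: 0], [:: [:: 0]; [:: 1]]);
      (2, [:: 1], [:: [:: 0]; [:: 1]; [:: 2]]);
      (2, [:: 1], [:: [:: 0]; [:: 1]; [:: 2; 0]; [:: 3; 0; 1]]);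
      (2, [:: 0; 1], [:: [:: 0]; [:: 1]; [:: 2; 0; 1]; [:: 3; 1]; [:: 4]]);
      (3, [::], [:: [:: 1]; [:: 0; 1]; [:: 3]; [:: 2; 3; 0; 1]; [:: 5];
                    [:: 4; 5; 0]])]%N.

Definition pres_split : pc_presentation :=
  [:: (2, [::], [::]);
      (2, [::], [:: [:: 0]]);
      (2, [::], [:: [:: 0]; [:: 1]]);
      (2, [::], [:: [:: 0]; [:: 1]; [:: 2]]);
      (2, [::], [:: [:: 0]; [:: 1]; [:: 2; 0]; [:: 3; 1]]);
      (2, [::], [:: [:: 0]; [:: 1]; [:: 2; 1]; [:: 3; 0; 1]; [:: 4]]);
      (3, [::], [:: [:: 1]; [:: 0; 1]; [:: 3]; [:: 2; 3]; [:: 4]; [:: 5]])]%N.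

Definition pres_homocyclic : pc_presentation :=
  [:: (2, [::], [::]);
      (2, [::], [:: [:: 0]]);
      (2, [:: 0], [:: [:: 0]; [:: 1]]);
      (2, [:: 1], [:: [:: 0]; [:: 1]; [:: 2]]);
      (2, [::], [:: [:: 0]; [:: 1]; [:: 2; 0]; [:: 3; 1]]);
      (2, [::], [:: [:: 0]; [:: 1]; [:: 2; 1]; [:: 3; 0; 1]; [:: 4]]);
      (3, [::], [:: [:: 1]; [:: 0; 1]; [:: 3]; [:: 2; 3; 0; 1]; [:: 4];
                    [:: 5]])]%N.

Definition pres_dicyclic_split : pc_presentation :=
  [:: (2, [::], [::]);
      (2, [::], [:: [:: 0]]);
      (2, [::], [:: [:: 0]; [:: 1]]);
      (2, [::], [:: [:: 0]; [:: 1]; [:: 2]]);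
      (2, [::], [:: [:: 0]; [:: 1]; [:: 2; 0]; [:: 3; 1]]);
      (3, [::], [:: [:: 1]; [:: 0; 1]; [:: 3]; [:: 2; 3]; [:: 4]]);
      (2, [:: 4], [:: [:: 0]; [:: 0; 1]; [:: 2; 1]; [:: 2; 3; 0]; [:: 4];
                      [:: 5; 5]])]%N.

Definition pres_dicyclic_homocyclic : pc_presentation :=
  [:: (2, [::], [::]);
      (2, [::], [:: [:: 0]]);
      (2, [:: 0], [:: [:: 0]; [:: 1]]);
      (2, [:: 1], [:: [:: 0]; [:: 1]; [:: 2]]);
      (2, [::], [:: [:: 0]; [:: 1]; [:: 2; 0]; [:: 3; 1]]);
      (3, [::], [:: [:: 1]; [:: 0; 1]; [:: 3]; [:: 2; 3; 0; 1]; [:: 4]]);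
      (2, [:: 4], [:: [:: 0]; [:: 0; 1]; [:: 2; 1]; [:: 2; 3; 1]; [:: 4];
                      [:: 5; 5]])]%N.

Definition satisfies (P : pc_presentation) (gT : finGroupType) (G : {group gT}) :=
  exists2 s : seq gT, pc_sat P s & <<[set x in s]>> = G.

(** * Groups with |O_2(G)| = 64 *)

Section TwoClosed.

Variables (gT : finGroupType) (G N P : {group gT}) (t : gT).
Hypotheses (oG : #|G| = 192) (cGN : camina_kernel G N).
Hypotheses (Gt : t \in G) (ot : #[t] = 3).
Hypotheses (nPG : P <| G) (oP : #|P| = 64).

Let sPG : P \subset G := normal_sub nPG.
Let nNG : N <| G. Proof. by case: cGN. Qed.
Let oN : #|N| = 4. Proof. by case: cGN. Qed.
Let memJN (n g : gT) := @camina_kernelJ _ _ _ cGN n g.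

Let pP : 2.-group P.
Proof. by rewrite /pgroup oP. Qed.

Let sNP : N \subset P.
Proof.
have sylP : 2.-Sylow(G) P by rewrite pHallE sPG oG p_part oP.
rewrite -(normal_Hall_pcore sylP nPG) pcore_max // /pgroup oN //.
Qed.

Let cNP : N \subset 'Z(P) := camina_kernel_central oG cGN nPG pP sNP.
Let nC (n q : gT) := @camina_kernel_com _ _ _ oG cGN _ nPG pP sNP n q.
Let nJ (n q : gT) := @camina_kernel_conj _ _ _ oG cGN _ nPG pP sNP n q.

Let nNP : P \subset 'N(N) := subset_trans sPG (normal_norm nNG).

(** An element of the centre outside [N] would have at least 4 conjugates by the Camina condition,
    but at most 3 because its centralizer contains [P]. *)
Lemma center_two_closed : 'Z(P) = N.
Proof.
apply/eqP; rewrite eqEsubset cNP andbT; apply/subsetP=> g /centerP[Pg cPg].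
apply/idPn=> N'g; have Gg := subsetP sPG g Pg.
have sPC : P \subset 'C_G[g].
  rewrite subsetI sPG; apply/subsetP=> x Px; apply/cent1P/commute_sym.
  exact: cPg.
have : g *: N \subset g ^: G.
  apply/subsetP=> _ /lcosetP[n Nn ->].
  by case: cGN => _ _ _ _; apply; rewrite // inE N'g.
move/subset_leq_card; rewrite card_lcoset oN -index_cent1 leqNgt => /negP[].
rewrite -divgS ?subsetIl // oG ltn_divLR ?cardG_gt0 //.
by apply: (@leq_trans (4 * 64)%N) => //; rewrite leq_mul2l -oP subset_leq_card.
Qed.

Lemma two_closed_factor : <[t]> * P = G.
Proof.
apply/eqP; rewrite eqEcard mul_subG ?cycle_subG // oG TI_cardMg.
  by rewrite -orderE ot oP.
by apply: coprime_TIg; rewrite -orderE ot oP.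
Qed.

(** Some [h] conjugates [w] to [w * n]; write it as a power of [t] times [p] in [P]. If [t] fixes
    the coset of [w], a fixed representative makes the power of [t] act trivially. Otherwise the
    power of [t] must be 1, since it fixes that coset. *)
Lemma commg_onto_camina_kernel (w n : gT) :
    w \in P -> w \notin N -> {in P, forall p, [~ w, p] \in N} -> n \in N ->
  exists2 p, p \in P & [~ w, p] = n.
Proof.
have onto v m : v \in P -> v \notin N -> m \in N ->
    exists2 h, h \in G & v ^ h = v * m.
  move=> Pv N'v Nm; have [_ _ _ _ cam] := cGN.
  have /imsetP[h Gh ->] : v * m \in v ^: G.
    by apply: cam; rewrite // inE N'v (subsetP sPG).
  by exists h.
move=> Pw N'w wPN Nn; have Gw := subsetP sPG w Pw.
have [Nwt | N'wt] := boolP (w^-1 * w ^ t \in N).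
  have [m Nm fix_wm] := fixed_coset_camina_kernel oG cGN Gt ot Nwt.
  have Pm := subsetP sNP m Nm.
  have N'wm : w * m \notin N by rewrite groupMr.
  have [h Gh wmh] := onto _ n (groupM Pw Pm) N'wm Nn.
  have /mulsgP[_ p /cycleP[k ->] Pp Dh] : h \in <[t]> * P by rewrite two_closed_factor.
  exists p => //; have fix_k : (w * m) ^ (t ^+ k) = w * m.
    by apply/conjg_fixP/commgP/commuteX/commgP/conjg_fixP.
  have : w ^ p * m = w * n * m.
    rewrite -(mulgA w) (camina_kernelC cGN Nn Nm) mulgA -wmh Dh conjgM fix_k.
    by rewrite conjMg (nJ Nm Pp).
  by move/mulIg=> wp; rewrite commgEl wp mulKg.
have [h Gh wh] := onto w n Pw N'w Nn.
have /mulsgP[y p /cycleP[k Dy] Pp Dh] : h \in <[t]> * P by rewrite two_closed_factor.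
have Pq : p^-1 \in P by rewrite groupV.
have wy : w^-1 * w ^ y \in N.
  have wp : w ^ (p^-1) = w * [~ w, p^-1] by rewrite commgEl mulKVg.
  have -> : w ^ y = w * [~ w, p^-1] * n.
    by rewrite -(conjgK p (w ^ y)) -(conjgM w y) -Dh wh conjMg (nJ Nn Pq) wp.
  by rewrite -mulgA mulKg groupM ?wPN.
have [yt1 | nt_y] := eqVneq y 1.
  by exists p => //; rewrite commgEl -[in w ^ p](mul1g p) -yt1 -Dh wh mulKg.
case/negP: N'wt.
(* If the square of [t] fixes the coset of [w], so does [t], the square of that square. *)
have wt2 : w^-1 * w ^ (t ^+ 2) \in N -> w^-1 * w ^ t \in N.
  move=> Nm; have -> : w ^ t = (w * (w^-1 * w ^ (t ^+ 2))) ^ (t ^+ 2).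
    by rewrite mulKVg -conjgM -expgD -[(2 + 2)%N]/(3 + 1)%N expgD -ot expg_order mul1g expg1.
  rewrite conjMg -{1}(mulKVg w (w ^ (t ^+ 2))) -mulgA mulKg.
  by rewrite groupM // memJN // groupX.
rewrite Dy in wy nt_y.
have Dk : t ^+ k = t ^+ (k %% 3) by rewrite -ot expg_mod_order.
rewrite Dk in wy nt_y; have := ltn_mod k 3.
case: (k %% 3)%N wy nt_y => [|[|[|]]] //; first by rewrite eqxx.
by move=> /wt2.
Qed.

Let CT : {group gT} := 'C_P[t]%G.
Let sNG : N \subset G := normal_sub nNG.

Lemma cent1_two_closed_TI : CT :&: N = 1.
Proof.
apply/trivgP/subsetP=> c /setIP[/setIP[_ ct] Nc]; apply/set1P.
exact: cent1_TI_camina_kernel oG cGN Gt ot c Nc ct.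
Qed.

Lemma card_2subgroup_mod3 (K : {group gT}) :
  K \subset P -> #|K| = 1 %[mod 3] -> #|K| \in [:: 1; 4; 16; 64]%N.
Proof.
move=> sKP; have : #|K| %| 64 by rewrite -oP cardSg.
rewrite dvdn_divisors // -[divisors 64]/[:: 1; 2; 4; 8; 16; 32; 64]%N !inE.
by case/or4P=> [|||/or4P[]] /eqP->.
Qed.

Lemma card_invariant (K : {group gT}) :
  K \subset P -> t \in 'N(K) -> #|'C_K[t]| = 1 %[mod 3] ->
  #|K| \in [:: 1; 4; 16; 64]%N.
Proof.
by move=> sKP nKt C1; rewrite card_2subgroup_mod3 // (card_cent1_mod3 ot nKt).
Qed.

Let nPt : t \in 'N(P) := subsetP (normal_norm nPG) t Gt.

(** The order is 1 modulo 3, hence a power of 4. Order 64 is too large, as the fixed points meet [N]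
    trivially. Order 16 would make [P] the product of [CT] and the central [N], and the centre of
    [CT] would lie in ['Z(P) = N]. *)
Lemma card_cent1_two_closed : #|CT| \in [:: 1; 4]%N.
Proof.
have C1 : #|CT| = 1 %[mod 3] by rewrite -(card_cent1_mod3 ot nPt) oP.
have sCP : CT \subset P := subsetIl _ _.
have oCN : (#|(CT * N)%g| = #|CT| * 4)%N by rewrite TI_cardMg ?cent1_two_closed_TI ?oN.
have sCNP : CT * N \subset P by rewrite mul_subG.
have := card_2subgroup_mod3 sCP C1; rewrite !inE.
case/or4P=> /eqP oC; rewrite ?oC //.
  have CNP : CT * N = P by apply/eqP; rewrite eqEcard sCNP oCN oC oP.
  have ntC : CT :!=: 1 by rewrite -cardG_gt1 oC.
  have ntZ : 'Z(CT) != 1.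
    by apply: contraNneq ntC => /(trivg_center_pgroup (pgroupS sCP pP))->.
  case/trivgPn: ntZ => c /centerP[Cc cC] nt_c; case/eqP: nt_c.
  apply/set1P; rewrite -[[set 1]]/(1 : {set gT}) -cent1_two_closed_TI inE Cc.
  rewrite -center_two_closed; apply/centerP; split; first exact: (subsetP sCP).
  rewrite -CNP => _ /mulsgP[d n Cd Nn ->].
  have cn := nC Nn (subsetP sCP c Cc).
  by apply: commuteM; [exact: cC | apply/esym].
by have := subset_leq_card sCNP; rewrite oCN oC oP.
Qed.

(** Since ['Z(P) = N], this is the second centre of [P]. The aim is to show that it is all of
    [P]. *)
Definition center_mod : {group gT} := (coset N @*^-1 'Z(P / N))%G.

Let nNP' : N <| P := normalS sNP sPG nNG.
Local Notation cent_mod := (cent_mod P N).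
Let cent_mod_sub := cent_mod_sub nNP'.
Let commg_mod := commg_mod nNP'.
Let mem_cent_mod := mem_cent_mod nNP'.

Lemma center_modP (w : gT) :
  reflect (w \in P /\ {in P, forall p, [~ w, p] \in N}) (w \in center_mod).
Proof.
have sZP : center_mod \subset P.
  by rewrite -(quotientGK (normalS sNP sPG nNG)) morphpreS ?subsetIl.
apply: (iffP idP) => [Zw | [Pw wP]].
  have Pw := subsetP sZP w Zw; split=> // p Pp.
  have /morphpreP[_ /centerP[_ cw]] := Zw.
  by rewrite commg_mod //; apply/commgP/cw/mem_quotient.
apply/morphpreP; split; first exact: (subsetP nNP).
apply/centerP; split; first exact: mem_quotient.
by move=> _ /morphimP[p Np Pp ->]; apply/commgP; rewrite -commg_mod ?wP.
Qed.

Lemma center_mod_sub : center_mod \subset P.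
Proof. by apply/subsetP=> w /center_modP[]. Qed.

Lemma center_mod_normal : center_mod <| G.
Proof.
rewrite /normal (subset_trans center_mod_sub) //=; apply/subsetP=> g Gg.
rewrite inE; apply/subsetP=> _ /imsetP[w /center_modP[Pw wP] ->].
have nPg := subsetP (normal_norm nPG) g Gg.
apply/center_modP; split=> [|p Pp]; first by rewrite memJ_norm.
have Ppg : p ^ g^-1 \in P by rewrite memJ_norm ?groupV.
by rewrite -(conjgKV g p) -conjRg memJN ?wP.
Qed.

Lemma sub_center_mod : N \subset center_mod.
Proof.
apply/subsetP=> n Nn; have Pn := subsetP sNP n Nn; apply/center_modP; split=> // p Pp.
suff -> : [~ n, p] = 1 by apply: group1.
by apply/eqP/commgP; apply: nC.
Qed.

Lemma card_center_mod : 4 < #|center_mod|.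
Proof.
have -> : #|center_mod| = (4 * #|'Z(P / N)%g|)%N by rewrite card_cosetpre oN.
rewrite -[X in X < _](muln1 4) ltn_pmul2l // cardG_gt1.
have : P / N != 1 by rewrite -cardG_gt1 card_quotient // -divgS // oP oN.
by apply: contraNneq => /(trivg_center_pgroup (quotient_pgroup N pP))->.
Qed.

Lemma nZt : t \in 'N(center_mod).
Proof. exact: subsetP (normal_norm center_mod_normal) t Gt. Qed.

Lemma camina_card_cent1_mod (w : gT) :
  w \in center_mod -> w \notin N -> #|'C_P[w]| = 16.
Proof.
move=> /center_modP[Pw wPN] N'w; have clw : w ^: P = w *: N.
  apply/setP=> y; apply/imsetP/lcosetP=> [[p Pp ->]|[n Nn ->]].
    by exists [~ w, p]; rewrite ?wPN // commgEl mulKVg.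
  have [p Pp <-] := commg_onto_camina_kernel Pw N'w wPN Nn.
  by exists p; rewrite // commgEl mulKVg.
have := Lagrange (subsetIl P 'C[w]); rewrite index_cent1 clw card_lcoset oN oP.
by rewrite -[64]/(16 * 4)%N => /eqP; rewrite eqn_pmul2r // => /eqP.
Qed.

(** Without fixed points the map sending [p] to [p^-1 * p ^ t] is injective, hence onto [P], and
    [norm3_commg] applies. *)
Lemma norm3_free (x : gT) : #|CT| = 1%N -> x \in P -> x * x ^ t * (x ^ t) ^ t = 1.
Proof.
move=> oC Px; suff /imsetP[p Pp ->] : x \in [set p^-1 * p ^ t | p in P].
  exact: (norm3_commg ot (p := p)) (erefl _).
suff -> : [set p^-1 * p ^ t | p in P] = P by [].
apply/eqP; rewrite eqEcard; apply/andP; split.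
  by apply/subsetP=> _ /imsetP[p Pp ->]; rewrite groupM ?groupV // memJ_norm.
rewrite card_in_imset // => p q Pp Pq /= eq_pq.
have : p * q^-1 \in CT.
  apply/setIP; split; first by rewrite groupM ?groupV.
  apply/cent1P/commgP/conjg_fixP.
  by rewrite conjMg conjVg -(mulKVg p (p ^ t)) eq_pq mulgA mulgK.
move/card1_trivg: oC => -> /set1P/(canRL (mulgK _)).
by rewrite mul1g invgK.
Qed.

(** Applied to [x] and to its inverse, [norm3_free] expresses the second conjugate as the inverse of
    [x * x ^ t] and as that of [x ^ t * x]. *)
Lemma norm3_free_com (x : gT) : #|CT| = 1%N -> x \in P -> commute x (x ^ t).
Proof.
move=> oC Px; have Pxt : x ^ t \in P by rewrite memJ_norm.
have := norm3_free oC (groupVr Px); rewrite !conjVg -!invMg => /eqP.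
rewrite invg_eq1 => /eqP eq1; apply: (mulgI ((x ^ t) ^ t)); rewrite eq1.
have /(canRL (mulKg _)) -> := norm3_free oC Px.
by rewrite mulg1 mulVg.
Qed.

Lemma cent_mod_center (x : gT) : x \in P -> P \subset cent_mod x -> x \in center_mod.
Proof.
by move=> Px /subsetP cP; apply/center_modP; split=> // p Pp; rewrite -mem_cent_mod ?cP.
Qed.

Lemma center_mod_cent (x : gT) : x \in P -> center_mod \subset cent_mod x.
Proof.
move=> Px; apply/subsetP=> z /center_modP[Pz zP].
by rewrite mem_cent_mod // -invg_comm groupV zP.
Qed.

Lemma cent_mod_id (x : gT) : x \in P -> x \in cent_mod x.
Proof. by move=> Px; rewrite mem_cent_mod // commgg. Qed.

(** All invariant subgroups have order a power of 4, so [center_mod] has order at least 16. For [x]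
    outside it, adding [x] and [x ^ t] yields an invariant subgroup of order more than 16, that is
    [P]. But [x] commutes modulo [N] with all these generators. *)
Lemma center_mod_free : #|CT| = 1%N -> P \subset center_mod.
Proof.
move=> oC; have freeC (K : {group gT}) : K \subset P -> #|'C_K[t]| = 1 %[mod 3].
  move=> sKP; have : 'C_K[t] \subset CT by rewrite setSI.
  by rewrite (card1_trivg oC) => /trivgP->; rewrite cards1.
have oZ : 16 <= #|center_mod|.
  have := card_invariant center_mod_sub nZt (freeC _ center_mod_sub).
  by have := card_center_mod; rewrite !inE => lt4 /or4P[] /eqP oZ; rewrite oZ in lt4 *.
apply/subsetP=> x Px; apply/idPn=> Z'x.
have Pxt : x ^ t \in P by rewrite memJ_norm.
pose D := <<center_mod :|: [set x; x ^ t]>>%G.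
have Dx : x \in D by rewrite mem_gen // !inE eqxx orbT.
have Dxt : x ^ t \in D by rewrite mem_gen // !inE eqxx !orbT.
have sZD : center_mod \subset D by rewrite sub_gen // subsetUl.
have sDP : D \subset P.
  by rewrite gen_subG subUset center_mod_sub; apply/subsetP=> y /set2P[]->.
have nDt : t \in 'N(D).
  rewrite inE -genJ gen_subG; apply/subsetP=> _ /imsetP[y + ->].
  case/setUP=> [Zy | /set2P[]-> //].
    by rewrite (subsetP sZD) // memJ_norm ?nZt.
  have /(canRL (mulKg _)) := norm3_free oC Px.
  by rewrite mulg1 => ->; rewrite groupV groupM.
have oD : 16 < #|D|.
  apply: leq_ltn_trans oZ (proper_card _); rewrite properE sZD.
  by apply: contra Z'x => /subsetP->.
have DP : D :=: P.
  apply/eqP; rewrite eqEcard sDP oP.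
  have := card_invariant sDP nDt (freeC _ sDP); rewrite !inE.
  by case/or4P=> /eqP oDD; rewrite oDD in oD *.
case/negP: Z'x; apply: cent_mod_center => //; rewrite -{1}DP gen_subG subUset.
rewrite center_mod_cent //=; apply/subsetP=> y /set2P[]->; first exact: cent_mod_id.
rewrite mem_cent_mod //; suff -> : [~ x, x ^ t] = 1 by apply: group1.
by apply/eqP/commgP; apply: norm3_free_com.
Qed.

Lemma abelian_CT : abelian CT.
Proof.
have := card_cent1_two_closed; rewrite !inE => /orP[] /eqP oC.
  by rewrite (card1_trivg oC) abelian1.
by apply: (@card_p2group_abelian _ 2).
Qed.

Lemma CT_comm (c d : gT) : c \in CT -> d \in CT -> [~ c, d] = 1.
Proof. by move=> Cc Cd; apply/eqP/commgP; apply: (centsP abelian_CT). Qed.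

(** Otherwise [t] acts freely on [center_mod], whose order is then at least 16, so that [P] is the
    product of [CT] and [center_mod]. As [CT] is abelian it would lie in [center_mod] after all. *)
Lemma center_mod_cent1 : #|CT| = 4%N ->
  exists2 w, w \in CT & (w \in center_mod) && (w != 1).
Proof.
move=> oC; have [TI | /trivgPn[w /setIP[Cw Zw] nt_w]] := eqVneq (CT :&: center_mod) 1; last first.
  by exists w; rewrite // Zw.
have sCP : CT \subset P := subsetIl _ _.
have oZ : 16 <= #|center_mod|.
  have CZ1 : #|'C_center_mod[t]| = 1 %[mod 3].
    have : 'C_center_mod[t] \subset CT :&: center_mod.
      by rewrite subsetI subsetIl setSI // center_mod_sub.
    by rewrite TI => /trivgP->; rewrite cards1.
  have := card_invariant center_mod_sub nZt CZ1.
  by have := card_center_mod; rewrite !inE => lt4 /or4P[] /eqP oZ; rewrite oZ in lt4 *.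
have CZP : CT * center_mod = P.
  apply/eqP; rewrite eqEcard mul_subG ?center_mod_sub // TI_cardMg // oC oP.
  by rewrite -[64]/(4 * 16)%N leq_mul2l.
have sCZ : CT \subset center_mod.
  apply/subsetP=> c Cc; have Pc := subsetP sCP c Cc; apply: cent_mod_center => //.
  rewrite -CZP mul_subG ?center_mod_cent //; apply/subsetP=> d Cd.
  by rewrite mem_cent_mod ?(subsetP sCP) // CT_comm // group1.
by have := cardG_gt1 CT; rewrite oC -[gval CT](setIidPl sCZ) TI eqxx.
Qed.

Lemma cent1_CT_N (w : gT) : #|CT| = 4%N ->
  w \in CT -> w \in center_mod -> w != 1 -> 'C_P[w] = CT * N.
Proof.
move=> oC Cw Zw nt_w; have N'w : w \notin N.
  apply: contra nt_w => Nw; apply/eqP/set1P.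
  by rewrite -[[set 1]]/(1 : {set gT}) -cent1_two_closed_TI inE Cw.
apply/eqP; rewrite eq_sym eqEcard (camina_card_cent1_mod Zw N'w).
rewrite TI_cardMg ?cent1_two_closed_TI // oC oN andbT mul_subG //.
  rewrite subsetI subsetIl; apply/subsetP=> c Cc; apply/cent1P.
  exact: (centsP abelian_CT).
rewrite subsetI sNP; apply/subsetP=> n Nn; apply/cent1P.
by apply: nC => //; case/setIP: Cw.
Qed.

(** [CT * N] is the centralizer of some [w] of the second centre, hence normal in [P]. So the coset
    of [c] has at most 3 conjugates in [P / N], and [cent_mod c] has order more than 16. It is
    [t]-invariant with fixed points [CT], so its order is 64. *)
Lemma CT_center_mod : #|CT| = 4%N -> CT \subset center_mod.
Proof.
move=> oC; have sCP : CT \subset P := subsetIl _ _.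
have [w Cw /andP[Zw nt_w]] := center_mod_cent1 oC.
have Kw := cent1_CT_N oC Cw Zw nt_w; have [Pw wPN] := center_modP _ Zw.
apply/subsetP=> c Cc; have Pc := subsetP sCP c Cc.
have [-> | nt_c] := eqVneq c 1; first exact: group1.
have N'c : c \notin N.
  apply: contra nt_c => Nc; apply/eqP/set1P.
  by rewrite -[[set 1]]/(1 : {set gT}) -cent1_two_closed_TI inE Cc.
have cJ p : p \in P -> c ^ p \in CT * N.
  move=> Pp; rewrite -Kw inE groupJ //=; apply/cent1P.
  have Nwp := wPN p Pp; have -> : w = (w * [~ w, p]) ^ p.
    have wp : w ^ p = w * [~ w, p] by rewrite commgEl mulKVg.
    by rewrite conjMg (nJ Nwp Pp) wp -(mulgA w) (camina_kernel_mulgg cGN Nwp) mulg1.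
  rewrite /commute -!conjMg; congr (_ ^ p); apply: commuteM.
    exact: (centsP abelian_CT).
  by apply/esym; apply: nC.
have clc : coset N c ^: (P / N) \subset (CT / N)^#.
  apply/subsetP=> _ /imsetP[_ /morphimP[p Np Pp ->] ->].
  have Nc := subsetP nNP c Pc; rewrite -morphJ //; apply/setD1P; split.
    rewrite morphJ // conjg_eq1; apply: contra N'c => /eqP.
    exact: coset_idr.
  have /mulsgP[d n Cd Nn ->] := cJ p Pp.
  by rewrite /= coset_kerr // mem_quotient.
have le3 : #|coset N c ^: (P / N)| <= 3.
  apply: leq_trans (subset_leq_card clc) _.
  have := leq_morphim (coset_morphism N) CT; rewrite oC.
  by rewrite -[_ @* _]/(CT / N) (cardsD1 1 (CT / N)) group1 /= add1n.
have oE : 16 < #|cent_mod c|.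
  have oR : #|P / N| = 16 by rewrite card_quotient // -divgS // oP oN.
  have := Lagrange (subsetIl (P / N) 'C[coset N c]); rewrite index_cent1 oR.
  move=> lag; rewrite ltnNge card_cosetpre oN -[16]/(4 * 4)%N leq_pmul2l //.
  by apply/negP=> le4; have := leq_mul le4 le3; rewrite lag.
have nEt : t \in 'N(cent_mod c).
  rewrite inE; apply/subsetP=> _ /imsetP[p Ep ->].
  have Pp := subsetP (cent_mod_sub c) p Ep; rewrite mem_cent_mod // in Ep.
  have ct : c ^ t = c by apply/conjg_fixP/commgP/cent1P; case/setIP: Cc.
  by rewrite mem_cent_mod ?memJ_norm // -ct -conjRg memJN.
have CE : 'C_(cent_mod c)[t] = CT.
  apply/eqP; rewrite eqEsubset setSI ?cent_mod_sub //= subsetI subsetIr andbT.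
  by apply/subsetP=> d Cd; rewrite mem_cent_mod ?(subsetP sCP) // CT_comm.
apply: cent_mod_center => //; suff <- : cent_mod c :=: P by [].
apply/eqP; rewrite eqEcard cent_mod_sub oP.
have := card_invariant (cent_mod_sub c) nEt; rewrite CE oC !inE => /(_ erefl).
by case/or4P=> /eqP oEE; rewrite oEE in oE *.
Qed.

(** The square of [x] centralizes [w], hence lies in [CT * N]. If its factor [c] in [CT] were
    nontrivial, [x] would commute with [c] and so lie in ['C_P[c]], which is [CT * N]. *)
Lemma sq_outside_CT (x : gT) : #|CT| = 4%N -> x \in P -> x \notin CT * N -> x * x \in N.
Proof.
move=> oC Px K'x; have [w Cw /andP[Zw nt_w]] := center_mod_cent1 oC.
have Kw := cent1_CT_N oC Cw Zw nt_w; have [Pw wPN] := center_modP _ Zw.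
have : x * x \in 'C_P[w].
  rewrite inE groupM //=; apply/cent1P/commute_sym/commgP.
  rewrite commgMJ (nJ (wPN x Px) Px) (camina_kernel_mulgg cGN) ?wPN //.
rewrite Kw => /mulsgP[c n Cc Nn Dxx].
have [c1 | nt_c] := eqVneq c 1; first by rewrite Dxx c1 mul1g.
case/negP: K'x; rewrite -(cent1_CT_N oC Cc (subsetP (CT_center_mod oC) c Cc) nt_c).
rewrite inE Px; apply/cent1P; have -> : c = x * x * n^-1 by rewrite Dxx mulgK.
apply: commuteM; first by apply: commuteM.
by apply/esym; apply: nC; rewrite ?groupV.
Qed.

Lemma sq_CT4 (x : gT) : #|CT| = 4%N -> x \in P -> x * x \in N.
Proof.
move=> oC Px; have sCP : CT \subset P := subsetIl _ _.
have oK : #|CT * N| = 16 by rewrite TI_cardMg ?cent1_two_closed_TI // oC oN.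
have [Kx | ] := boolP (x \in CT * N); last exact: sq_outside_CT.
(* For [x] inside [CT * N], compare the squares of [y] and [y * x], both outside: up to a commutator
   in [N] they differ by the square of [x]. *)
have [y Py K'y] : exists2 y, y \in P & y \notin CT * N.
  by apply/subsetPn; apply/negP=> /subset_leq_card; rewrite oP oK.
have nCN : CT <*> N = CT * N by rewrite norm_joinEl // (subset_trans sCP).
have K'yx : y * x \notin CT * N.
  by move: Kx K'y; rewrite -nCN => Kx K'y; rewrite groupMr.
have Zx : x \in center_mod.
  case/mulsgP: Kx => c n Cc Nn ->.
  exact: groupM (subsetP (CT_center_mod oC) c Cc) (subsetP sub_center_mod n Nn).
have [_ /(_ y Py) Nxy] := center_modP _ Zx.
have := sq_outside_CT oC (groupM Py Px) K'yx.
move: [~ x, y] (Nxy) (commgC x y) => n Nn xy Nyx.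
rewrite (_ : x * x = (y * y)^-1 * (y * x * (y * x)) * n^-1).
  by apply: groupM (groupM _ Nyx) (groupVr Nn); rewrite groupV sq_outside_CT.
apply: (mulIg n); rewrite mulgKV; apply: (mulgI (y * y)); rewrite mulKVg.
by rewrite -!mulgA; congr (y * _); rewrite [RHS]mulgA xy -!mulgA (nC Nn Px).
Qed.

Lemma commg_two_closed : {in P &, forall x y, [~ x, y] \in N}.
Proof.
have := card_cent1_two_closed; rewrite !inE => /orP[] /eqP oC x y Px Py.
  by have /center_modP[_ ->] := subsetP (center_mod_free oC) x Px.
apply: (commg_of_sq_mod nNP') => // z; exact: sq_CT4.
Qed.

(** By bilinearity, a square commutes with everything, hence lies in ['Z(P) = N]. *)
Lemma sq_two_closed : {in P, forall x, x * x \in N}.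
Proof.
move=> x Px; rewrite -center_two_closed; apply/centerP; split; first exact: groupM.
move=> y Py; apply/commgP.
rewrite (class2_commMgl cNP commg_two_closed) //.
by rewrite (camina_kernel_mulgg cGN) // commg_two_closed.
Qed.

Lemma commg_onto (w n : gT) : w \in P -> w \notin N -> n \in N ->
  exists2 p, p \in P & [~ w, p] = n.
Proof.
move=> Pw N'w Nn; apply: commg_onto_camina_kernel => // p.
exact: commg_two_closed.
Qed.

Lemma der1_two_closed : P^`(1) = N.
Proof.
apply/eqP; rewrite eqEsubset; apply/andP; split.
  by rewrite gen_subG; apply/subsetP=> _ /imset2P[x y Px Py ->]; apply: commg_two_closed.
have [w Pw N'w] : exists2 w, w \in P & w \notin N.
  by apply/subsetPn; apply/negP=> /subset_leq_card; rewrite oP oN.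
apply/subsetP=> n Nn; have [p Pp <-] := commg_onto Pw N'w Nn.
exact: mem_commg.
Qed.

Lemma Phi_two_closed : 'Phi(P) = N.
Proof.
apply/eqP; rewrite eqEsubset; apply/andP; split.
  apply: (Phi_min pP nNP); apply/abelemP => //; split.
    by rewrite sub_der1_abelian // der1_two_closed.
  move=> _ /morphimP[x Nx Px ->]; rewrite -morphX //.
  by apply: coset_id; apply: sq_two_closed.
by rewrite -der1_two_closed (Phi_joing pP) joing_subl.
Qed.

(** Commutation with an element outside [N] reaches every element of [N], in particular one outside
    [M]; so the centre of [P / M] is just [N / M], of order 2. *)
Lemma semi_extraspecial_two_closed : semi_extraspecial 2 P.
Proof.
split=> // M; rewrite center_two_closed => maxM.
have pN : 2.-group N := pgroupS sNP pP.
have sMN : M \subset N by case/maxgroupP: maxM => /proper_sub.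
have oM : #|M| = 2.
  have := Lagrange sMN; rewrite (p_maximal_index pN maxM) oN.
  by rewrite -[4]/(2 * 2)%N => /eqP; rewrite eqn_pmul2r // => /eqP.
have nMP : P \subset 'N(M).
  by rewrite cents_norm // centsC (subset_trans sMN) // (subset_trans cNP) // subsetIr.
have [n Nn M'n] : exists2 n, n \in N & n \notin M.
  by apply/subsetPn; apply/negP=> /subset_leq_card; rewrite oM oN.
have ZPM : 'Z(P / M) = N / M.
  apply/eqP; rewrite eqEsubset; apply/andP; split; last first.
    by rewrite subsetI quotientS // quotient_cents // (subset_trans cNP) // subsetIr.
  apply/subsetP=> _ /centerP[/morphimP[w Mw Pw ->] cw].
  apply: mem_quotient; apply/idPn=> N'w.
  have [p Pp wp] := commg_onto Pw N'w Nn; case/negP: M'n; rewrite -wp.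
  apply: coset_idr; first by rewrite (subsetP nMP) // groupR.
  rewrite morphR ?(subsetP nMP) //; apply/eqP/commgP/cw.
  exact: mem_quotient.
split; last by rewrite ZPM card_quotient ?(subset_trans sNP) // -divgS // oN oM.
by split; rewrite ZPM -?(quotient_Phi pP) // ?Phi_two_closed // -?quotient_der // der1_two_closed.
Qed.

Let Pt (x : gT) : x \in P -> x ^ t \in P.
Proof. by move=> Px; rewrite memJ_norm. Qed.

Let commR := class2_commgMr cNP commg_two_closed.
Let commL := class2_commMgl cNP commg_two_closed.
Let commS := class2_commg_sym (camina_kernel_mulgg cGN) commg_two_closed.
Let sqM := class2_sqM cNP (camina_kernel_mulgg cGN) commg_two_closed.
Let N2 := camina_kernel_mulgg cGN.
Let commV := class2_commgVr cGN cNP commg_two_closed.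
Let conj2 := conj2_norm3 cGN Gt nPG cNP commg_two_closed sq_two_closed.
Let norm3C := norm3_com oG cGN Gt ot nPG cNP commg_two_closed.

Lemma card_invariant_proper (H K : {group gT}) :
    H \subset K -> ~~ (K \subset H) -> K \subset P ->
    t \in 'N(H) -> t \in 'N(K) ->
    #|'C_H[t]| = 1 %[mod 3] -> #|'C_K[t]| = 1 %[mod 3] ->
  4 * #|H| <= #|K|.
Proof.
move=> sHK nsKH sKP nHt nKt C1 C2; have sHP := subset_trans sHK sKP.
have ltHK : #|H| < #|K| by rewrite proper_card // properE sHK.
have := card_invariant sHP nHt C1; have := card_invariant sKP nKt C2.
rewrite !inE => /or4P[] /eqP oK /or4P[] /eqP oH; rewrite oK oH // in ltHK *.
Qed.

Lemma camina_kernel_gen (u : gT) : u \in N -> u != 1 -> N \subset <<[set u; u ^ t]>>.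
Proof.
move=> Nu nt_u; have Nut := memJN Nu Gt; pose H := <<[set u; u ^ t]>>%G; change (N \subset H).
have sHN : H \subset N by rewrite gen_subG; apply/subsetP=> y /set2P[]->.
have nHt : t \in 'N(H).
  rewrite inE -genJ gen_subG; apply/subsetP=> _ /imsetP[y /set2P[] -> ->].
    by rewrite mem_gen // !inE eqxx orbT.
  by rewrite (camina_kernel_conj2 oG cGN Gt ot Nu) groupM // mem_gen // !inE eqxx ?orbT.
have C1 : #|'C_H[t]| = 1 %[mod 3].
  have : 'C_H[t] \subset CT :&: N.
    apply/subsetP=> y /setIP[Hy cyt]; have Ny := subsetP sHN y Hy.
    by rewrite !in_setI Ny cyt (subsetP sNP).
  by rewrite cent1_two_closed_TI => /trivgP->; rewrite cards1.
have := card_invariant (subset_trans sHN sNP) nHt C1; rewrite !inE.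
have ntH : 1 < #|H|.
  by rewrite cardG_gt1; apply/trivgPn; exists u; rewrite // mem_gen // !inE eqxx.
have leH := subset_leq_card sHN.
case/or4P=> /eqP oH; rewrite ?oH // in ntH leH.
- have /eqP<- : H == N :> {set gT} by rewrite eqEcard sHN oH oN.
  by [].
- by rewrite oN in leH.
by rewrite oN in leH.
Qed.

Lemma two_closed_gen (A : {set gT}) : P \subset <<A>> -> t \in A -> A \subset G -> <<A>> = G.
Proof.
move=> sPA At sAG; apply/eqP; rewrite eqEsubset gen_subG sAG -two_closed_factor.
by rewrite mul_subG // cycle_subG mem_gen.
Qed.

(** * Order 64, with [t] acting freely *)

Section FreeAction.

Hypothesis oC : #|CT| = 1%N.

Lemma free_C1 (K : {group gT}) : K \subset P -> #|'C_K[t]| = 1 %[mod 3].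
Proof.
move=> sKP; have : 'C_K[t] \subset CT by rewrite setSI.
by rewrite (card1_trivg oC) => /trivgP->; rewrite cards1.
Qed.

(** With [t] as a cube root of unity w, the claim is that a factor w in either argument comes out as
    w^2. Since [x * y] commutes with its conjugate, the two mixed commutators agree; the trivial
    norm of their common value then determines it. *)
Lemma free_commg_cross (x y u : gT) : x \in P -> y \in P -> [~ x, y] = u ->
  ([~ x, y ^ t] = u * u ^ t) /\ ([~ x ^ t, y] = u * u ^ t).
Proof.
move=> Px Py xy; have Pxt := Pt Px; have Pyt := Pt Py.
have Nu : u \in N by rewrite -xy commg_two_closed.
have com z : z \in P -> [~ z, z ^ t] = 1.
  by move=> Pz; apply/eqP/commgP/norm3_free_com.
have eq_w : [~ x ^ t, y] = [~ x, y ^ t].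
  have := com _ (groupM Px Py); rewrite conjMg (commL Px Py (groupM Pxt Pyt)).
  rewrite (commR Px Pxt Pyt) (commR Py Pxt Pyt) (com x) // (com y) //.
  rewrite mul1g mulg1 => w1; apply: (mulgI [~ x, y ^ t]).
  by rewrite (commS Py Pxt) w1 N2 // commg_two_closed.
rewrite eq_w; set w := [~ x, y ^ t].
have Nw : w \in N by rewrite commg_two_closed.
have xyt : [~ x ^ t, y ^ t] = u ^ t by rewrite -conjRg xy.
have wt : w ^ t = w * u ^ t.
  rewrite /w conjRg (_ : (y ^ t) ^ t = (y * y ^ t)^-1).
    by rewrite (commV Pxt (groupM Py Pyt)) commR // eq_w xyt.
  have /(canRL (mulKg _)) -> := norm3_free oC Py.
  by rewrite mulg1.
have := camina_kernel_norm3 oG cGN Gt ot Nw; rewrite wt conjMg wt.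
rewrite (camina_kernel_conj2 oG cGN Gt ot Nu); have Nut := memJN Nu Gt.
move: w Nw (u ^ t) Nut {eq_w wt xyt} => w Nw v Nv.
rewrite !mulgA N2 // mul1g (camina_kernelC cGN Nv Nw) => w1.
have wuv : w = u * v.
  apply: (mulIg (u * v)); rewrite [RHS]N2 ?groupM // -w1 mulgA.
  by rewrite -(mulgA w v v) N2 // mulg1.
by rewrite wuv.
Qed.

(** The first four generators span an invariant subgroup of order more than 4, hence at least 16,
    which centralizes [x]. As [y] does not, adjoining it multiplies the order by at least 4. *)
Lemma free_generators (x y u : gT) : x \in P -> y \in P -> u \in N -> u != 1 ->
  x \notin N -> [~ x, y] = u ->
  <<[set z in [:: u; u ^ t; x; x ^ t; y; y ^ t; t]]>> = G.
Proof.
move=> Px Py Nu nt_u N'x xy; have Pxt := Pt Px; have Pyt := Pt Py.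
have Nut := memJN Nu Gt; have Pu := subsetP sNP u Nu; have Put := Pt Pu.
pose H3 := [set u; u ^ t; x; x ^ t]; pose H5 := H3 :|: [set y; y ^ t].
have sH3 : H3 \subset H5 by apply: subsetUl.
have memH3 : [/\ u \in H3, u ^ t \in H3, x \in H3 & x ^ t \in H3].
  by rewrite !inE !eqxx !orbT.
have [H3u H3ut H3x H3xt] := memH3.
have memH5 : [/\ y \in H5 & y ^ t \in H5] by rewrite !inE !eqxx !orbT.
have [H5y H5yt] := memH5.
have sH5P : <<H5>> \subset P.
  rewrite gen_subG; apply/subsetP=> z; rewrite !inE -!orbA.
  by case/or3P=> [|| /or4P[]] /eqP->.
have sH3P : <<H3>> \subset P by apply: subset_trans sH5P; apply: genS.
have xtt (A : {set gT}) z : z \in P -> z \in A -> z ^ t \in A -> (z ^ t) ^ t \in <<A>>.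
  move=> Pz Az Azt; have /(canRL (mulKg _)) -> := norm3_free oC Pz.
  by rewrite mulg1 groupV groupM // mem_gen.
have nH3 : t \in 'N(<<H3>>).
  rewrite inE -genJ gen_subG; apply/subsetP=> _ /imsetP[z + ->].
  rewrite !inE -!orbA.
  by case/or4P=> /eqP->; first [exact: mem_gen | exact: xtt].
have nH5 : t \in 'N(<<H5>>).
  rewrite inE -genJ gen_subG; apply/subsetP=> _ /imsetP[z H5z ->].
  case/setUP: H5z => [H3z | /set2P[]->].
  - apply: subsetP (genS sH3) _ _; rewrite memJ_norm ?mem_gen //.
  - by rewrite mem_gen.
  exact: xtt.
have sNH3 : N \subset <<H3>>.
  apply: subset_trans (camina_kernel_gen Nu nt_u) (genS _).
  by apply/subsetP=> z /set2P[]->.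
have oH3 : 16 <= #|<<H3>>|.
  have := card_invariant sH3P nH3 (free_C1 sH3P).
  have : 4 < #|<<H3>>|.
    rewrite -oN proper_card // properE sNH3; apply: contra N'x => /subsetP-> //.
    exact: mem_gen.
  by rewrite !inE => lt4 /or4P[] /eqP oH; rewrite oH in lt4 *.
apply: two_closed_gen; last 1 first.
- apply/subsetP=> z; rewrite !inE => /or4P[|||/or4P[]] /eqP-> //; exact: subsetP sPG _ _.
- have sH5 : <<H5>> \subset <<[set z in [:: u; u ^ t; x; x ^ t; y; y ^ t; t]]>>.
    apply: genS; apply/subsetP=> z; rewrite !inE -!orbA.
    by case/or3P=> [||/or4P[]] ->; rewrite ?orbT.
  suff <- : <<H5>> = P by [].
  have : 4 * #|<<H3>>| <= #|<<H5>>|.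
    apply: (card_invariant_proper (genS sH3) _ sH5P nH3 nH5 (free_C1 sH3P) (free_C1 sH5P)).
    apply/negP=> sH53; have H3y := subsetP sH53 y (mem_gen H5y).
    have : <<H3>> \subset 'C[x].
      rewrite gen_subG; apply/subsetP=> z; rewrite !in_setU !in_set1 -!orbA.
      case/or4P=> /eqP->; apply/cent1P => //.
      - exact: nC.
      - exact: nC.
      by apply/commute_sym/norm3_free_com.
    move/subsetP/(_ y H3y)/cent1P/commute_sym/commgP; rewrite xy.
    by move/eqP=> u1; rewrite u1 eqxx in nt_u.
  move=> le4; apply/eqP; rewrite eqEcard sH5P oP.
  by apply: leq_trans le4; rewrite -[64]/(4 * 16)%N leq_mul2l oH3.
by rewrite !inE eqxx !orbT.
Qed.

Lemma order3_cube : t ^+ 3 = 1.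
Proof. by rewrite -ot expg_order. Qed.

Lemma conj_two_closed (x y : gT) : x ^ y = x * [~ x, y].
Proof. by rewrite commgEl mulKVg. Qed.

Lemma conj_com (x y : gT) : [~ x, y] = 1 -> x ^ y = x.
Proof. by move/eqP/conjg_fixP. Qed.

Section FreePair.

Variables x y u : gT.
Hypotheses (Px : x \in P) (Py : y \in P) (xy : [~ x, y] = u).

Let Pxt : x ^ t \in P := Pt Px.
Let Pyt : y ^ t \in P := Pt Py.
Let Nu : u \in N. Proof. by rewrite -xy commg_two_closed. Qed.
Let Nut : u ^ t \in N := memJN Nu Gt.
Let Pu : u \in P := subsetP sNP u Nu.
Let Put : u ^ t \in P := Pt Pu.
Let uu : u * u = 1 := N2 Nu.
Let vv : u ^ t * u ^ t = 1 := N2 Nut.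
Let utt : (u ^ t) ^ t = u * u ^ t := camina_kernel_conj2 oG cGN Gt ot Nu.

Let xyE : x ^ y = x * u. Proof. by rewrite conj_two_closed xy. Qed.
Let xtyE : (x ^ t) ^ y = x ^ t * (u * u ^ t).
Proof. by have [_ <-] := free_commg_cross Px Py xy; rewrite conj_two_closed. Qed.
Let xytE : x ^ (y ^ t) = x * (u * u ^ t).
Proof. by have [<- _] := free_commg_cross Px Py xy; rewrite conj_two_closed. Qed.
Let xtytE : (x ^ t) ^ (y ^ t) = x ^ t * u ^ t.
Proof. by rewrite conj_two_closed -conjRg xy. Qed.

Let com (z : gT) : z \in P -> z ^ (z ^ t) = z.
Proof. by move=> Pz; apply/conj_com/eqP/commgP/norm3_free_com. Qed.
Let xxt : x ^ (x ^ t) = x := com Px.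
Let yyt : y ^ (y ^ t) = y := com Py.

Let norm3 (z : gT) : z \in P -> (z ^ t) ^ t = z * z ^ t * (z * z) * (z * z) ^ t.
Proof.
by move=> Pz; apply: conj2; [| apply: norm3_free_com | apply: norm3_free].
Qed.

Lemma free_pc_sat_hyperbolic : x * x = 1 -> y * y = 1 ->
  pc_sat pres_hyperbolic [:: u; u ^ t; x; x ^ t; y; y ^ t; t].
Proof.
move=> xx yy.
have xtxt : x ^ t * x ^ t = 1 by rewrite -conjMg xx conj1g.
have ytyt : y ^ t * y ^ t = 1 by rewrite -conjMg yy conj1g.
have xtt : (x ^ t) ^ t = x * x ^ t by rewrite norm3 // xx conj1g !mulg1.
have ytt : (y ^ t) ^ t = y * y ^ t by rewrite norm3 // yy conj1g !mulg1.
rewrite /pc_sat /eval_word /= !mulg1.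
by do ![apply/andP; split=> //]; apply/eqP;
  first [done | exact: nJ | exact: order3_cube].
Qed.

Lemma free_pc_sat_elliptic : x * x = u -> y * y = u ^ t ->
  pc_sat pres_elliptic [:: u; u ^ t; x; x ^ t; y; y ^ t; t].
Proof.
move=> xx yy.
have xtxt : x ^ t * x ^ t = u ^ t by rewrite -conjMg xx.
have ytyt : y ^ t * y ^ t = u * u ^ t by rewrite -conjMg yy utt.
have xtt : (x ^ t) ^ t = x * (x ^ t * (u * u ^ t)).
  by rewrite norm3 // xx !mulgA.
have ytt : (y ^ t) ^ t = y * (y ^ t * u).
  rewrite norm3 // yy utt (camina_kernelC cGN Nu Nut) [LHS]mulgA.
  by rewrite -(mulgA (y * y ^ t)) vv mulg1 [RHS]mulgA.
rewrite /pc_sat /eval_word /= !mulg1.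
by do ![apply/andP; split=> //]; apply/eqP;
  first [done | exact: nJ | exact: order3_cube].
Qed.

End FreePair.

Lemma free_satisfies : satisfies pres_hyperbolic G \/ satisfies pres_elliptic G.
Proof.
have onto (w n : gT) : w \in P -> w \notin N -> n \in N ->
    exists2 p, p \in P & [~ w, p] = n by apply: commg_onto.
have N'comm x y : x \in P -> [~ x, y] != 1 -> y \notin N.
  move=> Px; apply: contra => Ny; apply/commgP/commute_sym; exact: nC.
have [/existsP[x /and3P[Px N'x /eqP xx]] | no_inv] :=
    boolP [exists x : gT, [&& x \in P, x \notin N & x * x == 1]].
  left; have [u Nu nt_u] : exists2 u, u \in N & u != 1.
    by apply/trivgPn; rewrite -cardG_gt1 oN.
  have [y Py xy] := onto x u Px N'x Nu.
  have Pxt := Pt Px; have Nut := memJN Nu Gt.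
  have [z [Pz xz zz]] : exists z, [/\ z \in P, [~ x, z] = u & z * z = 1].
    have [_ xty] := free_commg_cross Px Py xy.
    have xtxt : x ^ t * x ^ t = 1 by rewrite -conjMg xx conj1g.
    have comx : [~ x, x ^ t] = 1 by apply/eqP/commgP/norm3_free_com.
    have Pxxt : x * x ^ t \in P by rewrite groupM.
    (* The square of [a * y] is that of [y] times [[~ a, y]] when [a] squares to 1. For [a] equal to
       [x], [x * x ^ t] and [x ^ t] this commutator runs through the involutions of [N], so it can
       cancel any square. *)
    have shift a : a \in P -> [~ x, a] = 1 -> a * a = 1 -> [~ a, y] = y * y ->
        exists z, [/\ z \in P, [~ x, z] = u & z * z = 1].
      move=> Pa xa aa ay; exists (a * y); split; first exact: groupM.
        by rewrite commR // xa mul1g.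
      by rewrite (sqM Pa Py) aa mul1g ay (N2 (sq_two_closed Py)).
    have := camina_kernel_elements oG cGN Gt ot Nu nt_u (sq_two_closed Py).
    rewrite !inE => /or4P[] /eqP yy.
    - by exists y.
    - by apply: (shift _ Px); rewrite ?commgg ?xy.
    - apply: (shift _ Pxxt).
      + by rewrite commR // commgg comx mulg1.
      + by rewrite (sqM Px Pxt) xx xtxt comx !mulg1.
      by rewrite commL // xy xty yy mulgA N2 // mul1g.
    by apply: (shift _ Pxt); rewrite ?xty.
  exists [:: u; u ^ t; x; x ^ t; z; z ^ t; t]; first exact: free_pc_sat_hyperbolic.
  exact: free_generators Px Pz Nu nt_u N'x xz.
have no_sq z : z \in P -> z \notin N -> z * z != 1.
  move=> Pz N'z; apply: contra no_inv => zz; apply/existsP; exists z.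
  by rewrite Pz N'z zz.
right; have [x Px N'x] : exists2 x, x \in P & x \notin N.
  by apply/subsetPn; apply/negP=> /subset_leq_card; rewrite oP oN.
have Nu := sq_two_closed Px; have nt_u := no_sq x Px N'x.
set u := x * x in Nu nt_u; have Pxt := Pt Px; have Nut := memJN Nu Gt.
have [y Py xy] := onto x u Px N'x Nu.
have [z [Pz xz zz]] : exists z, [/\ z \in P, [~ x, z] = u & z * z = u ^ t].
  have [_ xty] := free_commg_cross Px Py xy.
  have comx : [~ x, x ^ t] = 1 by apply/eqP/commgP/norm3_free_com.
  have xxty : [~ x, x ^ t * y] = u by rewrite commR // comx mul1g.
  (* Passing from [y] to [x ^ t * y] multiplies the square by [u]. As neither square is 1, the
     square of [y] is [u ^ t] or [u * u ^ t], and the passage exchanges these. *)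
  have sq : (x ^ t * y) * (x ^ t * y) = u * (y * y).
    rewrite (sqM Pxt Py) xty -conjMg -/u.
    move: (y * y) (sq_two_closed Py) => n Nn.
    rewrite (camina_kernelC cGN Nut Nn) -mulgA (camina_kernelC cGN Nu Nut).
    by rewrite (mulgA (u ^ t)) (N2 Nut) mul1g (camina_kernelC cGN Nn Nu).
  have := camina_kernel_elements oG cGN Gt ot Nu nt_u (sq_two_closed Py).
  have N'y : y \notin N by apply: (N'comm x); rewrite ?xy.
  have N'xty : x ^ t * y \notin N by apply: (N'comm x); rewrite ?xxty.
  rewrite !inE => /or4P[] /eqP yy.
  - by have := no_sq y Py N'y; rewrite yy eqxx.
  - by have := no_sq _ (groupM Pxt Py) N'xty; rewrite sq yy N2 // eqxx.
  - by exists y.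
  exists (x ^ t * y); split=> //; first exact: groupM.
  by rewrite sq yy mulgA N2 // mul1g.
exists [:: u; u ^ t; x; x ^ t; z; z ^ t; t]; first exact: free_pc_sat_elliptic.
exact: free_generators Px Pz Nu nt_u N'x xz.
Qed.

End FreeAction.

(** * Order 64, with four fixed points of [t] *)

Section FixedPoints.

Hypothesis oC : #|CT| = 4.

Let sCP : CT \subset P := subsetIl _ _.

Lemma CT_conj (c : gT) : c \in CT -> c ^ t = c.
Proof. by case/setIP=> _ /cent1P ct; apply/conjg_fixP/commgP. Qed.

Lemma CT_sq (c : gT) : c \in CT -> c * c = 1.
Proof.
move=> Cc; apply/set1P; rewrite -[[set 1]]/(1 : {set gT}) -cent1_two_closed_TI.
by rewrite inE groupM // sq_two_closed ?(subsetP sCP).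
Qed.

Lemma cent1_CT (c : gT) : c \in CT -> c != 1 -> 'C_P[c] = CT * N.
Proof. by move=> Cc nt_c; apply: cent1_CT_N; rewrite ?(subsetP (CT_center_mod oC)). Qed.

(** Take [p^-1 * p ^ t] for [p] outside [CT * N]. If it were a product of [c] in [CT] and an element
    of [N], its trivial norm would force [c = 1], so [t] would fix the coset of [p] and [p] would
    lie in [CT * N]. *)
Lemma outside_CT_N : exists x : gT,
  [/\ x \in P, x \notin CT * N & x * x ^ t * (x ^ t) ^ t = 1].
Proof.
have oK : #|CT * N| = 16 by rewrite TI_cardMg ?cent1_two_closed_TI // oC oN.
have [p Pp K'p] : exists2 p, p \in P & p \notin CT * N.
  by apply/subsetPn; apply/negP=> /subset_leq_card; rewrite oP oK.
exists (p^-1 * p ^ t); split; first by rewrite groupM ?groupV ?Pt.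
  apply/negP=> /mulsgP[c n Cc Nn Dx].
  have := norm3_commg ot (esym Dx).
  have Pc := subsetP sCP c Cc.
  rewrite (norm3_fixed_mul oG cGN Gt ot nPG pP sNP Pc (CT_conj Cc) Nn) CT_sq // mul1g.
  move=> c1; move: Dx; rewrite c1 mul1g => Dx.
  have Npt : p^-1 * p ^ t \in N by rewrite Dx.
  have [m Nm pm] := fixed_coset_camina_kernel oG cGN Gt ot Npt.
  case/negP: K'p; rewrite -(mulgK m p); apply/mulsgP.
  exists (p * m) m^-1; rewrite ?groupV //; apply/setIP; split.
    by rewrite groupM // (subsetP sNP).
  by apply/cent1P/commgP/conjg_fixP.
exact: (norm3_commg ot (p := p)) (erefl _).
Qed.

Section FixedTriple.

Variables x c d u : gT.
Hypotheses (Px : x \in P) (K'x : x \notin CT * N).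
Hypotheses (norm_x : x * x ^ t * (x ^ t) ^ t = 1).
Hypotheses (Cc : c \in CT) (Cd : d \in CT) (Nu : u \in N) (nt_u : u != 1).
Hypotheses (xc : [~ x, c] = u) (xd : [~ x, d] = u ^ t).

Let Pxt : x ^ t \in P := Pt Px.
Let Pc : c \in P := subsetP sCP c Cc.
Let Pd : d \in P := subsetP sCP d Cd.
Let Nut : u ^ t \in N := memJN Nu Gt.
Let Pu : u \in P := subsetP sNP u Nu.
Let Put : u ^ t \in P := Pt Pu.
Let utt : (u ^ t) ^ t = u * u ^ t := camina_kernel_conj2 oG cGN Gt ot Nu.
Let ct : c ^ t = c := CT_conj Cc.
Let dt : d ^ t = d := CT_conj Cd.
Let xtt := conj2 Px (norm3C Px norm_x) norm_x.

Lemma fixed_generators : <<[set z in [:: u; u ^ t; x; x ^ t; c; d; t]]>> = G.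
Proof.
have memA z : z \in [:: u; u ^ t; x; x ^ t; c; d; t] ->
    z \in <<[set z in [:: u; u ^ t; x; x ^ t; c; d; t]]>>.
  by move=> Az; apply: mem_gen; rewrite inE.
set A := [set z in _] in memA *.
have sAG : A \subset G.
  apply/subsetP=> z; rewrite !inE.
  by case/or4P=> [|||/or4P[]] /eqP->; rewrite ?Gt ?(subsetP sPG).
have At : t \in A by rewrite !inE eqxx !orbT.
(* [K] properly contains [CT * N] of order 16 and has the four fixed points of [t], so its order is
   a power of 4 above 16. *)
apply: two_closed_gen => //; pose K := (P :&: <<A>>)%G.
have nKt : t \in 'N(K).
  by apply/normP; rewrite conjIg (normP nPt) conjGid // mem_gen.
have sKP : K \subset P := subsetIl _ _.
have Ac : c \in <<A>> by rewrite memA ?inE ?eqxx ?orbT.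
have Ad : d \in <<A>> by rewrite memA ?inE ?eqxx ?orbT.
have sCA : CT \subset <<A>>.
  have sH : <<[set c; d]>> \subset CT.
    by rewrite gen_subG; apply/subsetP=> z /set2P[]->.
  have sHA : <<[set c; d]>> \subset <<A>>.
    by rewrite gen_subG; apply/subsetP=> z /set2P[]->.
  apply: subset_trans sHA; suff -> : <<[set c; d]>> = CT by [].
  have nt_ut : u ^ t != 1 by rewrite conjg_eq1.
  have ntc : c != 1 by apply: contraNneq nt_u => c1; rewrite -xc c1 commg1.
  have ntd : d != 1 by apply: contraNneq nt_ut => d1; rewrite -xd d1 commg1.
  have ncd : c != d.
    apply: contraNneq nt_u => cd; apply/eqP/(camina_kernel_fix oG cGN Gt ot Nu).
    by rewrite -xd -cd.
  apply/eqP; rewrite eqEcard sH oC /=.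
  have : #|<<[set c; d]>>| %| 4 by rewrite -oC cardSg.
  have : 2 < #|<<[set c; d]>>|.
    apply: leq_trans (subset_leq_card (_ : [set 1; c; d] \subset _)).
      by rewrite setUC cardsU1 cards2 eq_sym ntc !inE negb_or ntd eq_sym ncd.
    apply/subsetP=> z; rewrite !inE -orbA => /or3P[] /eqP->; rewrite ?group1 //;
      by rewrite mem_gen // !inE eqxx ?orbT.
  by case: #|_| => [|[|[|[|[|k]]]]] //.
have sNA : N \subset <<A>>.
  apply: subset_trans (camina_kernel_gen Nu nt_u) _.
  by rewrite gen_subG; apply/subsetP=> z /set2P[]->; rewrite memA ?inE ?eqxx ?orbT.
have CK : 'C_K[t] = CT.
  apply/eqP; rewrite eqEsubset setSI //= subsetI subsetIr andbT.
  by rewrite subsetI sCP.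
have oK : 16 < #|K|.
  have <- : #|CT * N| = 16 by rewrite TI_cardMg ?cent1_two_closed_TI // oC oN.
  rewrite proper_card // properE mul_subG ?subsetI ?sCP ?sNP //=.
  apply: contra K'x => /subsetP-> //; rewrite inE Px memA ?inE ?eqxx ?orbT //.
suff <- : K :=: P by apply: subsetIr.
apply/eqP; rewrite eqEcard sKP oP.
have := card_invariant sKP nKt; rewrite CK oC !inE => /(_ erefl).
by case/or4P=> /eqP oKK; rewrite oKK in oK *.
Qed.

Let xcE : x ^ c = x * u. Proof. by rewrite conj_two_closed xc. Qed.
Let xdE : x ^ d = x * u ^ t. Proof. by rewrite conj_two_closed xd. Qed.
Let xtcE : (x ^ t) ^ c = x ^ t * u ^ t.
Proof. by rewrite conj_two_closed -{1}ct -conjRg xc. Qed.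
Let xtdE : (x ^ t) ^ d = x ^ t * (u * u ^ t).
Proof. by rewrite conj_two_closed -{1}dt -conjRg xd utt. Qed.
Let cdE : c ^ d = c. Proof. by apply/conj_com/CT_comm. Qed.
Let xxt : x ^ (x ^ t) = x.
Proof. by apply/conj_com/eqP/commgP/norm3C. Qed.
Let uu : u * u = 1 := N2 Nu.
Let vv : u ^ t * u ^ t = 1 := N2 Nut.
Let cc : c * c = 1 := CT_sq Cc.
Let dd : d * d = 1 := CT_sq Cd.

Lemma fixed_pc_sat_split : x * x = 1 ->
  pc_sat pres_split [:: u; u ^ t; x; x ^ t; c; d; t].
Proof.
move=> xx; have xtxt : x ^ t * x ^ t = 1 by rewrite -conjMg xx conj1g.
have xttE : (x ^ t) ^ t = x * x ^ t by rewrite xtt xx conj1g !mulg1.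
rewrite /pc_sat /eval_word /= !mulg1.
by do ![apply/andP; split=> //]; apply/eqP;
  first [done | exact: nJ | exact: order3_cube].
Qed.

Lemma fixed_pc_sat_homocyclic : x * x = u ->
  pc_sat pres_homocyclic [:: u; u ^ t; x; x ^ t; c; d; t].
Proof.
move=> xx; have xtxt : x ^ t * x ^ t = u ^ t by rewrite -conjMg xx.
have xttE : (x ^ t) ^ t = x * (x ^ t * (u * u ^ t)) by rewrite xtt xx !mulgA.
rewrite /pc_sat /eval_word /= !mulg1.
by do ![apply/andP; split=> //]; apply/eqP;
  first [done | exact: nJ | exact: order3_cube].
Qed.

End FixedTriple.

(** Commutation with [x] is injective on [CT]: a nontrivial element there has centralizer [CT * N],
    which misses [x]. Both [CT] and [N] have order 4. *)
Lemma commg_CT_onto (x n : gT) : x \in P -> x \notin CT * N -> n \in N ->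
  exists2 c, c \in CT & [~ x, c] = n.
Proof.
move=> Px K'x Nn; suff /imsetP[c Cc ->] : n \in [set [~ x, c] | c in CT] by exists c.
suff -> : [set [~ x, c] | c in CT] = N by [].
apply/eqP; rewrite eqEcard; apply/andP; split.
  apply/subsetP=> _ /imsetP[c Cc ->].
  exact: commg_two_closed Px (subsetP sCP c Cc).
rewrite card_in_imset ?oC ?oN // => c d Cc Cd /= eq_cd; apply/eqP.
have Pc := subsetP sCP c Cc; have Pd := subsetP sCP d Cd.
have Ccd : c * d^-1 \in CT by rewrite groupM ?groupV.
have : [~ x, c * d^-1] = 1.
  rewrite commR ?groupV // commV // eq_cd N2 //.
  exact: commg_two_closed.
rewrite eq_mulgV1; apply: contra_eqT => nt_cd; apply: contra K'x => /eqP xcd.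
rewrite -(cent1_CT Ccd nt_cd) inE Px; apply/cent1P/commgP.
by rewrite xcd.
Qed.

Lemma fixed_satisfies : satisfies pres_split G \/ satisfies pres_homocyclic G.
Proof.
have [x [Px K'x norm_x]] := outside_CT_N.
have [xx | nt_xx] := eqVneq (x * x) 1.
  left; have [u Nu nt_u] : exists2 u, u \in N & u != 1.
    by apply/trivgPn; rewrite -cardG_gt1 oN.
  have [c Cc xc] := commg_CT_onto Px K'x Nu.
  have [d Cd xd] := commg_CT_onto Px K'x (memJN Nu Gt).
  exists [:: u; u ^ t; x; x ^ t; c; d; t]; first exact: fixed_pc_sat_split.
  exact: fixed_generators.
right; have Nu := sq_two_closed Px.
have [c Cc xc] := commg_CT_onto Px K'x Nu.
have [d Cd xd] := commg_CT_onto Px K'x (memJN Nu Gt).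
set u := x * x in nt_xx Nu xc xd.
exists [:: u; u ^ t; x; x ^ t; c; d; t]; first exact: fixed_pc_sat_homocyclic.
exact: fixed_generators.
Qed.

End FixedPoints.

Lemma two_closed_satisfies :
  [\/ satisfies pres_hyperbolic G, satisfies pres_elliptic G,
      satisfies pres_split G | satisfies pres_homocyclic G].
Proof.
have := card_cent1_two_closed; rewrite !inE => /orP[] /eqP oC.
  by case: (free_satisfies oC) => sat; [apply: Or41 | apply: Or42].
by case: (fixed_satisfies oC) => sat; [apply: Or43 | apply: Or44].
Qed.

End TwoClosed.

(** * Groups with |O_2(G)| = 32 *)

Lemma index2_coset (gT : finGroupType) (H K : {group gT}) (x y : gT) :
    H \subset K -> #|K| = (2 * #|H|)%N -> x \in K -> x \notin H -> y \in K ->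
  y \notin H -> x^-1 * y \in H.
Proof.
move=> sHK oK Kx H'x Ky H'y; rewrite -mem_lcoset.
suff -> : x *: H = K :\: H by rewrite inE H'y.
apply/eqP; rewrite eqEcard card_lcoset cardsD (setIidPr sHK) oK mul2n -addnn addnK.
rewrite leqnn andbT; apply/subsetP=> _ /lcosetP[h Hh ->].
by rewrite inE groupMr // H'x groupM // (subsetP sHK).
Qed.

Section NotTwoClosed.

Variables (gT : finGroupType) (G N Q : {group gT}) (t : gT).
Hypotheses (oG : #|G| = 192) (cGN : camina_kernel G N).
Hypotheses (Gt : t \in G) (ot : #[t] = 3).
Hypotheses (nQG : Q <| G) (oQ : #|Q| = 32).
Hypothesis maxQ : forall K : {group gT}, K <| G -> 2.-group K -> K \subset Q.

Let sQG : Q \subset G := normal_sub nQG.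
Let nNG : N <| G. Proof. by case: cGN. Qed.
Let oN : #|N| = 4. Proof. by case: cGN. Qed.
Let memJN (n g : gT) := @camina_kernelJ _ _ _ cGN n g.
Let N2 := camina_kernel_mulgg cGN.
Let NC := camina_kernelC cGN.

Let pQ : 2.-group Q.
Proof. by rewrite /pgroup oQ. Qed.

Let sNQ : N \subset Q.
Proof. by apply: maxQ => //; rewrite /pgroup oN. Qed.

Let cNQ : N \subset 'Z(Q) := camina_kernel_central oG cGN nQG pQ sNQ.
Let nC (n q : gT) := @camina_kernel_com _ _ _ oG cGN _ nQG pQ sNQ n q.
Let nJ (n q : gT) := @camina_kernel_conj _ _ _ oG cGN _ nQG pQ sNQ n q.
Let nsNQ : N <| Q := normalS sNQ sQG nNG.
Let nQt : t \in 'N(Q) := subsetP (normal_norm nQG) t Gt.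
Let Qt (x : gT) : x \in Q -> x ^ t \in Q.
Proof. by move=> Qx; rewrite memJ_norm. Qed.

Let CT : {group gT} := 'C_Q[t]%G.
Let sCQ : CT \subset Q := subsetIl _ _.

Let CT_TI : CT :&: N = 1.
Proof.
apply/trivgP/subsetP=> c /setIP[/setIP[_ ct] Nc]; apply/set1P.
exact: cent1_TI_camina_kernel oG cGN Gt ot c Nc ct.
Qed.

Lemma card_core_mod3 (K : {group gT}) : K \subset Q ->
  #|K| \in if #|K| == 1 %[mod 3] then [:: 1; 4; 16]%N else [:: 2; 8; 32]%N.
Proof.
move=> sKQ; have : #|K| %| 32 by rewrite -oQ cardSg.
rewrite dvdn_divisors // -[divisors 32]/[:: 1; 2; 4; 8; 16; 32]%N !inE.
by case/or4P=> [|||/or3P[]] /eqP->.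
Qed.

(** The order is 2 modulo 3, hence 2, 8 or 32, and 32 is too large. If it were 8, [Q] would be
    [CT * N], and a central element of [CT] would be centralized by [Q] and [t]; having at most 2
    conjugates, it would contradict the Camina condition. *)
Lemma card_cent1_core : #|CT| = 2.
Proof.
have := card_core_mod3 sCQ; rewrite -(card_cent1_mod3 ot nQt) oQ !inE.
have oCN : #|(CT * N)%g| = (#|CT| * 4)%N by rewrite TI_cardMg ?CT_TI ?oN.
have sCNQ : CT * N \subset Q by rewrite mul_subG.
case/or3P=> /eqP oC //.
  have CNQ : CT * N = Q by apply/eqP; rewrite eqEcard sCNQ oCN oC oQ.
  have ntC : CT :!=: 1 by rewrite -cardG_gt1 oC.
  have ntZ : 'Z(CT) != 1.
    by apply: contraNneq ntC => /(trivg_center_pgroup (pgroupS sCQ pQ))->.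
  case/trivgPn: ntZ => c /centerP[Cc cC] nt_c.
  have Qc := subsetP sCQ c Cc; have Gc := subsetP sQG c Qc.
  have N'c : c \notin N.
    apply: contra nt_c => Nc; apply/eqP/set1P.
    by rewrite -[[set 1]]/(1 : {set gT}) -CT_TI inE Cc.
  have cQc : Q \subset 'C_G[c].
    rewrite subsetI sQG; apply/subsetP=> q; rewrite -CNQ => /mulsgP[d n Cd Nn ->].
    apply/cent1P/commute_sym/commuteM; first exact: cC.
    by apply/esym; apply: nC.
  have tC : t \in 'C_G[c] by rewrite inE Gt cent1C; case/setIP: Cc.
  have : c *: N \subset c ^: G.
    apply/subsetP=> _ /lcosetP[n Nn ->].
    by case: cGN => _ _ _ _; apply; rewrite // inE N'c.
  move/subset_leq_card; rewrite card_lcoset oN -index_cent1 leqNgt => /negP[].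
  rewrite -divgS ?subsetIl // oG ltn_divLR ?cardG_gt0 //.
  apply: (@leq_trans (4 * 96)%N) => //; rewrite leq_mul2l /= dvdn_leq //.
  rewrite -[96]/(32 * 3)%N Gauss_dvd // -{1}oQ -ot cardSg //=.
  exact: order_dvdG.
by have := subset_leq_card sCNQ; rewrite oCN oC oQ.
Qed.

Section Core.

Variable c : gT.
Hypotheses (Cc : c \in CT) (nt_c : c != 1).

Let Qc : c \in Q := subsetP sCQ c Cc.
Let Gc : c \in G := subsetP sQG c Qc.
Let ct : c ^ t = c.
Proof. by case/setIP: Cc => _ /cent1P ct; apply/conjg_fixP/commgP. Qed.

Let CTE : CT :=: [set 1; c].
Proof.
apply/esym/eqP; rewrite eqEcard cards2 eq_sym nt_c card_cent1_core andbT.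
by apply/subsetP=> d /set2P[]->.
Qed.

Let CT_cases (d : gT) : d \in CT -> d != 1 -> d = c.
Proof. by rewrite CTE => /set2P[->|//]; rewrite eqxx. Qed.

Let cc : c * c = 1.
Proof.
apply/eqP/idPn=> nt_cc; have := CT_cases (groupM Cc Cc) nt_cc.
by rewrite -[RHS]mulg1 => /mulgI/eqP; apply/negP.
Qed.

Let N'c : c \notin N.
Proof.
apply: contra nt_c => Nc; apply/eqP/set1P.
by rewrite -[[set 1]]/(1 : {set gT}) -CT_TI inE Cc.
Qed.

Let CN : {group gT} := (CT <*> N)%G.
Let CNE : CN :=: CT * N.
Proof. by rewrite /= norm_joinEl // (subset_trans sCQ) ?normal_norm. Qed.
Let oCN : #|CN| = 8.
Proof. by rewrite CNE TI_cardMg ?CT_TI // card_cent1_core oN. Qed.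

Lemma core_commgN (q : gT) : q \in Q -> [~ c, q] \in N.
Proof.
move=> Qq; rewrite -(mem_cent_mod nsNQ Qc Qq); move: q Qq; apply/subsetP.
have sEQ := cent_mod_sub nsNQ c; set E := cent_mod Q N c in sEQ *.
have Ec : c \in E by rewrite mem_cent_mod // commgg.
have nEt : t \in 'N(E).
  rewrite inE; apply/subsetP=> _ /imsetP[p Ep ->].
  have Qp := subsetP sEQ p Ep; rewrite mem_cent_mod // in Ep.
  by rewrite mem_cent_mod ?Qt // -ct -conjRg memJN.
have CE : 'C_E[t] = CT.
  apply/eqP; rewrite eqEsubset setSI //= subsetI subsetIr andbT CTE.
  by apply/subsetP=> d /set2P[]->.
have : #|E| \in [:: 2; 8; 32]%N.
  by have := card_core_mod3 sEQ; rewrite (card_cent1_mod3 ot nEt) CE card_cent1_core.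
have sNE : N \subset E.
  apply/subsetP=> n Nn; have Qn := subsetP sNQ n Nn; rewrite mem_cent_mod //.
  by rewrite (_ : [~ c, n] = 1) //; apply/eqP/commgP/commute_sym; apply: nC.
have oE2 : 4 <= #|E| by rewrite -oN subset_leq_card.
rewrite !inE => /or3P[] /eqP oE; rewrite oE // in oE2; last first.
  suff -> : E :=: Q by [].
  by apply/eqP; rewrite eqEcard sEQ oE oQ.
(* If the centralizer of [coset N c] had order 2, it would be the center.    *)
have oR : #|Q / N| = 8 by rewrite card_quotient ?normal_norm // -divgS // oQ oN.
have oC : #|'C_(Q / N)[coset N c]| = 2.
  have := card_cosetpre 'C_(Q / N)[coset N c]%G; rewrite -/E oE oN.
  by rewrite -[8]/(4 * 2)%N => /eqP; rewrite eqn_pmul2l // => /eqP <-.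
have ntR : Q / N != 1 by rewrite -cardG_gt1 oR.
have ntZ : 'Z(Q / N) != 1.
  by apply: contraNneq ntR => /(trivg_center_pgroup (quotient_pgroup N pQ))->.
have Zc : coset N c \in 'Z(Q / N).
  have sZC : 'Z(Q / N) \subset 'C_(Q / N)[coset N c].
    rewrite subsetI subsetIl; apply/subsetP=> z /centerP[_ cz].
    by apply/cent1P/cz/mem_quotient.
  have -> : 'Z(Q / N) = 'C_(Q / N)[coset N c].
    by apply/eqP; rewrite eqEcard sZC oC cardG_gt1.
  by rewrite inE mem_quotient //=; apply/cent1P.
have sRC : Q / N \subset 'C_(Q / N)[coset N c].
  by rewrite subsetI subxx sub_cent1; case/setIP: Zc.
by have := subset_leq_card sRC; rewrite oC oR.
Qed.

(** The Frattini argument for the Sylow 3-subgroup [<[t]>] of [Q <*> <[t]>], which has index 2 in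
    [G] and so is normal. *)
Let Frattini : Q * 'N_G(<[t]>) = G.
Proof.
have QtQ : <[t]> \subset 'N(Q) by rewrite cycle_subG.
pose K := (Q <*> <[t]>)%G.
have oK : #|K| = 96.
  rewrite /= norm_joinEr // coprime_cardMg -?orderE ?oQ ?ot //.
have sKG : K \subset G by rewrite join_subG sQG cycle_subG.
have nKG : K <| G.
  by apply: index2_normal; rewrite // -divgS // oG oK.
have sylT : 3.-Sylow(K) <[t]>.
  rewrite pHallE joing_subr /= -/K oK -orderE ot p_part //.
apply/eqP; rewrite eqEsubset mul_subG ?subsetIl //=.
apply/subsetP=> g Gg.
have /mulsgP[k h + Nh ->] : g \in K * 'N_G(<[t]>) by rewrite (Frattini_arg nKG sylT).
rewrite /= norm_joinEr // => /mulsgP[q r Qq Tr ->]; rewrite -mulgA mem_mulg //.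
rewrite groupM // inE (subsetP (normG _)) // andbT.
by apply: subsetP Tr; rewrite cycle_subG.
Qed.

(** The normalizer of [<[t]>] acts on the fixed points of [t] in [Q], and [c] is the only nontrivial
    one. *)
Let normTc (h : gT) : h \in 'N_G(<[t]>) -> c ^ h = c.
Proof.
case/setIP=> Gh nTh; apply: CT_cases; rewrite ?conjg_eq1 //.
rewrite inE memJ_norm ?Qc ?(subsetP (normal_norm nQG)) //=.
have /cycleP[k tk] : t ^ h^-1 \in <[t]> by rewrite memJ_norm ?groupV ?cycle_id.
apply/cent1P/commgP; rewrite -(conjgKV h t) -conjRg conjg_eq1 tk; apply/commgP.
by apply: commuteX; case/setIP: Cc => _ /cent1P.
Qed.

(** The conjugation taking [c] to [c * n] factors through the normalizer of [<[t]>], which fixes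
    [c], followed by an element of [Q]. *)
Lemma core_onto (n : gT) : n \in N -> exists2 q, q \in Q & [~ c, q] = n.
Proof.
move=> Nn; have [_ _ _ _ cam] := cGN.
have /imsetP[g Gg cg] : c * n \in c ^: G by apply: cam; rewrite // inE N'c.
have : g^-1 \in Q * 'N_G(<[t]>) by rewrite Frattini groupV.
case/mulsgP=> q h Qq Nh Dg; exists q^-1; rewrite ?groupV //.
have Dg' : g = h^-1 * q^-1 by rewrite -invMg -Dg invgK.
by rewrite commgEl -(normTc (groupVr Nh)) -conjgM -Dg' -cg (normTc (groupVr Nh)) mulKg.
Qed.

Lemma card_cent1_c : 'C_Q[c] = CN.
Proof.
have clc : c ^: Q = c *: N.
  apply/setP=> y; apply/imsetP/lcosetP=> [[q Qq ->]|[n Nn ->]].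
    by exists [~ c, q]; rewrite ?core_commgN // commgEl mulKVg.
  by have [q Qq <-] := core_onto Nn; exists q; rewrite // commgEl mulKVg.
apply/esym/eqP; rewrite eqEcard oCN; apply/andP; split.
  rewrite CNE mul_subG // subsetI ?sCQ ?sNQ; apply/subsetP=> d.
    by rewrite CTE => /set2P[]->; rewrite ?group1 ?cent1id.
  by move=> Nd; apply/cent1P/nC.
have := Lagrange (subsetIl Q 'C[c]); rewrite index_cent1 clc card_lcoset oN oQ.
by rewrite -[32]/(8 * 4)%N => /eqP; rewrite eqn_pmul2r // => /eqP->.
Qed.

Lemma core_sq (x : gT) : x \in Q -> x * x \in N.
Proof.
move=> Qx; have [| CN'x] := boolP (x \in CN).
  rewrite CNE => /mulsgP[d n Cd Nn ->]; have Qn := subsetP sNQ n Nn.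
  rewrite -mulgA (mulgA n) (nC Nn (subsetP sCQ d Cd)) -mulgA N2 // mulg1.
  by move: Cd; rewrite CTE => /set2P[]->; rewrite ?mulg1 ?cc group1.
have : x * x \in 'C_Q[c].
  rewrite inE groupM //=; apply/cent1P/commute_sym/commgP.
  by rewrite commgMJ (nJ (core_commgN Qx) Qx) N2 ?core_commgN.
rewrite card_cent1_c CNE => /mulsgP[d n Cd Nn Dxx].
have [d1 | nt_d] := eqVneq d 1; first by rewrite Dxx d1 mul1g.
case/negP: CN'x; rewrite -card_cent1_c inE Qx; apply/cent1P.
rewrite -(CT_cases Cd nt_d); have -> : d = x * x * n^-1 by rewrite Dxx mulgK.
apply: commuteM; first by apply: commuteM.
by apply/esym; apply: nC; rewrite ?groupV.
Qed.

Lemma core_commg : {in Q &, forall x y, [~ x, y] \in N}.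
Proof. exact: commg_of_sq_mod nsNQ core_sq. Qed.

Let commR := class2_commgMr cNQ core_commg.
Let commS := class2_commg_sym N2 core_commg.
Let sqM := class2_sqM cNQ N2 core_commg.
Let commV := class2_commgVr cGN cNQ core_commg.
Let norm3C := norm3_com oG cGN Gt ot nQG cNQ core_commg.
Let norm_cN (n : gT) (Nn : n \in N) :=
  norm3_fixed_mul oG cGN Gt ot nQG pQ sNQ Qc ct Nn.

Lemma nil_class_core : nil_class Q = 2.
Proof.
apply/eqP; rewrite eqn_leq nil_class2 ltnNge nil_class1; apply/andP; split.
  apply: subset_trans cNQ; rewrite gen_subG.
  by apply/subsetP=> _ /imset2P[x y Qx Qy ->]; apply: core_commg.
have [n Nn nt_n] : exists2 n, n \in N & n != 1.
  by apply/trivgPn; rewrite -cardG_gt1 oN.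
have [q Qq cq] := core_onto Nn; apply: contra nt_n => /centsP cQQ.
by rewrite -cq; apply/commgP/cQQ.
Qed.

Lemma core_outside : exists x : gT,
  [/\ x \in Q, x \notin CN & x * x ^ t * (x ^ t) ^ t = 1].
Proof.
have [p Qp CN'p] : exists2 p, p \in Q & p \notin CN.
  by apply/subsetPn; apply/negP=> /subset_leq_card; rewrite oQ oCN.
have norm_x := norm3_commg ot (p := p) (erefl _).
exists (p^-1 * p ^ t); split=> //; first by rewrite groupM ?groupV ?Qt.
apply/negP; rewrite CNE => /mulsgP[d n Cd Nn Dx].
have [d1 | nt_d] := eqVneq d 1; last first.
  move: norm_x; rewrite Dx (CT_cases Cd nt_d) norm_cN // cc mul1g => c1.
  by case/eqP: nt_c.
have Npt : p^-1 * p ^ t \in N by rewrite Dx d1 mul1g.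
have [m Nm pm] := fixed_coset_camina_kernel oG cGN Gt ot Npt.
case/negP: CN'p; rewrite -(mulgK m p) CNE; apply/mulsgP.
exists (p * m) m^-1; rewrite ?groupV //; apply/setIP; split.
  by rewrite groupM // (subsetP sNQ).
by apply/cent1P/commgP/conjg_fixP.
Qed.

(** * An invariant complement to [<[c]>] in O_2(G) *)

Section CoreComplement.

Variable x : gT.
Hypotheses (Qx : x \in Q) (CN'x : x \notin CN).
Hypothesis norm_x : x * x ^ t * (x ^ t) ^ t = 1.

Let Qxt : x ^ t \in Q := Qt Qx.
Let cxxt : commute x (x ^ t) := norm3C Qx norm_x.

Let N'x : x \notin N.
Proof. by apply: contra CN'x => Nx; rewrite mem_gen // inE Nx orbT. Qed.

Let nt_xc : [~ x, c] != 1.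
Proof.
apply: contra CN'x => /commgP cxc; rewrite -card_cent1_c inE Qx.
exact/cent1P.
Qed.

Lemma comm_xc_cases (q : gT) : q \in Q -> q \notin 'C_Q[x] ->
  #|'C_Q[x]| = 16 -> [~ x, q] = [~ x, c].
Proof.
move=> Qq A'q oA; have A'c : c \notin 'C_Q[x].
  by rewrite inE Qc; apply: contra nt_xc => /cent1P/commute_sym/commgP.
have := @index2_coset _ 'C_Q[x]%G Q c q (subsetIl _ _).
rewrite oA oQ => /(_ erefl Qc A'c Qq A'q)/setIP[_ /cent1P/commute_sym/commgP].
rewrite commR ?groupV // (commV Qx Qc) => /eqP eq1.
by apply: (mulgI [~ x, c]); rewrite eq1 N2 // core_commg.
Qed.

(** It turns out to have order 16, to equal ['C_Q[x]] and to avoid [c]. *)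
Definition complement : {group gT} := <<N :|: [set x; x ^ t]>>%G.

Lemma complement_sub : complement \subset Q.
Proof.
by rewrite gen_subG subUset sNQ; apply/subsetP=> z /set2P[]->.
Qed.

Let sAQ := complement_sub.

Let sNA : N \subset complement.
Proof. by rewrite sub_gen // subsetUl. Qed.

Lemma mem_complement : x \in complement.
Proof. by rewrite mem_gen // !inE eqxx orbT. Qed.

Let Ax := mem_complement.

Let Axt : x ^ t \in complement.
Proof. by rewrite mem_gen // !inE eqxx !orbT. Qed.

Let xtt : (x ^ t) ^ t = (x * x ^ t)^-1.
Proof. by have /(canRL (mulKg _)) := norm_x; rewrite mulg1. Qed.

Let nAt : t \in 'N(complement).
Proof.
rewrite inE -genJ gen_subG; apply/subsetP=> _ /imsetP[z + ->].
case/setUP=> [Nz | /set2P[]-> //].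
  by rewrite (subsetP sNA) // memJN.
by rewrite xtt groupV; exact: groupM Ax Axt.
Qed.

Let sACx : complement \subset 'C_Q[x].
Proof.
rewrite subsetI complement_sub /= gen_subG subUset; apply/andP; split.
  by apply/subsetP=> n Nn; apply/cent1P/nC.
by apply/subsetP=> z /set2P[]->; apply/cent1P => //; apply: commute_sym.
Qed.

Let A'c : c \notin complement.
Proof.
apply: contra nt_xc => Ac; apply/commgP/commute_sym/cent1P.
by case/setIP: (subsetP sACx c Ac).
Qed.

Let CA1 : 'C_complement[t] = 1.
Proof.
apply/trivgP/subsetP=> d /setIP[Ad ctd]; apply/set1P/eqP/idPn=> nt_d.
have Cd : d \in CT by rewrite inE (subsetP complement_sub).
by case/negP: A'c; rewrite -(CT_cases Cd nt_d).
Qed.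

Let oA : #|complement| = 16.
Proof.
have := card_core_mod3 complement_sub; rewrite (card_cent1_mod3 ot nAt) CA1 cards1 /= !inE.
have : 4 < #|complement|.
  by rewrite -oN proper_card // properE sNA; apply: contra N'x => /subsetP->.
by move=> lt4 /or3P[] /eqP oA; rewrite oA in lt4 *.
Qed.

Let AE : 'C_Q[x] = complement.
Proof.
apply/esym/eqP; rewrite eqEcard sACx oA.
have := cardSg (subsetIl Q 'C[x]); rewrite oQ.
have : 'C_Q[x] \proper Q.
  rewrite properE subsetIl; apply: contra nt_xc => /subsetP/(_ c Qc)/setIP[_].
  by move/cent1P/commute_sym/commgP.
move/proper_card; rewrite oQ dvdn_divisors // -[divisors 32]/[:: 1; 2; 4; 8; 16; 32]%N.
by move=> lt32; rewrite !inE => /or4P[|||/or3P[]] /eqP oC; rewrite oC in lt32 *.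
Qed.

Lemma commx_cases (q : gT) : q \in Q -> [~ x, q] = 1 \/ [~ x, q] = [~ x, c].
Proof.
move=> Qq; have [Cq | C'q] := boolP (q \in 'C_Q[x]).
  by left; apply/eqP/commgP/commute_sym/cent1P; case/setIP: Cq.
by right; apply: comm_xc_cases; rewrite // AE oA.
Qed.

Lemma complement_cover (q : gT) : q \in Q -> q \in complement \/ c * q \in complement.
Proof.
move=> Qq; have [Aq | A'q] := boolP (q \in complement); [by left | right].
have cV : c^-1 = c by apply/eqP; rewrite eq_invg_mul cc.
by rewrite -cV; apply: (@index2_coset _ complement Q) => //; rewrite oA oQ.
Qed.

Lemma complement_elements (a : gT) : a \in complement ->
  exists2 n, n \in N & a \in [:: n; x * n; x ^ t * n; x * x ^ t * n].
Proof.
move=> Aa; have nNA := subset_trans complement_sub (normal_norm nsNQ).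
have oAN : #|complement / N| = 4 by rewrite card_quotient // -divgS // oA oN.
have N'xt : x ^ t \notin N.
  by rewrite memJ_norm // (subsetP (normal_norm nNG)).
have N'xxt : x * x ^ t \notin N.
  by rewrite -groupV -xtt !memJ_norm // (subsetP (normal_norm nNG)).
have N'xVxt : x^-1 * x ^ t \notin N.
  apply/negP=> Nxt; have [m Nm xm] := fixed_coset_camina_kernel oG cGN Gt ot Nxt.
  have : x * m \in 'C_complement[t].
    apply/setIP; split; first exact: groupM mem_complement (subsetP sNA m Nm).
    by apply/cent1P/commgP/conjg_fixP.
  rewrite CA1 => /set1P xm1; case/negP: N'x.
  by rewrite -(mulgK m x) xm1 mul1g groupV.
have eqN y z : y \in complement -> z \in complement ->
    coset N y = coset N z -> y^-1 * z \in N.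
  move=> Ay Az eq_yz; have Ny := subsetP nNA y Ay; have Nz := subsetP nNA z Az.
  apply: coset_idr; first by rewrite groupM ?groupV.
  by rewrite morphM ?groupV // morphV //= eq_yz mulVg.
pose s := [:: 1; x; x ^ t; x * x ^ t].
have Axxt : x * x ^ t \in complement := groupM Ax Axt.
have sA : {subset s <= complement}.
  by move=> z; rewrite !inE => /or4P[] /eqP->.
have neq y z : y \in complement -> z \in complement -> y^-1 * z \notin N ->
    coset N y != coset N z.
  by move=> Ay Az; apply: contraNneq; apply: eqN.
have uniq_s : uniq (map (coset N) s).
  rewrite /= !inE !negb_or !andbT; do ![apply/andP; split]; apply: neq => //.
  - by rewrite invg1 mul1g.
  - by rewrite invg1 mul1g.
  - by rewrite invg1 mul1g.
  - by rewrite mulKg.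
  by rewrite cxxt mulKg.
have sub_s : {subset map (coset N) s <= enum (complement / N)}.
  by move=> _ /mapP[z sz ->]; rewrite mem_enum mem_quotient ?sA.
have [|_ /(_ (coset N a))] := uniq_min_size uniq_s sub_s; first by rewrite -cardE oAN.
rewrite mem_enum mem_quotient // => /mapP[e se /esym/(eqN e a (sA e se) Aa) Nea].
have [n Nn ->] : exists2 n, n \in N & a = e * n by exists (e^-1 * a); rewrite ?mulKVg.
exists n => //; move: se; rewrite !inE.
by case/or4P=> /eqP ->; rewrite ?mul1g eqxx ?orbT.
Qed.

(* [complement] and its conjugate by [g] meet in a [t]-invariant subgroup of *)
(* order at least 8 without nontrivial fixed points, hence coincide.         *)
Lemma complementJ (g : gT) : g \in 'N_G(<[t]>) -> g \in 'N(complement).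
Proof.
move=> NTg; have [Gg nTg] := setIP NTg.
have nQg := subsetP (normal_norm nQG) g Gg.
pose B := (complement :&: complement :^ g)%G.
have sBA : B \subset complement := subsetIl _ _.
have tAg : t \in 'N(complement :^ g).
  have : t ^ g^-1 \in 'N(complement).
    have : t ^ g^-1 \in <[t]> by rewrite memJ_norm ?groupV ?cycle_id.
    by apply: subsetP; rewrite cycle_subG.
  by rewrite normJ mem_conjg.
have nBt : t \in 'N(B).
  by apply/normP; rewrite conjIg (normP nAt) (normP tAg).
have CB1 : 'C_B[t] = 1 by apply/trivgP; rewrite -CA1 setSI.
have sAgQ : complement :^ g \subset Q by rewrite -(normP nQg) conjSg.
have oB : 8 <= #|B|.
  have := mul_cardG complement (complement :^ g)%G; rewrite cardJg oA.
  have : #|complement * complement :^ g| <= 32.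
    by rewrite -oQ subset_leq_card // mul_subG.
  rewrite -/B => leM eqM; rewrite leqNgt; apply/negP=> ltB.
  have := leq_mul leM (ltB : #|B| <= 7); rewrite -[X in X <= _]eqM.
  by [].
have oBE : #|B| = 16.
  have := card_core_mod3 (subset_trans sBA complement_sub).
  rewrite (card_cent1_mod3 ot nBt) CB1 cards1 /= !inE.
  by case/or3P=> /eqP oBB; rewrite oBB in oB *.
have BA : B :=: complement by apply/eqP; rewrite eqEcard sBA oBE oA.
apply/normP/esym/eqP; rewrite eqEcard cardJg leqnn andbT -{1}BA.
exact: subsetIr.
Qed.

End CoreComplement.

(** * The normalizer of [<[t]>] and an element inverting [t] *)

Let NT : {group gT} := 'N_G(<[t]>)%G.

(** For [q] normalizing [<[t]>], the commutator of [q] and [t] lies in both [Q] and [<[t]>], of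
    coprime orders. *)
Let QNT : Q :&: NT = CT.
Proof.
apply/eqP; rewrite eqEsubset; apply/andP; split; last first.
  rewrite subsetI sCQ subsetI (subset_trans sCQ) //=.
  by rewrite cents_norm // cent_cycle subsetIr.
apply/subsetP=> q /setIP[Qq /setIP[Gq nTq]]; rewrite inE Qq; apply/cent1P/commgP.
have : [~ q, t] \in Q :&: <[t]>.
  apply/setIP; split; first by rewrite commgEl groupM ?groupV ?Qt.
  by rewrite commgEr groupM ?cycle_id // memJ_norm // groupV cycle_id.
by rewrite coprime_TIg -?orderE ?oQ ?ot // => /set1P->.
Qed.

Let oNT : #|NT| = 12.
Proof.
have := mul_cardG Q NT; rewrite QNT Frattini oQ oG card_cent1_core.
by rewrite -[(192 * 2)%N]/(32 * 12)%N => /eqP; rewrite eqn_pmul2l // => /eqP.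
Qed.

Lemma core_inverter : exists s : gT,
  [/\ s \in NT, s * s \in CT, t ^ s = t * t
    & forall g, g \in G -> exists k q, q \in Q /\ (g = t ^+ k * q \/ g = t ^+ k * s * q)].
Proof.
have [S0 sylS0] := Sylow_exists 2 NT; have [sS0 pS0 _] := and3P sylS0.
have oS0 : #|S0| = 4 by rewrite (card_Hall sylS0) oNT p_part.
have sCS0 : CT \subset S0.
  apply: subset_trans (pcore_sub_Hall sylS0); apply: pcore_max.
    exact: pgroupS sCQ pQ.
  by rewrite /normal -QNT subsetIr normsI ?normG // (subset_trans (subsetIl _ _)) ?normal_norm.
have [s Ss C's] : exists2 s, s \in S0 & s \notin CT.
  by apply/subsetPn; apply/negP=> /subset_leq_card; rewrite oS0 card_cent1_core.
have NTs := subsetP sS0 s Ss; have [Gs nTs] := setIP NTs.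
have S0E h : h \in S0 -> exists2 d, d \in CT & h = d \/ h = s * d.
  move=> Sh; have [Ch | C'h] := boolP (h \in CT); first by exists h; [|left].
  exists (s^-1 * h); last by right; rewrite mulKVg.
  by apply: (@index2_coset _ CT S0) => //; rewrite oS0 card_cent1_core.
have NTE : <[t]> * S0 = NT.
  apply/eqP; rewrite eqEcard mul_subG //; last first.
    by rewrite subsetI cycle_subG Gt normG.
  by rewrite coprime_cardMg -?orderE ?ot ?oS0 // oNT.
have ss : s * s \in CT.
  rewrite -groupV invMg; apply: (@index2_coset _ CT S0) => //; rewrite ?groupV //.
  by rewrite oS0 card_cent1_core.
exists s; split=> //; last first.
  move=> g Gg; have : g^-1 \in Q * NT by rewrite Frattini groupV.
  case/mulsgP=> q h Qq; rewrite -groupV -NTE => /mulsgP[r y /cycleP[k ->] Sy Dh] Dg.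
  have [d Cd Dy] := S0E y Sy; exists k, (d * q^-1).
  split; first exact: groupM (subsetP sCQ d Cd) (groupVr Qq).
  rewrite -[g]invgK Dg invMg Dh.
  by case: Dy => ->; [left | right]; rewrite !mulgA.
have /cycleP[k tsk] : t ^ s \in <[t]> by rewrite memJ_norm ?cycle_id.
have nt_ts : t ^ s != 1 by rewrite conjg_eq1 -order_gt1 ot.
(* If [s] centralized [t], then [Q <*> S0] would be normalized by [t] and by itself, hence a normal
   2-subgroup of order 64, against the maximality of [Q]. *)
have nt_tst : t ^ s != t.
  apply/eqP=> tst; pose S1 := (Q <*> S0)%G.
  have nQS0 : S0 \subset 'N(Q) by rewrite (subset_trans sS0) // (subset_trans _ (normal_norm nQG)) ?subsetIl.
  have QS0 : Q :&: S0 = CT.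
    apply/eqP; rewrite eqEsubset subsetI sCQ sCS0 andbT -QNT setIS //.
  have oS1 : #|S1| = 64.
    have := mul_cardG Q S0; rewrite /= norm_joinEr // QS0 oQ oS0 card_cent1_core.
    by rewrite -[(32 * 4)%N]/(64 * 2)%N => /eqP; rewrite eqn_pmul2r // => /eqP.
  have nS1t : t \in 'N(S1).
    apply/normP; rewrite conjYg (normP nQt) (_ : S0 :^ t = S0) //.
    apply/normP; rewrite (subsetP (cent_sub _)) //; apply/centP=> h Sh.
    have [d Cd Dh] := S0E h Sh; have ctd : commute t d.
      by apply/commute_sym/cent1P; case/setIP: Cd.
    have cts : commute t s by apply/commgP/conjg_fixP.
    by case: Dh => ->; [| apply: commuteM].
  have sS1G : S1 \subset G by rewrite join_subG sQG (subset_trans sS0) ?subsetIl.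
  have nS1G : S1 <| G.
    rewrite /normal sS1G; apply/setIidPl/eqP; rewrite eqEcard subsetIl oG /=.
    rewrite dvdn_leq // -[192]/(64 * 3)%N Gauss_dvd //; apply/andP; split.
      by rewrite -oS1 cardSg // subsetI sS1G normG.
    by rewrite -ot order_dvdG // inE Gt.
  have pS1 : 2.-group S1 by rewrite /pgroup oS1.
  by have := subset_leq_card (maxQ nS1G pS1); rewrite oS1 oQ.
have Dk : t ^+ k = t ^+ (k %% 3) by rewrite -ot expg_mod_order.
move: nt_ts nt_tst; rewrite tsk Dk; have := ltn_mod k 3.
by case: (k %% 3)%N => [|[|[|]]] //; rewrite ?eqxx // expg1 eqxx.
Qed.

Let outside_commg (y : gT) : y \in Q -> (y \notin CN) = ([~ y, c] != 1).
Proof.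
move=> Qy; congr (~~ _); rewrite -card_cent1_c inE Qy /=.
by apply/cent1P/commgP.
Qed.

Let outside (y : gT) : Prop :=
  [/\ y \in Q, y \notin CN & y * y ^ t * (y ^ t) ^ t = 1].

Let outsideJ (y : gT) : outside y -> outside (y ^ t).
Proof.
case=> Qy CN'y norm_y; split; first exact: Qt.
  by rewrite outside_commg ?Qt // -ct -conjRg conjg_eq1 -outside_commg.
by rewrite -[LHS]conjg1 -?conjMg; have := congr1 (fun z => z ^ t) norm_y;
  rewrite conjMg (conjMg y) conj1g conjg1.
Qed.

Lemma conj_inverter (s y : gT) : t ^ s = t * t -> (y ^ t) ^ s = ((y ^ s) ^ t) ^ t.
Proof. by move=> ts; rewrite -!conjgM conjgC ts !conjgM. Qed.

(** Modulo [N], [t] permutes [x], [x ^ t] and [x * x ^ t] cyclically. As [s] inverts [t], it acts on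
    these three cosets as a transposition, so it fixes one; that coset provides the new [x]. *)
Lemma core_semilinear (s : gT) : s \in NT -> t ^ s = t * t ->
  exists x n, [/\ outside x, n \in N & x ^ s = x * n].
Proof.
move=> NTs ts; have [x [Qx CN'x norm_x]] := core_outside.
have out_x : outside x by split.
have sE (y : gT) := conj_inverter y ts.
have [Gs _] := setIP NTs; have N'x : x \notin N.
  by apply: contra CN'x => Nx; rewrite mem_gen // inE Nx orbT.
have Axs : x ^ s \in complement x.
  rewrite memJ_norm ?mem_complement //.
  exact: (complementJ Qx CN'x norm_x NTs).
have [n Nn] := complement_elements Qx CN'x norm_x Axs.
have Nnt := memJN Nn Gt; have Nntt := memJN Nnt Gt.
rewrite !inE => /or4P[] /eqP xs.
- case/negP: N'x; rewrite -(conjgK s x) xs memJN // groupV //.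
- by exists x, n.
- exists ((x ^ t) ^ t), (n ^ t); split=> //; first exact/outsideJ/outsideJ.
  by rewrite !sE (conj_order3 ot) xs (conjMg (x ^ t)).
exists (x ^ t), ((x * x) ^ t * (n ^ t) ^ t); split.
- exact: outsideJ.
- by rewrite groupM // memJN // core_sq.
have Qxt := Qt Qx; rewrite sE xs.
have -> : ((x * x ^ t * n) ^ t) ^ t = (x ^ t) ^ t * x * (n ^ t) ^ t.
  by rewrite (conjMg (x * x ^ t)) (conjMg x) (conjMg (x ^ t * _)) (conjMg (x ^ t)) (conj_order3 ot).
have /(canRL (mulKg _)) -> := norm_x; rewrite mulg1 invMg mulgKV.
by rewrite (class2_inv cGN core_sq Qxt) (conjMg x x) !mulgA.
Qed.

Lemma core_frame : exists x s : gT,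
  [/\ outside x, s \in NT, s * s = c, t ^ s = t * t
    & x ^ s = x * [~ x, c] ^ t].
Proof.
have [s [NTs ss ts GE]] := core_inverter.
have [x [n [out_x Nn xs]]] := core_semilinear NTs ts.
have [Qx CN'x norm_x] := out_x; have Qxt := Qt Qx.
set u := [~ x, c]; have Nu : u \in N by rewrite core_commg.
have nt_u : u != 1 by rewrite -outside_commg.
have Nut := memJN Nu Gt; have utt := camina_kernel_conj2 oG cGN Gt ot Nu.
have [Gs _] := setIP NTs; have cs := normTc NTs.
have fix_u : u ^ s = u.
  rewrite /u conjRg cs xs (class2_commMgl cNQ core_commg Qx (subsetP sNQ n Nn) Qc).
  have -> : [~ n, c] = 1 by apply/eqP/commgP/nC.
  by rewrite mulg1.
have vs : (u ^ t) ^ s = u * u ^ t by rewrite conj_inverter // fix_u utt.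
have N'x : x \notin N.
  by apply: contra CN'x => Nx; rewrite mem_gen // inE Nx orbT.
have N'xVxt : x^-1 * x ^ t \notin N.
  apply/negP=> Nxt; have [m Nm xm] := fixed_coset_camina_kernel oG cGN Gt ot Nxt.
  have Cxm : x * m \in CT.
    apply/setIP; split; first by rewrite groupM // (subsetP sNQ).
    by apply/cent1P/commgP/conjg_fixP.
  by case/negP: CN'x; rewrite -(mulgK m x) CNE mem_mulg ?groupV.
have N'xVxtt : x^-1 * (x ^ t) ^ t \notin N.
  apply: contra N'xVxt => Nm.
  have -> : x^-1 * x ^ t = ((x^-1 * (x ^ t) ^ t) ^ t)^-1.
    by rewrite conjMg conjVg (conj_order3 ot) invMg invgK.
  by rewrite groupV memJN.
have camx : exists2 g, g \in G & x ^ g = x * u ^ t.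
  have [_ _ _ _ cam] := cGN.
  have /imsetP[g Gg xg] : x * u ^ t \in x ^: G.
    by apply: cam; rewrite // inE N'x (subsetP sQG).
  by exists g.
have [g Gg xg] := camx; have [k [q [Qq Dg]]] := GE g Gg.
have cosN (y m : gT) : y \in Q -> y ^ q = x * m -> m \in N -> x^-1 * y \in N.
  move=> Qy yq Nm; have Nyq : [~ y, q] \in N by rewrite core_commg.
  have -> : y = x * m * [~ y, q]^-1.
    by rewrite -yq {1}(commgEl y q) invMg mulgA mulgV invgK mul1g.
  by rewrite !mulgA mulVg mul1g groupM ?groupV.
have Dk : t ^+ k = t ^+ (k %% 3) by rewrite -ot expg_mod_order.
have t2E (y : gT) : y ^ (t ^+ 2) = (y ^ t) ^ t by rewrite expgS conjgM.
(* The element [g] conjugates [x] to [x * u ^ t]. A power of [t] moves the coset of [x] unless it is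
   trivial, and [q] alone takes [x] only to [x] or [x * u]; so [g = s * q]. *)
have nxq : n = [~ x, q] * u ^ t.
  rewrite Dk in Dg; have lt3 := ltn_mod k 3.
  case: Dg => Dg; rewrite Dg conjgM in xg.
    case: (k %% 3)%N lt3 xg => [|[|[|]]] // _; rewrite ?expg0 ?conjg1 ?expg1 ?t2E.
    - move=> xq; have xqE : [~ x, q] = u ^ t by rewrite commgEl xq mulKg.
      case/negP: nt_u; have [] := commx_cases Qx CN'x norm_x Qq; rewrite xqE.
        by move/eqP; rewrite conjg_eq1.
      by move/(camina_kernel_fix oG cGN Gt ot Nu)->.
    - by move/(cosN _ _ Qxt)/(_ Nut); rewrite (negPf N'xVxt).
    by move/(cosN _ _ (Qt Qxt))/(_ Nut); rewrite (negPf N'xVxtt).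
  rewrite conjgM in xg.
  case: (k %% 3)%N lt3 xg => [|[|[|]]] // _; rewrite ?expg0 ?conjg1 ?expg1 ?t2E.
  - rewrite xs (conjMg x) (nJ Nn Qq) => xq; have : x^-1 * (x ^ q * n) = u ^ t by rewrite xq mulKg.
    rewrite mulgA -commgEl => <-; rewrite mulgA N2 ?mul1g //.
    exact: core_commg.
  - rewrite (conj_inverter x) // xs (conjMg x) (conjMg (x ^ t)) => xq.
    have Nntt := memJN (memJN Nn Gt) Gt.
    have := cosN _ _ (groupM (Qt Qxt) (subsetP sNQ _ Nntt)) xq Nut.
    by rewrite mulgA groupMr // (negPf N'xVxtt).
  rewrite (conj_inverter (x ^ t)) // (conj_inverter x) // (conj_order3 ot) xs.
  rewrite (conjMg x) => xq.
  have Nnt := memJN Nn Gt.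
  have := cosN _ _ (groupM Qxt (subsetP sNQ _ Nnt)) xq Nut.
  by rewrite mulgA groupMr // (negPf N'xVxt).
(* In both cases for [n], conjugating twice by [s] multiplies [x] by [u], so the square of [s] is
   not 1. *)
have ss_c : s * s = c.
  apply: CT_cases => //; apply: contra nt_u => /eqP ss1; apply/eqP.
  apply: (mulgI x); rewrite mulg1 -{2}(conjg1 x) -ss1 conjgM xs conjMg xs -mulgA.
  congr (x * _); rewrite nxq; have [->|->] := commx_cases Qx CN'x norm_x Qq.
    by rewrite mul1g vs (NC Nu Nut) mulgA N2 // mul1g.
  by rewrite -/u (conjMg u) fix_u vs (mulgA u u) N2 // mul1g -mulgA N2 // mulg1.
have [xq1 | xqc] := commx_cases Qx CN'x norm_x Qq.
  by exists x, s; split; rewrite // xs nxq xq1 mul1g.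
exists x, (s * c); have NTc : c \in NT by rewrite -ss_c groupM.
have csc : c * s = s * c by apply/commgP/conjg_fixP.
split=> //; first by rewrite groupM.
- by rewrite -mulgA (mulgA c s) csc -mulgA cc mulg1 ss_c.
- rewrite conjgM ts conjMg (_ : t ^ c = t) //.
  by apply/conjg_fixP/commgP/commute_sym/commgP/conjg_fixP.
rewrite conjgM xs conjMg (nJ Nn Qc) nxq xqc -/u (_ : x ^ c = x * u).
  by rewrite -mulgA (mulgA u u) N2 // mul1g.
by rewrite /u commgEl mulKVg.
Qed.

(** * Relations and generation from the frame [x], [s] *)

Section CoreFrame.

Variables x s : gT.
Hypotheses (out_x : outside x) (NTs : s \in NT) (ss : s * s = c).
Hypotheses (ts : t ^ s = t * t) (xsu : x ^ s = x * [~ x, c] ^ t).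

Let u := [~ x, c].

Let Qx : x \in Q. Proof. by case: out_x. Qed.
Let CN'x : x \notin CN. Proof. by case: out_x. Qed.
Let norm_x : x * x ^ t * (x ^ t) ^ t = 1. Proof. by case: out_x. Qed.
Let Qxt : x ^ t \in Q := Qt Qx.
Let Nu : u \in N := core_commg Qx Qc.
Let Nut : u ^ t \in N := memJN Nu Gt.
Let Qu : u \in Q := subsetP sNQ u Nu.
Let Qut : u ^ t \in Q := Qt Qu.
Let nt_u : u != 1. Proof. by rewrite -outside_commg. Qed.
Let uu : u * u = 1 := N2 Nu.
Let vv : u ^ t * u ^ t = 1 := N2 Nut.
Let utt : (u ^ t) ^ t = u * u ^ t := camina_kernel_conj2 oG cGN Gt ot Nu.
Let xs : x ^ s = x * u ^ t := xsu.
Let xc : x ^ c = x * u. Proof. by rewrite /u commgEl mulKVg. Qed.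
Let xtc : (x ^ t) ^ c = x ^ t * u ^ t. Proof. by rewrite -{1}ct -conjJg xc conjMg. Qed.
Let xxt : x ^ (x ^ t) = x. Proof. by apply/conjg_fixP/commgP/norm3C. Qed.
Let cs : c ^ s = c := normTc NTs.
Let us : u ^ s = u.
Proof.
rewrite /u conjRg cs xs (class2_commMgl cNQ core_commg Qx Qut Qc).
by rewrite (_ : [~ u ^ t, c] = 1) ?mulg1 //; apply/eqP/commgP/nC.
Qed.
Let vs : (u ^ t) ^ s = u * u ^ t. Proof. by rewrite conj_inverter // us utt. Qed.
Let xtt := conj2_norm3 cGN Gt nQG cNQ core_commg core_sq Qx (norm3C Qx norm_x) norm_x.
Let ttt : t ^+ 3 = 1. Proof. by rewrite -ot expg_order. Qed.
Let xts : (x ^ t) ^ s = (x ^ t) ^ t * u.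
Proof.
by rewrite conj_inverter // xs (conjMg x) (conjMg (x ^ t)) (conj_order3 ot).
Qed.

(** The square of [x] is fixed by [s], which fixes [u] and exchanges the two other involutions of
    [N]. *)
Lemma frame_sq : x * x = 1 \/ x * x = u.
Proof.
have Nxx := core_sq Qx; have fix_xx : (x * x) ^ s = x * x.
  rewrite (conjMg x) xs (sqM Qx Qut) vv mulg1.
  by rewrite (_ : [~ x, u ^ t] = 1) ?mulg1 //; apply/eqP/commgP/commute_sym/nC.
have := camina_kernel_elements oG cGN Gt ot Nu nt_u Nxx; rewrite !inE.
case/or4P=> /eqP xx; [by left | by right | |].
  move: fix_xx; rewrite xx vs => /(canRL (mulgK _)); rewrite mulgV => u1.
  by case/eqP: nt_u.
move: fix_xx; rewrite xx (conjMg u) us vs mulgA uu mul1g => /esym.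
by move/(canRL (mulgK _)); rewrite mulgV => u1; case/eqP: nt_u.
Qed.

(** [Q] is the normal Sylow 2-subgroup of the join, so the 2-element [s] would lie in [Q], hence in
    [CT], and commute with [t] instead of inverting it. *)
Let frame_notin : s \notin Q <*> <[t]>.
Proof.
have nQT : <[t]> \subset 'N(Q) by rewrite cycle_subG.
apply/negP=> QTs; suff Cs : s \in CT.
  case/setIP: Cs => _ /cent1P cst; have : t ^ s = t by apply/conjg_fixP/commgP.
  rewrite ts => /(canRL (mulgK _)); rewrite mulgV => t1.
  by move: ot; rewrite t1 order1.
rewrite -QNT inE NTs andbT.
have hallQ : 2.-Sylow(Q <*> <[t]>) Q.
  rewrite pHallE joing_subl /= norm_joinEr // coprime_cardMg -?orderE ?oQ ?ot //.
  by rewrite p_part.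
have nsQ : Q <| Q <*> <[t]> by rewrite /normal joing_subl join_subG normG.
rewrite (mem_normal_Hall hallQ nsQ QTs) /p_elt.
have : #[s] %| 4 by rewrite order_dvdn (expgD s 2 2) !expgS expg0 mulg1 ss cc.
by move/pnat_dvd; apply.
Qed.

Lemma frame_generators : <<[set z in [:: u; u ^ t; x; x ^ t; c; t; s]]>> = G.
Proof.
set S := [set z in _]; pose K := <<S>>%G.
have sK z : z \in [:: u; u ^ t; x; x ^ t; c; t; s] -> z \in K.
  by move=> Sz; rewrite mem_gen // inE.
have Ku : u \in K by apply: sK; rewrite inE eqxx.
have Kut : u ^ t \in K by apply: sK; rewrite !inE eqxx ?orbT.
have Kx : x \in K by apply: sK; rewrite !inE eqxx ?orbT.
have Kxt : x ^ t \in K by apply: sK; rewrite !inE eqxx ?orbT.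
have Kc : c \in K by apply: sK; rewrite !inE eqxx ?orbT.
have Kt : t \in K by apply: sK; rewrite !inE eqxx ?orbT.
have Ks : s \in K by apply: sK; rewrite !inE eqxx ?orbT.
have sNK : N \subset K.
  apply/subsetP=> n /(camina_kernel_elements oG cGN Gt ot Nu nt_u).
  rewrite !inE => /or4P[] /eqP-> //.
  exact: groupM Ku Kut.
have sAK : complement x \subset K.
  by rewrite gen_subG subUset sNK; apply/subsetP=> z /set2P[]->.
have sQK : Q \subset K.
  apply/subsetP=> q /(complement_cover Qx CN'x norm_x)[/(subsetP sAK)// | Acq].
  by rewrite -(mulKg c q) groupM ?groupV // (subsetP sAK).
have sKG : K \subset G.
  have [Gs _] := setIP NTs; rewrite gen_subG; apply/subsetP=> z; rewrite 2!inE.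
  have GQ := subsetP sQG.
  by rewrite !inE; do 5!(case/orP=> [/eqP->|]; first exact: GQ);
    case/orP=> /eqP->.
have sMK : Q <*> <[t]> \subset K by rewrite join_subG sQK cycle_subG.
have oM : #|Q <*> <[t]>| = 96.
  rewrite norm_joinEr ?cycle_subG // coprime_cardMg -?orderE ?oQ ?ot //.
have ltMK : Q <*> <[t]> \proper K.
  by rewrite properE sMK; apply: contra frame_notin => /subsetP->.
apply/eqP; rewrite eqEcard sKG oG /= -/K.
have := cardSg sMK; rewrite oM => /dvdnP[m oK]; rewrite oK.
by have := proper_card ltMK; rewrite oM oK; case: m {oK} => [|[|m]].
Qed.

Lemma frame_pc_sat_split : x * x = 1 ->
  pc_sat pres_dicyclic_split [:: u; u ^ t; x; x ^ t; c; t; s].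
Proof.
move=> xx; have xtxt : x ^ t * x ^ t = 1 by rewrite -conjMg xx conj1g.
have xttE : (x ^ t) ^ t = x * x ^ t by rewrite xtt xx conj1g !mulg1.
have xtsE : (x ^ t) ^ s = x * (x ^ t * u) by rewrite xts xttE -(mulgA x).
rewrite /pc_sat /eval_word /= !mulg1.
by do ![apply/andP; split=> //]; apply/eqP; first [done | exact: nJ | exact: ttt].
Qed.

Lemma frame_pc_sat_homocyclic : x * x = u ->
  pc_sat pres_dicyclic_homocyclic [:: u; u ^ t; x; x ^ t; c; t; s].
Proof.
move=> xx; have xtxt : x ^ t * x ^ t = u ^ t by rewrite -conjMg xx.
have xttE : (x ^ t) ^ t = x * (x ^ t * (u * u ^ t)) by rewrite xtt xx !mulgA.
have xtsE : (x ^ t) ^ s = x * (x ^ t * u ^ t).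
  by rewrite xts xttE (NC Nu Nut) -!(mulgA x) -!(mulgA (x ^ t)) -(mulgA (u ^ t)) uu mulg1.
rewrite /pc_sat /eval_word /= !mulg1.
by do ![apply/andP; split=> //]; apply/eqP; first [done | exact: nJ | exact: ttt].
Qed.

End CoreFrame.

Lemma core_satisfies :
  satisfies pres_dicyclic_split G \/ satisfies pres_dicyclic_homocyclic G.
Proof.
have [x [s [out_x NTs ss ts xs]]] := core_frame.
have genG := frame_generators out_x NTs ss ts.
have [xx|xx] := frame_sq out_x NTs ts xs; [left | right];
  exists [:: [~ x, c]; [~ x, c] ^ t; x; x ^ t; c; t; s] => //.
  exact: frame_pc_sat_split.
exact: frame_pc_sat_homocyclic.
Qed.

End Core.

Let core_generator : exists2 c, c \in CT & c != 1.
Proof. by apply/trivgPn; rewrite -cardG_gt1 card_cent1_core. Qed.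

Lemma not_two_closed_satisfies :
  satisfies pres_dicyclic_split G \/ satisfies pres_dicyclic_homocyclic G.
Proof. by have [c Cc] := core_generator; apply: core_satisfies. Qed.

Lemma nil_class_not_two_closed : nil_class Q = 2.
Proof. by have [c Cc] := core_generator; apply: nil_class_core. Qed.

End NotTwoClosed.

(** * Twisted products *)

Definition F4 : Type := bool * bool.
Definition el : Type := F4 * F4 * F4 * option bool.

HB.instance Definition _ := Finite.copy el
  ((bool * bool) * (bool * bool) * (bool * bool) * option bool)%type.

(* [(a0, a1)] stands for [a0 + a1 w] with [w ^ 2 = w + 1], and [None],       *)
(* [Some false], [Some true] for the residues 0, 1, 2 modulo 3.              *)
Definition f4_add (a b : F4) : F4 := (a.1 (+) b.1, a.2 (+) b.2).

Definition f4_mul (a b : F4) : F4 :=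
  ((a.1 && b.1) (+) (a.2 && b.2),
   (a.1 && b.2) (+) ((a.2 && b.1) (+) (a.2 && b.2))).

Definition f4_sq (a : F4) : F4 := (a.1 (+) a.2, a.2).

Definition f4_rot (k : option bool) (a : F4) : F4 :=
  match k with
  | None => a
  | Some false => (a.2, a.1 (+) a.2)
  | Some true => (a.1 (+) a.2, a.1)
  end.

Definition z3_opp (k : option bool) : option bool :=
  if k is Some b then Some (~~ b) else None.

Definition z3_add (k l : option bool) : option bool :=
  match k, l with
  | None, _ => l
  | _, None => k
  | Some false, Some false => Some true
  | Some true, Some true => Some false
  | _, _ => None
  end.

Definition f4_form := F4 -> F4 -> F4 -> F4 -> F4.

Record twist := Twist {
  tw_form : f4_form;
  tw_b : option bool -> option bool;
  tw_z : option bool -> option bool;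
  tw_frob : bool
}.

Definition f4_act (k : option bool) (f : bool) (x : F4) : F4 :=
  f4_rot k (if f then f4_sq x else x).

Definition z3_twist (k : option bool) (f : bool) (k' : option bool) :=
  z3_add k (if f then z3_opp k' else k').

(* The element [(a, b, z, k)] is the vector [(a, b, z)] followed by the       *)
(* [k]-th power of an automorphism of order 3, which multiplies [a], [b] and *)
(* [z] by the powers of [w] given by [k], [tw_b k] and [tw_z k].  When       *)
(* [tw_frob] holds, the elements with [b] outside the prime field moreover   *)
(* induce the Frobenius automorphism.                                        *)
Definition twisted_mul (T : twist) (p q : el) : el :=
  let: (a, b, z, k) := p in
  let: (a', b', z', k') := q in
  let f := tw_frob T && b.2 in
  let A := f4_act k f a' in
  let B := f4_act (tw_b T k) f b' in
  let Z := f4_act (tw_z T k) f z' in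
  (f4_add a A, f4_add b B, f4_add z (f4_add Z (tw_form T a b A B)),
   z3_twist k f k').

Definition f0 : F4 := (false, false).
Definition f1 : F4 := (true, false).
Definition f2 : F4 := (false, true).
Definition f3 : F4 := (true, true).
Definition f4_elems : seq F4 := [:: f0; f1; f2; f3].

(** An explicit list, so that quantifiers and counts over the 192 elements can be evaluated. *)
Definition el_elems : seq el :=
  [seq (abz, k) | abz <- [seq (ab, z) | ab <- [seq (a, b) | a <- f4_elems,
                                                            b <- f4_elems],
                                        z <- f4_elems],
                  k <- [:: None; Some false; Some true]].

Definition el_one : el := (f0, f0, f0, None).

Lemma mem_el_elems (x : el) : x \in el_elems.
Proof. by case: x => [[[[[] []] [[] []]] [[] []]] [[]|]]; vm_compute. Qed.

Lemma uniq_el_elems : uniq el_elems.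
Proof. by vm_compute. Qed.

Lemma all_elP (p : pred el) : reflect (forall x, p x) (all p el_elems).
Proof. by apply: (iffP allP) => p_all x; [apply/p_all/mem_el_elems | move=> _]. Qed.

Lemma card_count (T : finType) (s : seq T) (p : pred T) :
  uniq s -> (forall x, x \in s) -> #|p| = count p s.
Proof.
move=> Us sT; rewrite cardE -size_filter; apply/perm_size/uniq_perm.
- exact: enum_uniq.
- exact: filter_uniq.
by move=> x; rewrite mem_enum mem_filter sT andbT.
Qed.

Lemma count_el (p : pred el) : #|p| = count p el_elems.
Proof. exact: card_count uniq_el_elems mem_el_elems. Qed.

Lemma count_pairs (T : finType) (s : seq T) (p : pred (T * T)) :
  uniq s -> (forall x, x \in s) ->
  #|p| = count p [seq (x, y) | x <- s, y <- s].
Proof.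
move=> Us sT; apply: card_count.
  by apply: allpairs_uniq => // -[x1 y1] [x2 y2].
by case=> x y; apply/allpairsP; exists (x, y); rewrite !sT.
Qed.

Definition z3_elems : seq (option bool) := [:: None; Some false; Some true].

Definition f4_all (P : F4 -> bool) : bool := all P f4_elems.

(** Associativity reduced to small tables: the form is biadditive and equivariant, the maps giving
    the exponents on [b] and [z] respect the twisted addition, and the Frobenius bit is additive
    because [b] is then not rotated. This avoids testing all triples. *)
Definition twist_ok (T : twist) : bool :=
  [&& f4_all (fun a => f4_all (fun b => f4_all (fun a' => f4_all (fun b' =>
        f4_all (fun c => f4_all (fun d =>
          (tw_form T (f4_add a a') (f4_add b b') c d ==
             f4_add (tw_form T a b c d) (tw_form T a' b' c d)) &&
          (tw_form T c d (f4_add a a') (f4_add b b') ==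
             f4_add (tw_form T c d a b) (tw_form T c d a' b')))))))),
      all (fun k => all (fun f => f4_all (fun a => f4_all (fun b =>
        f4_all (fun c => f4_all (fun d =>
          f4_act (tw_z T k) f (tw_form T a b c d) ==
          tw_form T (f4_act k f a) (f4_act (tw_b T k) f b)
                    (f4_act k f c) (f4_act (tw_b T k) f d))))))
        (if tw_frob T then [:: false; true] else [:: false])) z3_elems,
      all (fun k => all (fun k' => all (fun f =>
          (tw_b T (z3_twist k f k') == z3_twist (tw_b T k) f (tw_b T k')) &&
          (tw_z T (z3_twist k f k') == z3_twist (tw_z T k) f (tw_z T k')))
        [:: false; true]) z3_elems) z3_elems
    & tw_frob T ==> all (fun k => tw_b T k == None) z3_elems].

Lemma f4_allP (P : F4 -> bool) : f4_all P -> forall x, P x.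
Proof. by rewrite /f4_all /= => /and5P[Pa Pb Pc Pd _] [[] []]. Qed.

Lemma mem_z3_elems (k : option bool) : k \in z3_elems.
Proof. by case: k => [[]|]. Qed.

Lemma f4_addA : associative f4_add.
Proof. by move=> a b c; rewrite /f4_add !addbA. Qed.

Lemma f4_addC : commutative f4_add.
Proof. by move=> a b; rewrite /f4_add addbC [X in (_, X)]addbC. Qed.

Lemma f4_addCA : left_commutative f4_add.
Proof. by move=> a b c; rewrite !f4_addA (f4_addC a). Qed.

Lemma f4_actD (k : option bool) (f : bool) : {morph f4_act k f : x y / f4_add x y}.
Proof. by case: k => [[]|]; case: f; do 2!case=> [[] []]. Qed.

(** These maps are the semilinear bijections of F_4, a copy of S_3. *)
Lemma f4_act_comp (k k' : option bool) (f f' : bool) (x : F4) :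
  f4_act k f (f4_act k' f' x) = f4_act (z3_twist k f k') (f (+) f') x.
Proof. by case: k => [[]|]; case: k' => [[]|]; case: f; case: f'; case: x => [[] []]. Qed.

Lemma z3_twistA (k k' k'' : option bool) (f f' : bool) :
  z3_twist k f (z3_twist k' f' k'') = z3_twist (z3_twist k f k') (f (+) f') k''.
Proof. by case: k => [[]|]; case: k' => [[]|]; case: k'' => [[]|]; case: f; case: f'. Qed.

Section TwistedProduct.

Variable T : twist.
Hypothesis okT : twist_ok T.

Let form := tw_form T.

Lemma form_addl (a b a' b' c d : F4) :
  form (f4_add a a') (f4_add b b') c d = f4_add (form a b c d) (form a' b' c d).
Proof.
have /and4P[chk _ _ _] := okT.
by have /f4_allP/(_ b)/f4_allP/(_ a')/f4_allP/(_ b')/f4_allP/(_ c)/f4_allP/(_ d)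
  /andP[/eqP ] := f4_allP chk a.
Qed.

Lemma form_addr (a b a' b' c d : F4) :
  form c d (f4_add a a') (f4_add b b') = f4_add (form c d a b) (form c d a' b').
Proof.
have /and4P[chk _ _ _] := okT.
by have /f4_allP/(_ b)/f4_allP/(_ a')/f4_allP/(_ b')/f4_allP/(_ c)/f4_allP/(_ d)
  /andP[_ /eqP] := f4_allP chk a.
Qed.

Lemma form_act (k : option bool) (f : bool) (a b c d : F4) : (f ==> tw_frob T) ->
  f4_act (tw_z T k) f (form a b c d) =
  form (f4_act k f a) (f4_act (tw_b T k) f b) (f4_act k f c) (f4_act (tw_b T k) f d).
Proof.
have /and4P[_ /allP/(_ k (mem_z3_elems k))/allP/(_ f) chk _ _] := okT => fT.
have f_in : f \in (if tw_frob T then [:: false; true] else [:: false]).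
  by move: fT; case: (f); case: (tw_frob T).
by have /f4_allP/(_ b)/f4_allP/(_ c)/f4_allP/(_ d)/eqP := f4_allP (chk f_in) a.
Qed.

Lemma tw_hom (k k' : option bool) (f : bool) :
  tw_b T (z3_twist k f k') = z3_twist (tw_b T k) f (tw_b T k') /\
  tw_z T (z3_twist k f k') = z3_twist (tw_z T k) f (tw_z T k').
Proof.
have /and4P[_ _ /allP/(_ k (mem_z3_elems k)) + _] := okT.
move/allP/(_ k' (mem_z3_elems k'))/allP/(_ f).
by case: f => /(_ isT)/andP[/eqP-> /eqP->].
Qed.

Lemma tw_frob_mul (k : option bool) (f : bool) (b b' : F4) :
  tw_frob T && (f4_add b (f4_act (tw_b T k) f b')).2 =
  (tw_frob T && b.2) (+) (tw_frob T && b'.2).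
Proof.
have /and4P[_ _ _] := okT; case: (tw_frob T) => // /implyP/(_ isT)/allP eb0.
by have /eqP-> := eb0 k (mem_z3_elems k); case: f.
Qed.

Lemma twisted_mulA : associative (twisted_mul T).
Proof.
case=> [[[a b] z] k] [[[a' b'] z'] k'] [[[a'' b''] z''] k''].
rewrite /twisted_mul; set f := tw_frob T && b.2; set f' := tw_frob T && b'.2.
rewrite tw_frob_mul -/f -/f' z3_twistA.
have [-> ->] := tw_hom k k' f.
rewrite !f4_actD !f4_act_comp !f4_addA; congr (_, _, _, _).
rewrite -/form form_addl form_addr form_act; last first.
  by rewrite /f; case: (tw_frob T); rewrite ?implybT.
rewrite !f4_act_comp -!f4_addA; congr (f4_add _ (f4_add _ _)).
by rewrite [RHS]f4_addCA; congr (f4_add _ _); rewrite f4_addC -f4_addA.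
Qed.

End TwistedProduct.

(* The exponents of the groups considered divide 24. *)
Definition twist_inv (T : twist) (x : el) : el := iter 22 (twisted_mul T x) x.

Definition twisted_law_ok (T : twist) : bool :=
  twist_ok T &&
  all (fun x => (twisted_mul T el_one x == x) &&
                (twisted_mul T (twist_inv T x) x == el_one)) el_elems.

Structure twisted_law := TwistedLaw {
  law_twist :> twist;
  law_ok : twisted_law_ok law_twist
}.

Definition twisted (L : twisted_law) : Type := el.

HB.instance Definition _ (L : twisted_law) := Finite.copy (twisted L) el.

Section TwistedGroup.

Variable L : twisted_law.

Lemma twisted_lawA : associative (twisted_mul L).
Proof. by case/andP: (law_ok L) => okL _; apply: twisted_mulA. Qed.

Lemma twisted_law1 : left_id el_one (twisted_mul L).
Proof. by case/andP: (law_ok L) => _ /all_elP ok x; case/andP: (ok x) => /eqP. Qed.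

Lemma twisted_lawV : left_inverse el_one (twist_inv L) (twisted_mul L).
Proof. by case/andP: (law_ok L) => _ /all_elP ok x; case/andP: (ok x) => _ /eqP. Qed.

End TwistedGroup.

HB.instance Definition _ (L : twisted_law) := Finite_isGroup.Build (twisted L)
  (@twisted_lawA L) (@twisted_law1 L) (@twisted_lawV L).

(** At equal arguments the four forms give the [z]-part of a square. It is ab (isotropic) here and
    a^2 + ab + w b^2 (anisotropic) for the elliptic form. For the last two forms the subgroup b = 0
    of the vector part is elementary abelian, respectively homocyclic of exponent 4. *)
Definition form_hyperbolic : f4_form := fun a b a' b' => f4_mul a b'.
Definition form_elliptic : f4_form := fun a b a' b' =>
  f4_add (f4_mul a b')
         (f4_add (f4_mul a a') (f4_mul f2 (f4_mul b b'))).
Definition form_split : f4_form := fun a b a' b' => f4_mul b a'.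
Definition form_homocyclic : f4_form := fun a b a' b' =>
  f4_add (f4_mul b a') (f4_sq (f4_mul a a')).

Definition law_hyperbolic : twisted_law.
Proof. by exists (Twist form_hyperbolic id z3_opp false); vm_compute. Defined.
Definition law_elliptic : twisted_law.
Proof. by exists (Twist form_elliptic id z3_opp false); vm_compute. Defined.
Definition law_split : twisted_law.
Proof. by exists (Twist form_split (fun=> None) id false); vm_compute. Defined.
Definition law_homocyclic : twisted_law.
Proof. by exists (Twist form_homocyclic (fun=> None) id false); vm_compute. Defined.
(** With the Frobenius twist the elements with a = z = 0 form a dicyclic group of order 12: [f2] has
    order 4 and inverts the element of order 3. *)
Definition law_dicyclic_split : twisted_law.
Proof. by exists (Twist form_split (fun=> None) id true); vm_compute. Defined.
Definition law_dicyclic_homocyclic : twisted_law.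
Proof. by exists (Twist form_homocyclic (fun=> None) id true); vm_compute. Defined.

(** * The Camina condition in the models *)

Definition N_elems : seq el :=
  [seq ((f0, f0, z, None) : el) | z <- f4_elems].

(* Conjugation by these elements already realizes the Camina condition.      *)
Definition conj_elems : seq el :=
  [seq ((a, f0, z, None) : el) | a <- f4_elems, z <- f4_elems] ++
  [seq ((f0, b, f0, k) : el) | b <- f4_elems, k <- z3_elems].

(** Conjugacy is written as an equality of two products, which avoids computing inverses as 23rd
    powers. *)
Definition kernel_ok (T : twist) : bool :=
  let mul := twisted_mul T in
  [&& all (fun n => all (fun m => (mul n m \in N_elems) && (mul n m == mul m n))
             N_elems && (mul n n == el_one)) N_elems,
      all (fun n => all (fun g => has (fun m => mul n g == mul g m) N_elems)
             el_elems) N_elems,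
      all (fun n => (n == el_one) || all (fun m => (m == el_one) ||
             has (fun h => mul n h == mul h m) conj_elems) N_elems) N_elems
    & all (fun g => (g \in N_elems) || all (fun n =>
             has (fun h => mul g h == mul h (mul g n)) conj_elems) N_elems)
        el_elems].

Section TwistedKernel.

Variable L : twisted_law.
Hypothesis okL : kernel_ok L.

Local Notation gT := (twisted L).

Definition kernel_set : {set gT} := [set x : gT | (x : el) \in N_elems].

Lemma in_kernel (x : gT) : (x \in kernel_set) = ((x : el) \in N_elems).
Proof. by rewrite inE. Qed.

Lemma kernel_group_set : group_set kernel_set.
Proof.
have /and4P[/allP chk _ _ _] := okL; apply/group_setP; split; first by rewrite inE.
move=> x y; rewrite !in_kernel => Nx Ny.
by have /andP[/allP/(_ y Ny)/andP[]] := chk x Nx.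
Qed.

Definition kernel_group : {group gT} := Group kernel_group_set.

Lemma card_twisted : #|[set: gT]| = 192.
Proof. by rewrite cardsT (card_prod _ _); rewrite !card_prod card_option card_bool. Qed.

Lemma card_kernel_group : #|kernel_group| = 4.
Proof. by rewrite cardsE (count_el (fun x => x \in N_elems)). Qed.

Lemma conj_eqP (x h y : gT) : x * h == h * y -> x ^ h = y.
Proof. by move/eqP=> xh; rewrite /conjg xh mulKg. Qed.

Lemma kernel_normal : kernel_group <| [set: gT].
Proof.
have /and4P[_ /allP chk _ _] := okL.
rewrite /normal subsetT; apply/subsetP=> g _; rewrite inE.
apply/subsetP=> _ /imsetP[n + ->]; rewrite !in_kernel => Nn.
have /allP/(_ g (mem_el_elems g))/hasP[m Nm] := chk n Nn.
by move/(@conj_eqP n g m)->.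
Qed.

Lemma twisted_camina : camina_kernel [set: gT]%G kernel_group.
Proof.
have /and4P[/allP chk1 _ /allP chk2 /allP chk3] := okL.
have oN := card_kernel_group; split=> //; first exact: kernel_normal.
- apply/abelemP=> //; split.
    apply/centsP=> x + y +; rewrite !in_kernel => Nx Ny.
    by have /andP[/allP/(_ y Ny)/andP[_ /eqP]] := chk1 x Nx.
  by move=> x; rewrite in_kernel => Nx; have /andP[_ /eqP] := chk1 x Nx.
- move=> n /setD1P[nt_n Kn].
  have -> : n ^: [set: gT] = kernel_group^#.
    apply/eqP; rewrite eqEsubset; apply/andP; split.
      rewrite class_sub_norm; first exact/setD1P.
      by rewrite normD1 normal_norm ?kernel_normal.
    apply/subsetP=> m /setD1P[nt_m Km]; rewrite in_kernel in Kn; rewrite in_kernel in Km.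
    case/orP: (chk2 n Kn) => [n1 | /allP/(_ m Km)/orP[m1 | /hasP[h _]]].
    - by case/negP: nt_n.
    - by case/negP: nt_m.
    by move/(@conj_eqP n h m) <-; apply: memJ_class; rewrite inE.
  by have := cardsD1 1 kernel_group; rewrite oN group1 => -[].
move=> g n /setDP[_ N'g] Nn; rewrite in_kernel in N'g; rewrite in_kernel in Nn.
case/orP: (chk3 g (mem_el_elems g)) => [Ng | /allP/(_ n Nn)/hasP[h _]].
  by case/negP: N'g.
by move/(@conj_eqP g h (g * n)) <-; apply: memJ_class; rewrite inE.
Qed.

Lemma twisted_isaacs : isaacs_group 4 [set: gT]%G.
Proof.
split=> //; first exact: card_twisted.
have [nNG oN _ clN camN] := twisted_camina.
exact: (camina_irr12 card_twisted nNG oN clN camN).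
Qed.

End TwistedKernel.

Definition span_seq (gT : finGroupType) (s : seq gT) : seq gT :=
  foldl (fun l g => l ++ [seq x * g | x <- l]) [:: 1] s.

Lemma span_seq_sub (gT : finGroupType) (G : {group gT}) (s : seq gT) :
  {subset s <= G} -> {subset span_seq s <= G}.
Proof.
rewrite /span_seq; have: {subset [:: 1] <= G} by move=> x /predU1P[->|//].
elim: s [:: 1] => //= g s IHs l lG sG; apply: IHs => [x | x sx].
  rewrite mem_cat => /orP[/lG // | /mapP[y ly ->]].
  by apply: groupM; [exact: lG | apply: sG; exact: mem_head].
by rewrite sG // inE sx orbT.
Qed.

(** [span_seq] uses each listed element at most once. This suffices for generators with exponent 0
    or 1; the square of the generator of order 3, at index [k], is appended for its exponent 2. *)
Lemma twisted_gen (L : twisted_law) (s : seq (twisted L)) (k : nat) :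
    all (mem (span_seq (rcons s (nth 1 s k ^+ 2)))) (el_elems : seq (twisted L)) ->
  <<[set x in s]>> = [set: twisted L].
Proof.
move/allP=> spanT; apply/eqP; rewrite eqEsubset subsetT /=; apply/subsetP=> x _.
have memS y : y \in s -> y \in <<[set x in s]>> by move=> sy; rewrite mem_gen ?inE.
apply: (span_seq_sub (G := <<[set x in s]>>%G)) (spanT x (mem_el_elems x)) => y.
rewrite mem_rcons inE => /predU1P[-> | /memS //]; rewrite groupX //.
by case: (ltnP k (size s)) => [/(mem_nth 1)/memS | /(nth_default 1)->].
Qed.

(** * Counting invariants *)

Lemma pclosed_card (gT : finGroupType) (G : {group gT}) : #|G| = 192 ->
  pclosed 2 G = (#|[set x in G | x ^+ 64 == 1]| == 64).
Proof.
move=> oG; apply/existsP/eqP=> [[P /andP[sylP nPG]] | oA].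
  have oP := card_Sylow2_192 oG sylP; rewrite -[RHS]oP; apply: eq_card => x.
  rewrite inE; apply/andP/idP=> [[Gx /eqP x64] | Px].
    rewrite (mem_normal_Hall sylP nPG) //; apply: (@pnat_dvd _ 64) => //.
    by rewrite order_dvdn x64.
  split; first exact: subsetP (normal_sub nPG) x Px.
  by rewrite -order_dvdn -oP order_dvdG.
have [P sylP] := Sylow_exists 2 G; exists P; rewrite sylP /=.
have [sPG _ _] := and3P sylP; have oP := card_Sylow2_192 oG sylP.
have PE : P :=: [set x in G | x ^+ 64 == 1].
  apply/eqP; rewrite eqEcard oA oP leqnn andbT; apply/subsetP=> x Px.
  by rewrite inE (subsetP sPG) //= -order_dvdn -oP order_dvdG.
rewrite /normal sPG; apply/subsetP=> g Gg; rewrite inE.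
apply/subsetP=> _ /imsetP[x + ->]; rewrite PE !inE => /andP[Gx /eqP x64].
by rewrite groupJ //= -conjXg x64 conj1g.
Qed.

Definition num_cube_roots (gT : finGroupType) (G : {group gT}) : nat :=
  #|[set x in G | x ^+ 3 == 1]|.

(** The identity is counted as an involution. The nested conditionals compare products only for
    pairs of involutions. *)
Definition commuting_involutions (gT : finGroupType) (p : gT * gT) : bool :=
  if p.1 ^+ 2 == 1 then
    if p.2 ^+ 2 == 1 then p.1 * p.2 == p.2 * p.1 else false
  else false.

Definition num_commuting (gT : finGroupType) (G : {group gT}) : nat :=
  #|[set p in setX G G | commuting_involutions p]|.

Lemma leq_isog_invariants (gT hT : finGroupType) (G : {group gT}) (H : {group hT}) :
  G \isog H ->
  num_cube_roots G <= num_cube_roots H /\ num_commuting G <= num_commuting H.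
Proof.
case/isogP=> f injf fGH; have fG x : x \in G -> f x \in H.
  by move=> Gx; rewrite -fGH mem_morphim.
have finj := injmP injf; split.
  rewrite /num_cube_roots -(card_in_imset (f := f)) => [|x y]; last first.
    by rewrite !inE => /andP[Gx _] /andP[Gy _]; apply: finj.
  apply: subset_leq_card; apply/subsetP=> _ /imsetP[x + ->].
  by rewrite !inE => /andP[Gx /eqP x3]; rewrite fG //= -morphX // x3 morph1.
pose f2 (p : gT * gT) := (f p.1, f p.2).
rewrite /num_commuting -(card_in_imset (f := f2)) => [|[x1 x2] [y1 y2]]; last first.
  rewrite !inE /= => /andP[/andP[Gx1 Gx2] _] /andP[/andP[Gy1 Gy2] _] [].
  by move/finj=> -> // /finj->.
apply: subset_leq_card; apply/subsetP=> _ /imsetP[[x y] + ->].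
rewrite !inE /= /commuting_involutions /= => /andP[/andP[Gx Gy]].
case: eqP => // x2; case: eqP => // y2 /eqP xy; rewrite !fG //=.
by rewrite -!morphX // -!morphM // x2 y2 xy !morph1 !eqxx.
Qed.

Lemma isog_invariants (gT hT : finGroupType) (G : {group gT}) (H : {group hT}) :
  G \isog H ->
  (num_cube_roots G, num_commuting G) = (num_cube_roots H, num_commuting H).
Proof.
move=> isoGH; have [le1 le2] := leq_isog_invariants isoGH.
rewrite isog_sym in isoGH; have [le3 le4] := leq_isog_invariants isoGH.
by congr pair; apply/eqP; rewrite eqn_leq ?le1 ?le2 ?le3 ?le4.
Qed.

Section TwistedCounts.

Variable L : twisted_law.
Local Notation gT := (twisted L).

Lemma card_twisted_set (p : pred gT) :
  #|[set x in [set: gT] | p x]| = count p (el_elems : seq gT).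
Proof.
by rewrite -(count_el p); apply: eq_card => x; rewrite !inE.
Qed.

Lemma card_twisted_pairs (p : pred (gT * gT)) :
  #|[set q in setX [set: gT] [set: gT] | p q]| =
  count p [seq (x, y) | x <- el_elems : seq gT, y <- el_elems : seq gT].
Proof.
rewrite -(count_pairs p uniq_el_elems mem_el_elems).
by apply: eq_card => q; rewrite !inE.
Qed.

Definition twisted_roots (n : nat) : nat :=
  count (fun x : gT => x ^+ n == 1) (el_elems : seq gT).

Definition twisted_invariants : nat * nat :=
  (twisted_roots 3, count (@commuting_involutions gT)
     [seq (x, y) | x <- el_elems : seq gT, y <- el_elems : seq gT]).

Lemma twisted_invariantsE :
  (num_cube_roots [set: gT]%G, num_commuting [set: gT]%G) = twisted_invariants.
Proof. by rewrite /num_cube_roots /num_commuting card_twisted_set card_twisted_pairs. Qed.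

Lemma pclosed_twisted : pclosed 2 [set: gT]%G = (twisted_roots 64 == 64).
Proof. by rewrite pclosed_card ?card_twisted // card_twisted_set. Qed.

End TwistedCounts.

Lemma twisted_isog_invariants (L M : twisted_law) :
  [set: twisted L] \isog [set: twisted M] ->
  twisted_invariants L = twisted_invariants M.
Proof.
move=> isoLM; rewrite -(twisted_invariantsE L) -(twisted_invariantsE M).
exact: isog_invariants.
Qed.

(** * The six models and their generators *)

Definition gens_hyperbolic : seq el :=
  [:: (f0, f0, f1, None); (f0, f0, f2, None); (f0, f1, f0, None);
      (f0, f3, f0, None); (f1, f0, f0, None); (f3, f0, f0, None);
      (f0, f0, f0, Some false)].

Definition gens_elliptic : seq el :=
  [:: (f0, f0, f2, None); (f0, f0, f3, None); (f0, f1, f0, None);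
      (f0, f3, f0, None); (f2, f0, f0, None); (f1, f0, f0, None);
      (f0, f0, f0, Some false)].

Definition gens_split : seq el :=
  [:: (f0, f0, f1, None); (f0, f0, f3, None); (f1, f0, f0, None);
      (f3, f0, f0, None); (f0, f1, f0, None); (f0, f3, f0, None);
      (f0, f0, f0, Some false)].

Definition gens_dicyclic : seq el :=
  [:: (f0, f0, f1, None); (f0, f0, f3, None); (f1, f0, f0, None);
      (f3, f0, f0, None); (f0, f1, f0, None); (f0, f0, f0, Some false);
      (f0, f2, f0, None)].

Definition law (i : nat) : twisted_law :=
  nth law_hyperbolic
    [:: law_hyperbolic; law_elliptic; law_split; law_homocyclic;
        law_dicyclic_split; law_dicyclic_homocyclic] i.

Definition pres (i : nat) : pc_presentation :=
  nth [::] [:: pres_hyperbolic; pres_elliptic; pres_split; pres_homocyclic;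
               pres_dicyclic_split; pres_dicyclic_homocyclic] i.

Definition gens (i : nat) : seq (twisted (law i)) :=
  nth [::] [:: gens_hyperbolic; gens_elliptic; gens_split; gens_split;
               gens_dicyclic; gens_dicyclic] i.

Lemma ord6_ind (A : 'I_6 -> Prop) :
    (forall lt06, A (@Ordinal 6 0 lt06)) -> (forall lt16, A (@Ordinal 6 1 lt16)) ->
    (forall lt26, A (@Ordinal 6 2 lt26)) -> (forall lt36, A (@Ordinal 6 3 lt36)) ->
    (forall lt46, A (@Ordinal 6 4 lt46)) -> (forall lt56, A (@Ordinal 6 5 lt56)) ->
  forall i, A i.
Proof. by move=> ? ? ? ? ? ? [[|[|[|[|[|[|]]]]]]]. Qed.

Lemma kernel_ok_law (i : 'I_6) : kernel_ok (law i).
Proof. by move: i; apply: ord6_ind; vm_compute. Qed.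

Lemma pc_wf_pres (i : 'I_6) : pc_wf (pres i).
Proof. by move: i; apply: ord6_ind; vm_compute. Qed.

Lemma pc_order_pres (i : 'I_6) : pc_order (pres i) = 192.
Proof.
by move: i; apply: ord6_ind; rewrite /pc_order /= ?big_cons big_nil.
Qed.

Lemma pc_sat_gens (i : 'I_6) : pc_sat (pres i) (gens i).
Proof. by move: i; apply: ord6_ind; vm_compute. Qed.

Lemma gens_generate (i : 'I_6) :
  <<[set x in gens i]>> = [set: twisted (law i)].
Proof.
apply: (twisted_gen (k := if i < 4 then 6 else 5)).
by move: i; apply: ord6_ind; vm_compute.
Qed.

Lemma twisted_roots_law (i : 'I_6) : (twisted_roots (law i) 64 == 64) = (i < 4).
Proof. by move: i; apply: ord6_ind; vm_compute. Qed.

(** There are 64 Sylow 3-subgroups when [t] acts freely and 16 otherwise, whence 129 and 33 cube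
    roots of 1; the second entry separates the rest. *)
Lemma twisted_invariants_law (i : 'I_6) : twisted_invariants (law i) =
  nth (0, 0) [:: (129, 496); (129, 16); (33, 496); (33, 400); (33, 304); (33, 208)] i.
Proof. by move: i; apply: ord6_ind; vm_compute. Qed.

(** * Every Isaacs group of degree 4 is one of the models *)

Section IsaacsGroup.

Variables (gT : finGroupType) (G : {group gT}).
Hypothesis isoG : isaacs_group 4 G.

Let oG : #|G| = 192. Proof. by case: isoG. Qed.

Lemma isaacs_semi_extraspecial : #|'O_2(G)| = 64 ->
  semi_extraspecial 2 'O_2(G)%G.
Proof.
move=> oO; have [N cGN] := isaacs_camina oG isoG.
have [||t Gt ot] := @Cauchy _ 3 G; rewrite ?oG //.
exact: semi_extraspecial_two_closed oG cGN Gt ot (pcore_normal 2 G) oO.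
Qed.

Let pcore_maxG (K : {group gT}) : K <| G -> 2.-group K -> K \subset 'O_2(G).
Proof. by move=> nKG pK; apply: pcore_max. Qed.

Lemma isaacs_nil_class : #|'O_2(G)| = 32 -> nil_class 'O_2(G) = 2.
Proof.
move=> oO; have [N cGN] := isaacs_camina oG isoG.
have [||t Gt ot] := @Cauchy _ 3 G; rewrite ?oG //.
exact: nil_class_not_two_closed oG cGN Gt ot (pcore_normal 2 G) oO pcore_maxG.
Qed.

Lemma isaacs_satisfies : exists i : 'I_6, satisfies (pres i) G.
Proof.
have [N cGN] := isaacs_camina oG isoG.
have [||t Gt ot] := @Cauchy _ 3 G; rewrite ?oG //.
have pres_at k (ltk6 : k < 6) : satisfies (pres k) G -> exists i : 'I_6, satisfies (pres i) G.
  by exists (Ordinal ltk6).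
have [oO | oO] := card_pcore_192 oG.
  have [] := two_closed_satisfies oG cGN Gt ot (pcore_normal 2 G) oO.
  - exact: (pres_at 0%N).
  - exact: (pres_at 1%N).
  - exact: (pres_at 2%N).
  exact: (pres_at 3%N).
have [] := not_two_closed_satisfies oG cGN Gt ot (pcore_normal 2 G) oO pcore_maxG.
  exact: (pres_at 4%N).
exact: (pres_at 5%N).
Qed.

Lemma isaacs_isog : exists i : 'I_6, G \isog [set: twisted (law i)].
Proof.
have [i [s sat gen]] := isaacs_satisfies; exists i.
apply: (pc_isog (pc_wf_pres i) sat (pc_sat_gens i) gen (gens_generate i)).
  by rewrite oG pc_order_pres.
by rewrite card_twisted pc_order_pres.
Qed.

End IsaacsGroup.

Lemma card_ord_pred (n : nat) (p : pred nat) :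
  #|[set i : 'I_n | p i]| = count p (iota 0 n).
Proof.
rewrite cardsE (card_count (fun i : 'I_n => p i) (ord_enum_uniq n) (@mem_ord_enum n)).
by rewrite -val_ord_enum count_map.
Qed.

Theorem mainTheorem5 :
  exists (gT : 'I_6 -> finGroupType) (G : forall i : 'I_6, {group gT i}),
    [/\ (forall i : 'I_6, isaacs_group 4 (G i)) /\
        (forall i j : 'I_6, i <> j -> ~ (G i \isog G j)),
        forall (hT : finGroupType) (H : {group hT}),
          isaacs_group 4 H -> exists i : 'I_6, H \isog G i,
        #|[set i : 'I_6 | pclosed 2 (G i)]| = 4 /\
        #|[set i : 'I_6 | ~~ pclosed 2 (G i)]| = 2,
        forall i : 'I_6, pclosed 2 (G i) ->
          exists P : {group gT i},
            [/\ 2.-Sylow(G i) P, P <| G i & semi_extraspecial 2 P]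
      & forall i : 'I_6, ~~ pclosed 2 (G i) -> nil_class 'O_2(G i) = 2].
Proof.
exists (fun i => twisted (law i)), (fun i => [set: twisted (law i)]%G).
have isaacs_law i := twisted_isaacs (kernel_ok_law i).
have pclosed_law (i : 'I_6) : pclosed 2 [set: twisted (law i)]%G = (i < 4).
  by rewrite pclosed_twisted twisted_roots_law.
split.
- split=> [|i j neq_ij /twisted_isog_invariants].
    exact: isaacs_law.
  rewrite !twisted_invariants_law => /eqP; rewrite nth_uniq // => /eqP/val_inj.
  exact: neq_ij.
- by move=> hT H; apply: isaacs_isog.
- have card4 := card_ord_pred 6 (fun k => k < 4).
  have card2 := card_ord_pred 6 (fun k => ~~ (k < 4)).
  split; [rewrite -[RHS]card4 | rewrite -[RHS]card2];
    by apply: eq_card => i; rewrite !inE pclosed_law.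
- move=> i cl; have oG := card_twisted (law i).
  have oO : #|'O_2([set: twisted (law i)])| = 64.
    by apply/eqP; rewrite -[[set: _]]/(gval [set: _]%G) -pclosed_192.
  exists 'O_2([set: twisted (law i)])%G; split.
  - by rewrite pHallE pcore_sub /= oO oG p_part.
  - exact: pcore_normal.
  exact: isaacs_semi_extraspecial.
move=> i; rewrite (pclosed_192 (G := [set: _]%G)) ?card_twisted // => not64.
apply: isaacs_nil_class => //.
have := card_pcore_192 (G := [set: twisted (law i)]%G) (card_twisted (law i)).
by case=> // oO; rewrite /= oO in not64.
Qed.
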